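(* Let $\theta=(\theta_t)_{t\in\mathbb R}$ be a smooth family of $1$-forms with $\theta_{t+1}=\theta_t$ on an open set $\mathfrak Q\subset\mathbb C$ containing $0$, and let $\mathcal A\colon T^*\bar{\mathcal L}^\times\mathfrak Z\to\mathbb R$ be the perturbed symplectic action functional, with Hamiltonian vector field $\mathcal X_\Theta$, Euler vector field $\mathcal Y_\Theta$, canonical vector field $\mathcal V$ and non-local Lorentz force $\mathcal Z_z$ as defined in the context. (a) The critical points of $\mathcal A$ are exactly the solutions $(z,\eta)\in T^*\bar{\mathcal L}^\times\mathfrak Z$ of the delay Euler-Hamilton equation $\mathcal V=\mathcal X_\Theta+\mathcal Y_\Theta$. (b) This equation for $(z,\eta)$ is of the form $$z'=\frac{1}{4\|z\|^2}\eta,\qquad \eta'_\tau=\frac{\|\eta\|^2-8}{4\|z\|^4}z_\tau+\frac1{4\|z\|^2}\Bigl((\mathcal Z_z\eta)_\tau-4|z_0|^2\,\dot{\mathbf a}_{t_z(\tau)}|_{z_\tau}\Bigr).$$ (c) If $\eta=4\|z\|^2z'$, then $\frac1{4\|z\|^2}\bigl((\mathcal Z_z\eta)_\tau-4|z_0|^2\dot{\mathbf a}_{t_z(\tau)}|_{z_\tau}\bigr)=(\operatorname{grad}\mathcal M|_z)_\tau$, where $\mathcal M(z)=\Theta_zz'$. (d) Equivalently, the delay Euler-Hamilton equation is the first order delay differential equation (for $\tau\in[0,1)$) $$\begin{aligned}z'&=\frac1{4\|z\|^2}\eta,\\ \eta'_\tau&=\frac{\|\eta\|^2-8}{4\|z\|^4}z_\tau-\frac{2z_\tau}{\|z\|^4}\int_0^1\Bigl(\int_0^s|z_\sigma|^2d\sigma\Bigr)\langle\dot{\mathbf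 a}_{t_z(s)}|_{z_s},z'_s\rangle_0\,ds\\&\quad+\frac{2z_\tau}{\|z\|^2}\int_\tau^1\langle\dot{\mathbf a}_{t_z(\sigma)}|_{z_\sigma},z'_\sigma\rangle_0\,d\sigma-\frac{|z_\tau|^2}{\|z\|^2}\dot{\mathbf a}_{t_z(\tau)}|_{z_\tau}-\bigl(\operatorname{rot}\mathbf a_{t_z(\tau)}|_{z_\tau}\bigr)\,iz'_\tau.\end{aligned}$$
   Context: Identify $\mathbb C\cong\mathbb R^2$; $\langle\cdot,\cdot\rangle_0$, $|\cdot|$ Euclidean; $\|\cdot\|$, $\langle\cdot,\cdot\rangle$ the $L^2([0,1],\mathbb R^2)$ norm and inner product; $z_\tau=z(\tau)$. $\varsigma(z)=z^2$, $\mathfrak Z=\varsigma^{-1}(\mathfrak Q)$, $\vartheta_t=\varsigma^*\theta_t=a^1_tdx+a^2_tdy$, $\mathbf a_t=(a_t^1,a_t^2)$, dot $=\partial_t$, $\operatorname{rot}\mathbf a_t=\partial_xa_t^2-\partial_ya_t^1$. Loop space: $\mathcal L_\pm\mathfrak Z=\{z\in C^\infty(\mathbb R,\mathfrak Z):z(\tau+1)=\pm z(\tau)\}$, $\mathcal L_\pm^\times\mathfrak Z=\mathcal L_\pm\mathfrak Z\setminus\{0\}$, $\mathcal L_\pm\mathbb C$ likewise; $\bar{\mathcal L}^\times\mathfrak Z$ is the quotient of $\mathcal L^\times_+\mathfrak Z\cup\mathcal L^\times_-\mathfrak Z$ by $z\sim-z$; tangent vectors at $z\in\mathcal L^\times_\pm\mathfrak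 Z$ are $\xi\in\mathcal L_\pm\mathbb C$. $T^*\bar{\mathcal L}^\times\mathfrak Z$ is the quotient of $(\mathcal L_+^\times\mathfrak Z\times\mathcal L_+\mathbb C)\cup(\mathcal L_-^\times\mathfrak Z\times\mathcal L_-\mathbb C)$ by $(z,\eta)\sim-(z,\eta)$, $\pi(z,\eta)=z$; tangent vectors are pairs $(\hat z,\hat\eta)\in\mathcal L_\pm\mathbb C\times\mathcal L_\pm\mathbb C$. Everything is compatible with the sign involution. $t_z(\tau)=\|z\|^{-2}\int_0^\tau|z_s|^2ds$, with derivative in $z$: $(dt|_z\xi)_\tau=\frac2{\|z\|^2}\int_0^\tau\langle z_\sigma,\xi_\sigma\rangle_0d\sigma-\frac{2\langle z,\xi\rangle}{\|z\|^4}\int_0^\tau|z_\sigma|^2d\sigma$. Magnetic $1$-form on loop space: $\Theta_z\xi=\int_0^1\vartheta_{t_z(\tau)}|_{z_\tau}\xi_\tau d\tau$; its exterior derivative is $d\Theta_z(\xi,\zeta)=\int_0^1\bigl(d\vartheta_{t_z}|_z(\xi,\zeta)+(dt|_z\xi)\dot\vartheta_{t_z}|_z\zeta-(dt|_z\zeta)\dot\vartheta_{t_z}|_z\xi\bigr)_\tau d\tau$, an $L^2$-continuous bilinear form. The Lorentz force $\mathcal Z_z$ is determined by $\langle\mathcal Z_z\eta,\cdot\rangle=-d\Theta_z(\eta,\cdot)$ (as an $L^2$ element). $\operatorname{grad}\mathcal M|_z$ is the $L^2$-gradient: $d\mathcal M|_z\xi=\langle\operatorname{grad}\mathcal M|_z,\xi\rangle$.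 $\Omega\bigl((\hat z^1,\hat\eta^1),(\hat z^2,\hat\eta^2)\bigr)=\langle\hat\eta^1,\hat z^2\rangle-\langle\hat\eta^2,\hat z^1\rangle$, $\Omega_\Theta=\Omega+\pi^*d\Theta$ (both extend continuously to $L^2$ vectors). $\mathcal H(z,\eta)=\frac{\|\eta\|^2}{8\|z\|^2}-\frac1{\|z\|^2}$. $\mathcal X_\Theta$ is determined by $d\mathcal H=\Omega_\Theta(\cdot,\mathcal X_\Theta)$. $\nu(z)=z'$ is the canonical vector field on $\bar{\mathcal L}^\times\mathfrak Z$, with flow the time shift $(\phi^r_\nu z)_\tau=z_{\tau+r}$, and $L_\nu\Theta=\frac{d}{dr}|_{r=0}(\phi^r_\nu)^*\Theta$. $\mathcal Y_\Theta$ is determined by $\Omega_\Theta(\mathcal Y_\Theta,\cdot)=\pi^*L_\nu\Theta$. $\mathcal V(z,\eta)=(z',\eta')$. The action is $$\mathcal A(z,\eta)=\langle\eta,z'\rangle+\Theta_zz'-\mathcal H(z,\eta),$$ and critical points are points where $d\mathcal A$ vanishes on all tangent vectors. *)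

(* Defs.v *)
From HB Require Import structures.
From mathcomp Require Import all_boot all_order all_algebra.
From mathcomp Require Import all_classical all_reals all_analysis.

Set Implicit Arguments.
Unset Strict Implicit.
Unset Printing Implicit Defensive.

Import Order.TTheory GRing.Theory Num.Theory.
Import numFieldNormedType.Exports.

Local Open Scope classical_set_scope.
Local Open Scope ring_scope.
Local Open Scope quotient_scope.

Section Smoothness.
Context {R : realType} {V W : normedModType R}.

(* Class C^k on an open set U, by iterated directional derivatives; for
   finite-dimensional V this is the usual notion. *)
Fixpoint Ck_on (k : nat) (U : set V) (f : V -> W) : Prop :=
  (forall x, U x -> {for x, continuous f}) /\
  if k is j.+1 then
    forall v, (forall x, U x -> derivable f x v) /\
              Ck_on j U (fun x => 'D_v f x)
  else True.

Definition smooth_on (U : set V) (f : V -> W) : Prop :=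
  forall k, Ck_on k U f.

End Smoothness.

Section Plane.
Context {R : realType}.

(* The complex line, identified with R^2: (x, y) stands for x + iy. The
   library's norm on R * R is the sup norm; only its topology is used. *)
Implicit Types u v w : R * R.

Definition dot0 u v : R := u.1 * v.1 + u.2 * v.2.

Definition enorm u : R := Num.sqrt (dot0 u u).

Definition imul u : R * R := (- u.2, u.1).

Definition varsigma u : R * R := (u.1 ^+ 2 - u.2 ^+ 2, 2 * (u.1 * u.2)).

End Plane.

(* A time-dependent 1-form theta_t = b^1_t dx + b^2_t dy is given by its
   coefficients b t w = (b^1_t(w), b^2_t(w)). *)
Section Forms.
Context {R : realType}.
Variable b : R -> R * R -> R * R.

Implicit Types (t : R) (w xi zeta : R * R).

Definition form_eval t w xi : R := dot0 (b t w) xi.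

Definition vartheta t w xi : R :=
  form_eval t (varsigma w) ('d (@varsigma R) w xi).

Definition avec t w : R * R := (vartheta t w (1, 0), vartheta t w (0, 1)).

Definition adot t w : R * R := derive1 (fun s : R => avec s w) t.

Definition rot_a t w : R :=
  'D_((1, 0) : R * R) (fun u : R * R => (avec t u).2) w -
  'D_((0, 1) : R * R) (fun u : R * R => (avec t u).1) w.

(* d(a^1 dx + a^2 dy) = rot a dx /\ dy *)
Definition dvartheta t w xi zeta : R :=
  rot_a t w * (xi.1 * zeta.2 - xi.2 * zeta.1).

Definition dot_vartheta t w xi : R := derive1 (fun s : R => vartheta s w xi) t.

End Forms.

Section Loops.
Context {R : realType}.

Local Notation C := (R * R)%type.
Local Notation loop := (R -> R * R).
Local Notation mu := (@lebesgue_measure R).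

Implicit Types (z eta xi zeta : loop) (p v : loop * loop).

Definition Int (a c : R) (f : R -> R) : R := \int[mu]_(x in `[a, c]) f x.

(* Elements of L^2([0,1], R^2) are represented by functions on R of which
   only the restriction to [0,1] matters, up to equality a.e. on [0,1]. *)
Definition L2_scalar (f : R -> R) : Prop :=
  measurable_fun `[0 : R, 1] f /\
  mu.-integrable `[0 : R, 1] (fun x => (f x ^+ 2)%:E).

Definition L2 xi : Prop :=
  L2_scalar (fun x => (xi x).1) /\ L2_scalar (fun x => (xi x).2).

Definition eqL2 xi zeta : Prop :=
  {ae mu, forall x : R, x \in `[0, 1] -> xi x = zeta x}.

Definition inner xi zeta : R := Int 0 1 (fun x => dot0 (xi x) (zeta x)).

Definition norm2 xi : R := Num.sqrt (inner xi xi).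

(* The L^2 element representing the linear functional phi on the test space S
   (the zero function if there is none). *)
Definition L2_repr (S : set loop) (phi : loop -> R) : loop :=
  xget 0 [set w | L2 w /\ forall xi, S xi -> inner w xi = phi xi].

(* s = false: 1-periodic loops; s = true: 1-antiperiodic loops. *)
Definition loops (s : bool) (Z : set C) : set loop :=
  [set z | [/\ forall n tau, derivable (derive1n n z) tau 1,
               forall tau, Z (z tau)
             & forall tau, z (tau + 1) = (-1) ^+ s *: z tau]].

Definition loopsx (s : bool) (Z : set C) : set loop :=
  loops s Z `\ (0 : loop).

(* A nonzero loop has exactly one parity s. *)
Definition tangent z : set loop :=
  [set xi | exists2 s, loops s setT z & loops s setT xi].

Definition tangent2 p : set (loop * loop) :=
  [set v | tangent p.1 v.1 /\ tangent p.1 v.2].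

Definition dvar (E : lmodType R) (F : E -> R) (p v : E) : R :=
  derive1 (fun e : R => F (p + e *: v)) 0.

Definition sign_rel : rel (loop * loop) :=
  fun p q => (p == q) || (p == - q).

Lemma sign_rel_refl : reflexive sign_rel.
Proof. by move=> p; rewrite /sign_rel eqxx. Qed.

Lemma sign_rel_sym : symmetric sign_rel.
Proof.
by move=> p q; rewrite /sign_rel eq_sym; congr orb; rewrite eq_sym eqr_oppLR.
Qed.

Lemma sign_rel_trans : transitive sign_rel.
Proof.
move=> q p r /orP[] /eqP -> // /orP[] /eqP ->; rewrite /sign_rel ?opprK;
  by rewrite eqxx ?orbT.
Qed.

Canonical sign_equiv :=
  EquivRel sign_rel sign_rel_refl sign_rel_sym sign_rel_trans.

Definition phaseQ : Type := {eq_quot sign_equiv}.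

Definition phase_class p : phaseQ := \pi_({eq_quot sign_equiv}) p.

Definition phase_repr (q : phaseQ) : loop * loop :=
  repr (q : {eq_quot sign_equiv}).

Definition cotangent_cover (Z : set C) : set (loop * loop) :=
  [set p | exists s, loopsx s Z p.1 /\ loops s setT p.2].

Definition cotangent (Z : set C) : set phaseQ :=
  phase_class @` cotangent_cover Z.

(* Meaningful for tau >= 0 (the integral is over the set [0,tau]); t_z is only
   evaluated on [0,1]. *)
Definition tz z (tau : R) : R :=
  (norm2 z ^+ 2)^-1 * Int 0 tau (fun s => enorm (z s) ^+ 2).

Definition dtz z xi (tau : R) : R :=
  2 / norm2 z ^+ 2 * Int 0 tau (fun s => dot0 (z s) (xi s)) -
  2 * inner z xi / norm2 z ^+ 4 * Int 0 tau (fun s => enorm (z s) ^+ 2).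

Definition time_shift (r : R) z : loop := fun tau => z (tau + r).

Section Magnetic.
Variable b : R -> C -> C.

Definition Theta z xi : R :=
  Int 0 1 (fun tau => vartheta b (tz z tau) (z tau) (xi tau)).

Definition dTheta z xi zeta : R :=
  Int 0 1 (fun tau =>
    dvartheta b (tz z tau) (z tau) (xi tau) (zeta tau) +
    dtz z xi tau * dot_vartheta b (tz z tau) (z tau) (zeta tau) -
    dtz z zeta tau * dot_vartheta b (tz z tau) (z tau) (xi tau)).

(* The shift is linear, hence equal to its own differential. *)
Definition Lie_nu_Theta z xi : R :=
  derive1 (fun r : R => Theta (time_shift r z) (time_shift r xi)) 0.

Definition Lorentz z eta : loop :=
  L2_repr (tangent z) (fun xi => - dTheta z eta xi).

Definition calM z : R := Theta z (derive1 z).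

Definition gradM z : loop := L2_repr (tangent z) (dvar calM z).

Definition calH p : R :=
  norm2 p.2 ^+ 2 / (8 * norm2 p.1 ^+ 2) - 1 / norm2 p.1 ^+ 2.

Definition action p : R :=
  inner p.2 (derive1 p.1) + Theta p.1 (derive1 p.1) - calH p.

Definition actionQ (q : phaseQ) : R := action (phase_repr q).

Definition Omega v w : R := inner v.2 w.1 - inner w.2 v.1.

Definition Omega_Theta p v w : R := Omega v w + dTheta p.1 v.1 w.1.

Definition X_Theta p : loop * loop :=
  xget 0 [set X | [/\ L2 X.1, L2 X.2 &
    forall v, tangent2 p v -> dvar calH p v = Omega_Theta p v X]].

Definition Y_Theta p : loop * loop :=
  xget 0 [set Y | [/\ L2 Y.1, L2 Y.2 &
    forall v, tangent2 p v -> Omega_Theta p Y v = Lie_nu_Theta p.1 v.1]].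

Definition calV p : loop * loop := (derive1 p.1, derive1 p.2).

(* The tangent vectors of the quotient at q are the classes of the pairs (p, v)
   with p a lift of q and v tangent at p, modulo (p, v) ~ (-p, -v); the curve
   e |-> phase_class (p + e *: v) represents such a class. *)
Definition critical (q : phaseQ) : Prop :=
  forall p v, phase_class p = q -> tangent2 p v ->
    is_derive (0 : R) 1 (fun e : R => actionQ (phase_class (p + e *: v))) 0.

(* The vector fields commute with the sign involution, so that the equation at
   q can be read at any lift of q. *)
Definition Euler_Hamilton (q : phaseQ) : Prop :=
  forall p, phase_class p = q ->
    eqL2 (calV p).1 (X_Theta p + Y_Theta p).1 /\
    eqL2 (calV p).2 (X_Theta p + Y_Theta p).2.

End Magnetic.

End Loops.

(* Main.v *)
(* Along (z, eta) + e (xi, kappa) the action is differentiated under the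
   integral sign, z' is moved off xi by parts, and the outcome is
   <z' - eta / (4 ||z||^2), kappa> + <u, xi> with a continuous u: the time shift
   of t_z produces the boundary term |z_0|^2, and exchanging the two integrations
   turns the variation of t_z into the non-local terms. Density of the smooth
   (anti)periodic loops in L^2 gives u = 0. The same density determines
   X_Theta, Y_Theta, the Lorentz force and grad M almost everywhere by their
   continuous representatives, and continuous loops that agree almost everywhere
   on [0, 1] agree; hence all forms of the equation coincide. *)

From HB Require Import structures.
From mathcomp Require Import all_boot all_order all_algebra.
From mathcomp Require Import all_classical all_reals all_analysis.
From mathcomp Require Import measurable_realfun.
From mathcomp Require Import ring lra.
Require Import Defs.

Set Implicit Arguments.
Unset Strict Implicit.
Unset Printing Implicit Defensive.

Import Order.TTheory GRing.Theory Num.Theory.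
Import numFieldNormedType.Exports.

Local Open Scope classical_set_scope.
Local Open Scope ring_scope.

(** * Integrals of continuous functions *)

(** [Lorentz], [gradM], [X_Theta] and [Y_Theta] are picked by [xget] among the L^2 solutions, so
    nothing is known of their values at a given point. Each is compared in L^2 with an explicit
    continuous solution. The test loops must have a prescribed parity; they are quotients of
    trigonometric polynomials, whose parity and smoothness can be read off, and they converge to
    step functions.

    Cartan's formula d(i_nu Theta) = L_nu Theta - i_nu dTheta is the reason why the gradient of
    [calM] is the Lorentz force of z' plus the Euler term. It is verified by differentiating an
    integral formula and removing the derivative along the loop of a function that takes equal
    values at 0 and 1.

    Two obstacles shape the analysis. Smoothness of [b] is given by directional derivatives, while
    the chain rule needs differentials. And a perturbed loop stays over [Q] only for small
    parameters, so regularity is stated locally near parameter 0 and made uniform by compactness of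
    [0,1]. *)

Section IntContinuous.
Context {R : realType}.
Local Notation mu := (@lebesgue_measure R).
Implicit Types (f g F : R -> R) (a c d x : R).

Lemma continuous_integrable f a c :
  continuous f -> mu.-integrable `[a, c] (EFin \o f).
Proof.
move=> cf; apply: continuous_compact_integrable; first exact: segment_compact.
exact/continuous_subspaceT.
Qed.

Lemma eq_Int f g a c :
  (forall x, a <= x <= c -> f x = g x) -> Int a c f = Int a c g.
Proof.
move=> fg; apply: eq_Rintegral => x; rewrite inE/= in_itv/=; exact: fg.
Qed.

Lemma IntD f g a c : continuous f -> continuous g ->
  Int a c (fun x => f x + g x) = Int a c f + Int a c g.
Proof. by move=> cf cg; rewrite /Int RintegralD//; exact: continuous_integrable. Qed.

Lemma IntZ k f a c : continuous f ->
  Int a c (fun x => k * f x) = k * Int a c f.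
Proof. by move=> cf; rewrite /Int RintegralZl//; exact: continuous_integrable. Qed.

Lemma Int0 a c : Int a c (fun=> 0 : R) = 0.
Proof. by rewrite /Int Rintegral_cst// mul0r. Qed.

Lemma Int_split f a c d : continuous f -> a <= c -> c <= d ->
  Int a d f = Int a c f + Int c d f.
Proof.
move=> cf ac cd; rewrite /Int.
rewrite -(@Rintegral_itv_obnd_cbnd _ c (BRight d)); last first.
  apply: (integrableS _ _ _ (continuous_integrable c d cf)) => //.
  exact: subset_itv_oc_cc.
rewrite -(@Rintegral_itvB _ f (BLeft a) (BRight d) c) ?bnd_simp//.
  by rewrite addrC subrK.
exact: continuous_integrable.
Qed.

Lemma Int_point f a : Int a a f = 0.
Proof. by rewrite /Int set_itv1 Rintegral_set1. Qed.

(** [Int] runs over a set and vanishes when its bounds are reversed. Subtracting the reversed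
    integral gives the signed primitive, which is differentiable on the whole line, in particular at
    0. *)
Definition prim f x : R := Int 0 x f - Int x 0 f.

Lemma Int_empty f a c : c < a -> Int a c f = 0.
Proof. by move=> ca; rewrite /Int set_itv_ge ?Rintegral_set0// bnd_simp -ltNge. Qed.

Lemma prim_ge0 f x : 0 <= x -> prim f x = Int 0 x f.
Proof.
rewrite /prim le_eqVlt => /predU1P[<-|x0]; first by rewrite !Int_point subr0.
by rewrite (Int_empty _ x0) subr0.
Qed.

Lemma prim_base f a x : continuous f -> a <= 0 -> a <= x ->
  prim f x = Int a x f - Int a 0 f.
Proof.
move=> cf a0 ax; have [x0|x0] := leP 0 x.
  by rewrite prim_ge0// (Int_split cf a0 x0) addrC addKr.
by rewrite /prim (Int_empty _ x0) (Int_split cf ax (ltW x0)) opprD addrA subrr.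
Qed.

Lemma Int_prim f a c : continuous f -> a <= c -> Int a c f = prim f c - prim f a.
Proof.
move=> cf ac; pose m := Num.min a 0.
have ma : m <= a by rewrite /m ge_min lexx.
have m0 : m <= 0 by rewrite /m ge_min lexx orbT.
rewrite !(@prim_base f m)//; last exact: le_trans ac.
by rewrite (Int_split cf ma ac); ring.
Qed.

Lemma is_derive_prim f x : continuous f -> is_derive x 1 (prim f) (f x).
Proof.
(* A base point strictly to the left of both 0 and [x]: near [x], [prim f] is then an integral from
   [a] up to a constant, and [x] is interior. *)
move=> cf; pose a := Num.min x 0 - 1.
have ax : a < x by have := ge_min x x 0; rewrite /a lexx => /= ?; lra.
have a0 : a <= 0 by have := ge_min 0 x 0; rewrite /a lexx orbT => /= ?; lra.
have dI : is_derive x 1 (fun y => Int a y f) (f x).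
  have xx1 : x < x + 1 by rewrite ltrDl.
  have [d1 d2] := continuous_FTC1_closed xx1 (continuous_integrable a (x + 1) cf) ax (cf x).
  by apply: (DeriveDef d1); rewrite -derive1E; exact: d2.
apply: (near_eq_is_derive (f := fun y => Int a y f - Int a 0 f)).
  near=> y; rewrite (@prim_base f a)//; apply: ltW; near: y.
  exact: lt_nbhsr.
by rewrite -[X in is_derive _ _ _ X]subr0; apply: is_deriveB.
Unshelve. all: end_near. Qed.

Lemma prim_continuous f : continuous f -> continuous (prim f).
Proof.
move=> cf x; apply: differentiable_continuous.
by apply/derivable1_diffP; have [] := is_derive_prim x cf.
Qed.

Lemma is_derive_eq0_cst F a c : (forall x, is_derive x 1 F 0) -> F a = F c.
Proof. by move=> F0; exact: is_derive_0_is_cst. Qed.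

Lemma Int_FTC f F a c : continuous f -> a <= c ->
  (forall x, is_derive x 1 F (f x)) -> Int a c f = F c - F a.
Proof.
move=> cf ac dF; rewrite Int_prim//.
suff : prim f c - F c = prim f a - F a by lra.
apply: (@is_derive_eq0_cst (fun x => prim f x - F x)) => x.
rewrite -(subrr (f x)); apply: is_deriveB; exact: is_derive_prim.
Qed.

Lemma prim0 f : prim f 0 = 0.
Proof. by rewrite /prim !Int_point subrr. Qed.

(** The primitive is nondecreasing with equal end values, hence constant, so its derivative [f]
    vanishes inside. The endpoints are left to continuity. *)
Lemma Int_ge0_eq0 f a c : continuous f -> (forall x, 0 <= f x) -> a <= c ->
  Int a c f = 0 -> forall x, a < x < c -> f x = 0.
Proof.
move=> cf f0 ac I0 x /andP[ax xc].
have nd y y' : y <= y' -> prim f y <= prim f y'.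
  by move=> yy; rewrite -subr_ge0 -Int_prim//; apply: Rintegral_ge0.
have pc y : a <= y -> y <= c -> prim f y = prim f a.
  move=> ay yc; apply/eqP; rewrite eq_le (nd _ _ ay) andbT.
  by apply: (le_trans (nd _ _ yc)); rewrite -subr_le0 -Int_prim// I0.
have d1 := is_derive_prim x cf.
have d2 : is_derive x 1 (prim f) 0.
  apply: (near_eq_is_derive (f := cst (prim f a))).
  near=> y; apply/esym/pc; apply: ltW; near: y;
    [exact: lt_nbhsr|exact: lt_nbhsl].
by rewrite -(@derive_val _ _ _ _ _ _ _ d1) (@derive_val _ _ _ _ _ _ _ d2).
Unshelve. all: end_near. Qed.

Lemma Int_by_parts F f G g : continuous f -> continuous g ->
  (forall x, is_derive x 1 F (f x)) -> (forall x, is_derive x 1 G (g x)) ->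
  Int 0 1 (fun x => F x * g x) = F 1 * G 1 - F 0 * G 0 - Int 0 1 (fun x => f x * G x).
Proof.
move=> cf cg dF dG.
have cF : continuous F.
  by move=> x; apply/differentiable_continuous/derivable1_diffP; have [] := dF x.
have cG : continuous G.
  by move=> x; apply/differentiable_continuous/derivable1_diffP; have [] := dG x.
have c1 : continuous (fun x => F x * g x) by move=> x; apply: cvgM; [exact: cF|exact: cg].
have c2 : continuous (fun x => f x * G x) by move=> x; apply: cvgM; [exact: cf|exact: cG].
apply/eqP; rewrite -[X in _ == X - _](@Int_FTC (fun x => F x * g x + f x * G x) (F * G)) //.
- by rewrite IntD// addrK.
- by move=> x; apply: cvgD; [exact: c1|exact: c2].
- move=> x; apply: (is_derive_eq (is_deriveM (dF x) (dG x))).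
  by rewrite /GRing.scale/= [f x * _]mulrC.
Qed.

End IntContinuous.

Section DerivePairs.
Context {R : realType}.

Lemma is_derive_cvg (V W : normedModType R) (f : V -> W) x v d :
  (fun h : R => h^-1 *: (f (h *: v + x) - f x)) @ 0^' --> d -> is_derive x v f d.
Proof. by move=> fd; split; [apply: cvgP fd|exact: cvg_lim fd]. Qed.

Lemma cvg_is_derive (V W : normedModType R) (f : V -> W) x v d :
  is_derive x v f d -> (fun h : R => h^-1 *: (f (h *: v + x) - f x)) @ 0^' --> d.
Proof. by case=> df <-. Qed.

Lemma is_derive_pair (V W1 W2 : normedModType R) (f : V -> W1) (g : V -> W2)
  x v d e :
  is_derive x v f d -> is_derive x v g e ->
  is_derive x v (fun y => (f y, g y)) (d, e).
Proof.
move=> /cvg_is_derive fd /cvg_is_derive ge; apply: is_derive_cvg.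
exact: (cvg_pair fd ge).
Qed.

Lemma is_derive_fst (V W1 W2 : normedModType R) (f : V -> W1 * W2) x v d :
  is_derive x v f d -> is_derive x v (fun y => (f y).1) d.1.
Proof.
move=> /cvg_is_derive fd; apply: is_derive_cvg.
exact: (cvg_comp _ _ fd cvg_fst).
Qed.

Lemma is_derive_snd (V W1 W2 : normedModType R) (f : V -> W1 * W2) x v d :
  is_derive x v f d -> is_derive x v (fun y => (f y).2) d.2.
Proof.
move=> /cvg_is_derive fd; apply: is_derive_cvg.
exact: (cvg_comp _ _ fd cvg_snd).
Qed.

Lemma is_deriveMc (V : normedModType R) (f : V -> R) x v d c :
  is_derive x v f d -> is_derive x v (fun y => c * f y) (c * d).
Proof.
move=> df; apply: (is_derive_eq (is_deriveM (is_derive_cst c x v) df)).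
by rewrite scaler0 addr0.
Qed.

Lemma derive1_val (W : normedModType R) (f : R -> W) (x : R) d :
  is_derive x 1 f d -> derive1 f x = d.
Proof. by case=> _ <-; rewrite derive1E. Qed.

Lemma is_derive_derive1 (W : normedModType R) (f : R -> W) (x : R) :
  derivable f x 1 -> is_derive x 1 f (derive1 f x).
Proof. by move=> df; rewrite derive1E; exact: derivableP. Qed.

Lemma derive1nSn (W : normedModType R) (f : R -> W) n :
  derive1n n.+1 f = derive1n n (derive1 f).
Proof. by rewrite /derive1n iterSr. Qed.

End DerivePairs.

(** * Smooth loops and the fundamental lemma *)

Section SmoothFunctions.
Context {R : realType}.
Implicit Types f g : R -> R.

(** A finite order of differentiability to induct on: the derivative of a product or quotient is
    built from functions of one order less, so no formula for higher derivatives is required. *)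
Definition derivable_upto (n : nat) f : Prop :=
  forall k, (k < n)%N -> forall x, derivable (derive1n k f) x 1.

Lemma derivable_uptoS n f f' : (forall x : R, is_derive x 1 f (f' x)) ->
  derivable_upto n f' -> derivable_upto n.+1 f.
Proof.
move=> df nf [_ x|k kn x]; first by have [] := df x.
rewrite derive1nSn (_ : derive1 f = f'); first exact: nf.
by apply/funext => y; exact: derive1_val.
Qed.

Lemma derivable_uptoSP n f : derivable_upto n.+1 f ->
  (forall x : R, is_derive x 1 f (derive1 f x)) /\ derivable_upto n (derive1 f).
Proof.
move=> nf; split=> [x|k kn x]; first exact/is_derive_derive1/(nf 0%N).
by rewrite -derive1nSn; exact: nf.
Qed.

Lemma derivable_uptoW n f : derivable_upto n.+1 f -> derivable_upto n f.
Proof. by move=> nf k kn; apply: nf; exact: ltnW. Qed.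

Lemma derivable_upto0 f : derivable_upto 0 f.
Proof. by move=> k; rewrite ltn0. Qed.

Lemma derivable_upto_cst n (c : R) : derivable_upto n (cst c).
Proof.
elim: n c => [c|n ih c]; first exact: derivable_upto0.
exact: (derivable_uptoS (fun x => is_derive_cst c x 1) (ih 0)).
Qed.

Lemma derivable_uptoD n f g : derivable_upto n f -> derivable_upto n g ->
  derivable_upto n (fun x => f x + g x).
Proof.
elim: n f g => [f g _ _|n ih f g]; first exact: derivable_upto0.
move=> /derivable_uptoSP[df nf] /derivable_uptoSP[dg ng].
exact: (derivable_uptoS (fun x => is_deriveD (df x) (dg x)) (ih _ _ nf ng)).
Qed.

Lemma derivable_uptoM n f g : derivable_upto n f -> derivable_upto n g ->
  derivable_upto n (fun x => f x * g x).
Proof.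
elim: n f g => [f g _ _|n ih f g nf ng]; first exact: derivable_upto0.
have [df nf'] := derivable_uptoSP nf; have [dg ng'] := derivable_uptoSP ng.
apply: (derivable_uptoS (fun x => is_deriveM (df x) (dg x))).
by apply: derivable_uptoD; apply: ih; [exact: derivable_uptoW| |exact: derivable_uptoW|].
Qed.

Lemma derivable_uptoX n f m : derivable_upto n f ->
  derivable_upto n (fun x => f x ^+ m).
Proof.
move=> nf; elim: m => [|m ih]; first exact: derivable_upto_cst.
rewrite (_ : (fun x => _) = fun x => f x * f x ^+ m).
  exact: (derivable_uptoM nf ih).
by apply/funext => x; rewrite exprS.
Qed.

(** The derivative of the inverse contains the inverse itself, but one order lower, where the
    induction hypothesis applies. *)
Lemma derivable_uptoV n f : (forall x, f x != 0) -> derivable_upto n f ->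
  derivable_upto n (fun x => (f x)^-1).
Proof.
move=> f0; elim: n => [_|n ih nf]; first exact: derivable_upto0.
have [df nf'] := derivable_uptoSP nf.
have dV (x : R) : is_derive x 1 (fun y => (f y)^-1)
    (- 1 * ((f x)^-1 ^+ 2 * derive1 f x)).
  split; first by apply: derivableV; [exact: f0|case: (df x)].
  rewrite deriveV; [|exact: f0|by case: (df x)].
  by rewrite -derive1E /GRing.scale/= mulNr mul1r exprVn mulNr.
apply: (derivable_uptoS dV); apply: derivable_uptoM; first exact: derivable_upto_cst.
by apply: derivable_uptoM nf'; apply: derivable_uptoX; apply: ih; exact: derivable_uptoW.
Qed.

Lemma is_derive_affine (a c x : R) : is_derive x 1 (fun y : R => a * y + c) a.
Proof.
apply: (is_derive_eq (is_deriveD (is_deriveMc a (is_derive_id x 1))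
  (is_derive_cst c x 1))).
by rewrite addr0 mulr1.
Qed.

(** Sine and cosine differentiate into each other, so they are treated together; the free amplitude
    [A] absorbs the factors produced. *)
Lemma derivable_upto_sin n (A a c : R) :
  derivable_upto n (fun x => A * sin (a * x + c)) /\
  derivable_upto n (fun x => A * cos (a * x + c)).
Proof.
elim: n A => [A|n ih A]; first by split; exact: derivable_upto0.
have ds (x : R) := @is_derive1_comp _ sin (fun y => a * y + c) _ _ _ (is_derive_sin (a * x + c)) (is_derive_affine a c x).
have dc (x : R) := @is_derive1_comp _ cos (fun y => a * y + c) _ _ _ (is_derive_cos (a * x + c)) (is_derive_affine a c x).
split.
  have dS (x : R) : is_derive x 1 (fun y => A * sin (a * y + c)) (A * a * cos (a * x + c)).
    by apply: (is_derive_eq (is_deriveMc A (ds x))); ring.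
  exact: (derivable_uptoS dS (ih (A * a)).2).
have dC (x : R) : is_derive x 1 (fun y => A * cos (a * y + c)) (- A * a * sin (a * x + c)).
  by apply: (is_derive_eq (is_deriveMc A (dc x))); ring.
exact: (derivable_uptoS dC (ih (- A * a)).1).
Qed.

Lemma derive1n_pairE n f g :
  (forall k, derivable_upto k f) -> (forall k, derivable_upto k g) ->
  derive1n n (fun x => (f x, g x)) = fun x => (derive1n n f x, derive1n n g x).
Proof.
elim: n f g => [//|n ih] f g nf ng; rewrite !derive1nSn.
have /all_and2[df nf'] k := derivable_uptoSP (nf k.+1).
have /all_and2[dg ng'] k := derivable_uptoSP (ng k.+1).
rewrite -ih//; congr derive1n; apply/funext => x.
exact/derive1_val/is_derive_pair/dg/0%N/df/0%N.
Qed.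

End SmoothFunctions.

(** * Smooth test functions of either parity converging to step functions *)

Section Density.
Context {R : realType}.
Implicit Types (w : R -> R) (s : bool) (x y t : R).

(* [bump s x n] tends to [weight s] times the indicator of [0, x[ on ]0, 1[. *)
Definition weight s t : R := sin (pi * t) ^+ (~~ s).+1.

(** For [x] and [t] in ]0,1[ the product of sines has the sign of x - t. So [ratio] is below 1
    before [x] and above 1 after it, and its powers tend to 0 or to infinity. The factor 1/2 keeps
    it positive everywhere. *)
Definition ratio x t : R := 1 - 2^-1 * (sin (pi * t) * sin (pi * x - pi * t)).

Definition bump s x n t : R := weight s t / (1 + ratio x t ^+ n).

Lemma sin_bound t : -1 <= sin t <= 1.
Proof. by rewrite sin_geN1 sin_le1. Qed.

Lemma ratio_gt0 x t : 0 < ratio x t.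
Proof.
rewrite /ratio; have := sin_bound (pi * t); have := sin_bound (pi * x - pi * t).
by move=> /andP[? ?] /andP[? ?]; nra.
Qed.

Lemma bump_den_gt1 x n t : 1 < 1 + ratio x t ^+ n.
Proof. by rewrite ltrDl exprn_gt0// ratio_gt0. Qed.

Lemma sin_pi_shift t : sin (pi * (t + 1)) = - sin (pi * t).
Proof. by rewrite mulrDr mulr1 sinDpi. Qed.

Lemma sin_pi_unshift x t : sin (pi * x - pi * (t + 1)) = - sin (pi * x - pi * t).
Proof. by rewrite mulrDr mulr1 opprD addrA -[in RHS](subrK pi (_ - _ : R)) sinDpi opprK. Qed.

(** Both sines in [ratio] change sign, so [ratio] is periodic. The parity comes from [weight] alone:
    exponent 1 for antiperiodic loops, 2 for periodic ones. *)
Lemma bump_shift s x n t : bump s x n (t + 1) = (-1) ^+ s * bump s x n t.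
Proof.
rewrite /bump /weight /ratio sin_pi_shift sin_pi_unshift mulrNN.
by case: s => /=; rewrite ?sqrrN ?expr1 ?expr0 ?mulNr ?mul1r.
Qed.

Lemma bump_smooth s x n k : derivable_upto k (bump s x n).
Proof.
have s1 : derivable_upto k (fun t => sin (pi * t)).
  rewrite (_ : (fun t => _) = fun t : R => 1 * sin (pi * t + 0)).
    exact: (derivable_upto_sin k 1 pi 0).1.
  by apply/funext => t; rewrite mul1r addr0.
have s2 : derivable_upto k (fun t => sin (pi * x - pi * t)).
  rewrite (_ : (fun t => _) = fun t : R => 1 * sin (- pi * t + pi * x)).
    exact: (derivable_upto_sin k 1 (- pi) (pi * x)).1.
  by apply/funext => t; rewrite mul1r mulNr addrC.
apply: derivable_uptoM; first exact: derivable_uptoX.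
apply: derivable_uptoV => [t|].
  by rewrite gt_eqF// (lt_trans ltr01)// bump_den_gt1.
apply: derivable_uptoD; first exact: derivable_upto_cst.
apply: derivable_uptoX.
rewrite (_ : ratio x = fun t => 1 + (- 2^-1) * (sin (pi * t) * sin (pi * x - pi * t))).
  apply: derivable_uptoD; first exact: derivable_upto_cst.
  apply: derivable_uptoM; first exact: derivable_upto_cst.
  exact: derivable_uptoM.
by apply/funext => t; rewrite /ratio mulNr.
Qed.

Lemma derivable_upto_continuous f : derivable_upto 1 f -> continuous (f : R -> R).
Proof.
by move=> nf t; apply/differentiable_continuous/derivable1_diffP/(nf 0%N).
Qed.

Lemma bump_continuous s x n : continuous (bump s x n).
Proof. exact/derivable_upto_continuous/bump_smooth. Qed.

Lemma weight_continuous s : continuous (weight s).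
Proof.
apply: derivable_upto_continuous; apply: derivable_uptoX.
rewrite (_ : (fun t => _) = fun t : R => 1 * sin (pi * t + 0)).
  exact: (derivable_upto_sin 1 1 pi 0).1.
by apply/funext => t; rewrite mul1r addr0.
Qed.

Lemma weight_le1 s t : `|weight s t| <= 1.
Proof.
rewrite /weight normrX exprn_ile1// ler_norml; exact: sin_bound.
Qed.

Lemma bump_le1 s x n t : `|bump s x n t| <= 1.
Proof.
rewrite /bump normrM normfV (ger0_norm (ltW (lt_trans ltr01 (bump_den_gt1 x n t)))).
rewrite ler_pdivrMr ?(lt_trans ltr01 (bump_den_gt1 x n t))// mul1r.
exact: le_trans (weight_le1 s t) (ltW (bump_den_gt1 x n t)).
Qed.

Lemma sin_pi_gt0 t : 0 < t < 1 -> 0 < sin (pi * t).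
Proof.
move=> /andP[t0 t1]; apply: sin_gt0_pi.
by rewrite mulr_gt0 ?pi_gt0//= gtr_pMr ?pi_gt0.
Qed.

(** Before [x] the denominator tends to 1. After [x] its inverse is squeezed between 0 and the
    powers of the inverse of [ratio]. At [x] itself [ratio] is 1 and the value is half the weight,
    hence the exclusion. *)
Lemma bump_cvg s x t : 0 < x < 1 -> 0 < t < 1 -> t != x ->
  bump s x n t @[n --> \oo] --> (if t < x then weight s t else 0).
Proof.
move=> /andP[x0 x1] t01 tx; have st := sin_pi_gt0 t01; have r0 := ratio_gt0 x t.
have /andP[t0 t1] := t01.
case: ltP => [ltx|xlt].
  have r1 : `|ratio x t| < 1.
    rewrite gtr0_norm// /ratio ltrBlDr ltrDl mulr_gt0 ?invr_gt0 ?mulr_gt0//.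
    by rewrite -mulrBr sin_pi_gt0//; lra.
  rewrite -[X in _ --> X]divr1 -[X in _ / X]addr0.
  apply: cvgM; first exact: cvg_cst.
  apply: cvgV; first by rewrite addr0 oner_neq0.
  by apply: cvgD; [exact: cvg_cst|exact: cvg_expr].
have {}xlt : x < t by rewrite lt_neqAle eq_sym tx.
have r1 : `|(ratio x t)^-1| < 1.
  rewrite normfV gtr0_norm// invf_lt1// /ratio ltrDl oppr_gt0 pmulr_rlt0 ?invr_gt0//.
  rewrite pmulr_rlt0// -mulrBr -opprB mulrN sinN oppr_lt0 sin_pi_gt0//; lra.
rewrite -[X in _ --> X](mulr0 (weight s t)); apply: cvgM; first exact: cvg_cst.
apply: (squeeze_cvgr (f := cst 0) (h := GRing.exp (ratio x t)^-1)).
- apply: nearW => n /=; have d := bump_den_gt1 x n t; have rn := exprn_gt0 n r0.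
  rewrite invr_ge0 (ltW (lt_trans ltr01 d))/= exprVn lef_pV2 ?posrE ?(lt_trans ltr01 d)//.
  by rewrite lerDr.
- exact: cvg_cst.
- exact: cvg_expr.
Qed.

End Density.

(** * Functions orthogonal to the test functions vanish almost everywhere *)

Section FundamentalLemma.
Context {R : realType}.
Local Notation mu := (@lebesgue_measure R).
Implicit Types (w : R -> R) (s : bool) (x y t a : R).

Lemma ae_filter : Filter (almost_everywhere mu).
Proof. exact: ae_filter_ringOfSetsType. Qed.

Lemma ae_neq a : {ae mu, forall t, t != a}.
Proof.
exists [set a]; split => //; first exact: lebesgue_measure_set1.
by move=> t /= /negP; rewrite negbK => /eqP.
Qed.

Lemma ae_and (P Q : R -> Prop) : {ae mu, forall t, P t} -> {ae mu, forall t, Q t} ->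
  {ae mu, forall t, P t /\ Q t}.
Proof. by move=> aP aQ; apply: (@filterI _ _ ae_filter). Qed.

Lemma ae_imply (P Q : R -> Prop) : (forall t, P t -> Q t) ->
  {ae mu, forall t, P t} -> {ae mu, forall t, Q t}.
Proof. by move=> PQ; apply: (@filterS _ _ ae_filter). Qed.

Lemma integrable_mul_bounded w f : mu.-integrable `[0, 1] (EFin \o w) ->
  continuous f -> (forall t, `|f t| <= 1) ->
  mu.-integrable `[0, 1] (EFin \o (fun t => w t * f t)).
Proof.
move=> iw cf f1; apply: (le_integrable _ _ _ iw) => //.
  apply/measurable_EFinP; apply: measurable_funM.
    by have /integrableP[/measurable_EFinP] := iw.
  by apply: measurable_funTS; exact: continuous_measurable_fun.
by move=> t _; rewrite /= lee_fin normrM ler_piMr.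
Qed.

Lemma Int_bump_limit w s x : 0 < x < 1 ->
  mu.-integrable `[0, 1] (EFin \o w) ->
  (forall n, Int 0 1 (fun t => w t * bump s x n t) = 0) ->
  Int 0 1 ((fun t => w t * weight s t) \_ `]-oo, x[) = 0.
Proof.
move=> x01 iw I0.
have mw : measurable_fun `[0 : R, 1] w by have /integrableP[/measurable_EFinP] := iw.
pose f_ n := EFin \o (fun t => w t * bump s x n t).
pose f := EFin \o ((fun t => w t * weight s t) \_ `]-oo, x[).
have mf_ n : measurable_fun `[0 : R, 1] (f_ n).
  have := integrable_mul_bounded iw (@bump_continuous _ s x n) (bump_le1 s x n).
  by case/integrableP.
have mf : measurable_fun `[0 : R, 1] f.
  apply/measurable_EFinP; apply/measurable_restrict => //.
  apply: (measurable_funS _ (@subIsetl _ `[0 : R, 1] _)) => //.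
  have := integrable_mul_bounded iw (@weight_continuous _ s) (weight_le1 s).
  by case/integrableP => /measurable_EFinP.
have fcvg : {ae mu, forall t, `[0, 1]%classic t -> f_ ^~ t @ \oo --> f t}.
  (* Pointwise convergence is known off the points 0, [x] and 1, which form a null set. The
     dominating function is the absolute value of [w], since [bump] is bounded by 1. *)
  apply: ae_imply (ae_and (ae_neq x) (ae_and (ae_neq 0) (ae_neq 1))).
  move=> t [tx [t0 t1]]; rewrite /= in_itv/= => /andP[le0t le1t].
  apply: cvg_EFin; first exact: nearW.
  have t01 : 0 < t < 1 by rewrite !lt_neqAle le0t le1t eq_sym t0 t1.
  rewrite [X in _ --> X](_ : _ = w t * (if t < x then weight s t else 0)).
    apply: cvgM; [exact: cvg_cst|exact: bump_cvg].
  by rewrite /= patchE mem_setE in_itv/=; case: ifP; rewrite ?mulr0.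
have ig : mu.-integrable `[0, 1] (EFin \o (fun t => `|w t|)).
  by have := integrable_norm iw.
have fg : {ae mu, forall t n, `[0, 1]%classic t -> (`|f_ n t| <= (`|w t|)%:E)%E}.
  apply: aeW => t n _; rewrite /= lee_fin normrM ler_piMr//; exact: bump_le1.
have [//|_ _ cvgI] := @dominated_convergence _ _ _ mu `[0 : R, 1] _ f_ f _ mf_ mf fcvg ig fg.
rewrite /Int /Rintegral.
suff : (\int[mu]_(t in `[0%R, 1%R]) f t)%E = 0%E by move=> ->.
move: cvgI; rewrite (_ : [sequence _]_n = cst 0%E).
  by move=> c0; apply/esym; exact: (cvg_unique _ (cvg_cst _) c0).
apply/funext => n /=.
have := I0 n; rewrite /Int /Rintegral => /eqP; rewrite -(@eqe R) fineK.
  by move=> /eqP.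
apply: integrable_fin_num => //.
exact: (integrable_mul_bounded iw (@bump_continuous _ s x n) (bump_le1 s x n)).
Qed.

(** In the limit of the test functions, the integral of [w * weight s] over [0,x] vanishes for every
    [x] in ]0,1[. Lebesgue differentiation of this zero primitive gives [w * weight s = 0] almost
    everywhere, and the weight is positive inside the interval. *)
Lemma fundamental_lemma_scalar w s :
  mu.-integrable `[0, 1] (EFin \o w) ->
  (forall x n, 0 < x < 1 -> Int 0 1 (fun t => w t * bump s x n t) = 0) ->
  {ae mu, forall t, t \in `[0, 1] -> w t = 0}.
Proof.
move=> iw I0; pose g t := w t * weight s t.
have ig : mu.-integrable `[0, 1] (EFin \o g).
  exact: (integrable_mul_bounded iw (@weight_continuous _ s) (weight_le1 s)).
(* Cutting off outside [0,1] makes the function integrable on the whole line, as [FTC1] is applied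
   to a locally integrable function there. *)
pose h := g \_ `[0, 1].
have ih : mu.-integrable [set: R] (EFin \o h).
  rewrite /h -restrict_EFin.
  exact: (proj1 (integrable_mkcond (mu := mu) (D := `[0 : R, 1]) (EFin \o g) _) ig).
have F0 x : 0 < x < 1 -> \int[mu]_(t in `[0, x]) h t = 0.
  move=> x01; have /andP[x0 x1] := x01.
  have := Int_bump_limit x01 iw (I0 x ^~ x01).
  rewrite /Int -!Rintegral_mkcondr => I; apply: etrans I.
  rewrite (_ : `[0, x] `&` `[0, 1] = [set` `[0, x]]); last first.
    apply: setIidl; apply: subset_itvl; rewrite bnd_simp; exact: ltW.
  rewrite (_ : `[0, 1] `&` `]-oo, x[ = [set` `[0, x[]).
    rewrite (Rintegral_itv_bndo_bndc (a := BLeft 0))//.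
    by apply: integrableS ig => //; apply: subset_itvl; rewrite bnd_simp; exact: ltW.
  apply/seteqP; split => t /=; rewrite !in_itv/=.
    by move=> [/andP[-> _] ->].
  by move=> /andP[-> tx]; rewrite tx (ltW (lt_trans tx x1)).
have locih : locally_integrable [set: R] h.
  exact: integrable_locally_restrict.
have ihy y : mu.-integrable [set` Interval (BLeft 0) (BRight y)] (EFin \o h).
  exact: integrableS ih.
have := FTC1 ihy locih => /= ftc.
apply: ae_imply (ae_and ftc (ae_and (ae_neq 0) (ae_neq 1))).
move=> t [dt [t0 t1]]; rewrite in_itv/= => /andP[le0t le1t].
have t01 : 0 < t < 1 by rewrite !lt_neqAle le0t le1t eq_sym t0 t1.
have [|d1 d2] := dt; first by rewrite lte_fin; case/andP: t01.
have ht : h t = 0.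
  rewrite -d2 derive1E.
  have -> : 'D_1 (fun x => \int[mu]_(t0 in `[0, x]) h t0) t = 'D_1 (cst 0 : R -> R) t.
    apply: near_eq_derive; near=> y; apply: F0; apply/andP; split; near: y.
      by apply: lt_nbhsr; case/andP: t01.
    by apply: lt_nbhsl; case/andP: t01.
  exact: derive_cst.
move: ht; rewrite /h patchE mem_setE in_itv/= le0t le1t/= => /eqP.
rewrite mulf_eq0 => /orP[/eqP//|]; rewrite /weight expf_eq0/= => /eqP st.
by have := sin_pi_gt0 t01; rewrite st ltxx.
Unshelve. all: end_near. Qed.

End FundamentalLemma.

Section LoopSpaces.
Context {R : realType}.
Local Notation mu := (@lebesgue_measure R).
Implicit Types (w u z xi zeta : R -> R * R) (s : bool).

Lemma L2_scalar_integrable (f : R -> R) : L2_scalar f ->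
  mu.-integrable `[0, 1] (EFin \o f).
Proof.
case=> mf if2.
(* On an interval of finite measure, L^2 lies in L^1 because the absolute value of f is at most 1 +
   f^2. *)
have i1 : mu.-integrable `[0 : R, 1] (EFin \o (fun t => 1 + f t ^+ 2)).
  have := @integrableD _ _ _ mu `[0 : R, 1] _ (EFin \o cst 1) (fun x => (f x ^+ 2)%:E).
  apply => //; exact: (continuous_integrable 0 1 (@cst_continuous R R 1)).
apply: (le_integrable _ _ _ i1) => //; first exact/measurable_EFinP.
move=> t _; rewrite /= lee_fin [leRHS]ger0_norm ?addr_ge0 ?sqr_ge0//.
by rewrite ler_norml; have := sqr_ge0 (f t); nra.
Qed.

Lemma continuous_L2_scalar (f : R -> R) : continuous f -> L2_scalar f.
Proof.
move=> cf; split; first by apply: measurable_funTS; exact: continuous_measurable_fun.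
apply: (continuous_integrable 0 1 (f := fun x => f x ^+ 2)) => t.
by rewrite (_ : (fun x => _) = fun x => f x * f x)//; apply: cvgM; exact: cf.
Qed.

Lemma pair_continuous (T U V : topologicalType) (f : T -> U) (g : T -> V) : continuous f -> continuous g ->
  continuous (fun t => (f t, g t)).
Proof. by move=> cf cg t; exact: (cvg_pair (cf t) (cg t)). Qed.

Lemma fst_comp_continuous (T : topologicalType) (f : T -> R * R) :
  continuous f -> continuous (fun t => (f t).1).
Proof. by move=> cf t; apply: (cvg_comp _ _ (cf t)); exact: cvg_fst. Qed.

Lemma snd_comp_continuous (T : topologicalType) (f : T -> R * R) :
  continuous f -> continuous (fun t => (f t).2).
Proof. by move=> cf t; apply: (cvg_comp _ _ (cf t)); exact: cvg_snd. Qed.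

Lemma continuous_L2 w : continuous w -> L2 w.
Proof.
by move=> cw; split; apply: continuous_L2_scalar;
  [exact: fst_comp_continuous|exact: snd_comp_continuous].
Qed.

Lemma eqL2_refl w : eqL2 w w.
Proof. exact: aeW. Qed.

Lemma eqL2_sym w u : eqL2 w u -> eqL2 u w.
Proof. by apply: ae_imply => t wu t01; rewrite wu. Qed.

Lemma eqL2_trans u w v : eqL2 w u -> eqL2 u v -> eqL2 w v.
Proof.
move=> wu uv; apply: ae_imply (ae_and wu uv) => t [a1 a2] t01.
by rewrite a1// a2.
Qed.

Lemma eqL2D w w' u u' : eqL2 w w' -> eqL2 u u' -> eqL2 (w + u) (w' + u').
Proof.
move=> a b; apply: ae_imply (ae_and a b) => t [a1 a2] t01.
by rewrite !fctE a1// a2.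
Qed.

Definition bump1 s x n : R -> R * R := fun t => (bump s x n t, 0).
Definition bump2 s x n : R -> R * R := fun t => (0, bump s x n t).

Lemma smooth_pair_loops s (f g : R -> R) :
  (forall k, derivable_upto k f) -> (forall k, derivable_upto k g) ->
  (forall t, f (t + 1) = (-1) ^+ s * f t) ->
  (forall t, g (t + 1) = (-1) ^+ s * g t) ->
  loops s setT (fun t => (f t, g t)).
Proof.
move=> nf ng pf pg; split => // [n t|t]; last by rewrite pf pg.
rewrite derive1n_pairE//; have df := is_derive_derive1 (nf n.+1 n (leqnn _) t).
have dg := is_derive_derive1 (ng n.+1 n (leqnn _) t).
by case: (is_derive_pair df dg).
Qed.

Lemma bump1_loops s x n : loops s setT (bump1 s x n).
Proof.
apply: smooth_pair_loops => [k|k|t|t]; rewrite ?mulr0 ?bump_shift//.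
- exact: bump_smooth.
- exact: derivable_upto_cst.
Qed.

Lemma bump2_loops s x n : loops s setT (bump2 s x n).
Proof.
apply: smooth_pair_loops => [k|k|t|t]; rewrite ?mulr0 ?bump_shift//.
- exact: derivable_upto_cst.
- exact: bump_smooth.
Qed.

(** The two components are tested separately, with a [bump] in one slot and 0 in the other. Only L^2
    regularity is assumed since the lemma is meant for the functions chosen by [xget]. *)
Lemma fundamental_lemma s w u : L2 w -> L2 u ->
  (forall xi, loops s setT xi -> inner w xi = inner u xi) -> eqL2 w u.
Proof.
move=> [/L2_scalar_integrable w1 /L2_scalar_integrable w2].
move=> [/L2_scalar_integrable u1 /L2_scalar_integrable u2] wu.
have key (f g : R -> R) : mu.-integrable `[0, 1] (EFin \o f) ->
    mu.-integrable `[0, 1] (EFin \o g) ->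
    (forall x n, Int 0 1 (fun t => f t * bump s x n t) = Int 0 1 (fun t => g t * bump s x n t)) ->
    {ae mu, forall t, t \in `[0, 1] -> f t - g t = 0}.
  move=> i1 i2 fg; apply: (@fundamental_lemma_scalar _ _ s).
    exact: (integrableB (mu := mu) (D := `[0 : R, 1]) _ i1 i2).
  move=> x n _; have cb := @bump_continuous R s x n; have b1 := bump_le1 s x n.
  rewrite -[RHS](subrr (Int 0 1 (fun t => g t * bump s x n t))) -{1}fg.
  rewrite /Int -RintegralB//; last 2 first.
  - exact: integrable_mul_bounded.
  - exact: integrable_mul_bounded.
  by apply: eq_Rintegral => t _; rewrite mulrBl.
have k1 := key _ _ w1 u1; have k2 := key _ _ w2 u2.
apply: ae_imply (ae_and (k1 _) (k2 _)).
- move=> t [a1 a2] t01; move/eqP: (a1 t01); move/eqP: (a2 t01).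
  rewrite !subr_eq0 [w t]surjective_pairing [u t]surjective_pairing /=.
  by move=> /eqP -> /eqP ->.
- move=> x n; have := wu _ (bump1_loops s x n); rewrite /inner /dot0/= => e.
  transitivity (Int 0 1 (fun t => (w t).1 * bump s x n t + (w t).2 * 0)).
    by apply: eq_Int => t _; rewrite mulr0 addr0.
  by rewrite e; apply: eq_Int => t _; rewrite mulr0 addr0.
- move=> x n; have := wu _ (bump2_loops s x n); rewrite /inner /dot0/= => e.
  transitivity (Int 0 1 (fun t => (w t).1 * 0 + (w t).2 * bump s x n t)).
    by apply: eq_Int => t _; rewrite mulr0 add0r.
  by rewrite e; apply: eq_Int => t _; rewrite mulr0 add0r.
Qed.

End LoopSpaces.

(** * Differentiability of the magnetic potential *)

Section ContinuouslyDifferentiable.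
Context {R : realType}.

(** The mean value theorem, with the slope compared to a fixed [k]. The endpoints are unordered
    because it is applied to increments of either sign. *)
Lemma mean_value_bound (phi dphi : R -> R) (a c k e : R) :
  (forall x, Num.min a c <= x <= Num.max a c ->
     is_derive x 1 phi (dphi x) /\ `|dphi x - k| <= e) ->
  `|phi c - phi a - k * (c - a)| <= e * `|c - a|.
Proof.
wlog ac : a c / a <= c => [wl H|].
  have [/wl|/ltW ca] := leP a c; first exact.
  rewrite (distrC c a) (_ : phi c - phi a - k * (c - a) =
    - (phi a - phi c - k * (a - c))); last by ring.
  by rewrite normrN; apply: wl => // x; rewrite minC maxC; exact: H.
rewrite (min_l ac) (max_r ac) => H.
have dphi_ x : x \in `]a, c[ -> is_derive x 1 phi (dphi x).
  by rewrite in_itv/= => /andP[ax xc]; have [|//] := H x; rewrite !ltW.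
have cphi : {within `[a, c], continuous phi}.
  apply: derivable_within_continuous => x; rewrite in_itv/= => axc.
  by have [[]] := H _ axc.
have [x + ->] := MVT_segment ac dphi_ cphi.
rewrite in_itv/= => /H[_ xk]; rewrite -mulrBl normrM ler_wpM2r//.
Qed.

Lemma is_derive_first (V W : normedModType R) (f : R * V -> W) (t : R) (v : V) d :
  is_derive (t, v) ((1, 0) : R * V) f d -> is_derive t 1 (fun s => f (s, v)) d.
Proof.
move=> /cvg_is_derive fd; apply: is_derive_cvg.
have -> // : (fun h : R => h^-1 *: (f (h *: 1 + t, v) - f (t, v))) =
  (fun h : R => h^-1 *: (f (h *: ((1, 0) : R * V) + (t, v)) - f (t, v))).
apply/funext => h; congr (_ *: (f _ - _)).
by rewrite [RHS](_ : _ = (h *: 1 + t, h *: 0 + v))// scaler0 add0r.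
Qed.

Lemma is_derive_second (V W : normedModType R) (f : R * V -> W) (t : R) (v u : V) d :
  is_derive (t, v) ((0, u) : R * V) f d -> is_derive v u (fun s => f (t, s)) d.
Proof.
move=> /cvg_is_derive fd; apply: is_derive_cvg.
have -> // : (fun h : R => h^-1 *: (f (t, h *: u + v) - f (t, v))) =
  (fun h : R => h^-1 *: (f (h *: ((0, u) : R * V) + (t, v)) - f (t, v))).
apply/funext => h; congr (_ *: (f _ - _)).
by rewrite [RHS](_ : _ = (h *: 0 + t, h *: u + v))// scaler0 add0r.
Qed.

Lemma differentiable_littleo (V W : normedModType R) (f : V -> W)
    (df : {linear V -> W}) (p : V) : continuous df ->
  (forall e : R, 0 < e ->
     \forall h \near 0, `|f (h + p) - f p - df h| <= e * `|h|) ->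
  differentiable f p.
Proof.
move=> cdf fo.
have fL : f \o shift p = cst (f p) + df +o_ 0 id.
  apply/eqaddoP => e e0; have := fo _ e0; apply: filterS => h.
  by rewrite /= opprD addrA.
by apply/diff_locallyP; rewrite (diff_unique cdf fL).
Qed.

Lemma littleo_differentiable (V W : normedModType R) (f : V -> W) (p : V) :
  differentiable f p -> forall e : R, 0 < e ->
  \forall h \near 0, `|f (h + p) - f p - 'd f p h| <= e * `|h|.
Proof.
move=> /diff_locally/eqaddoP fo e e0; have := fo _ e0; apply: filterS => h.
by rewrite /= opprD addrA.
Qed.

(** The increment is cut in two. Along the first coordinate the mean value bound and the continuity
    of [D1] apply; in the slice through [p] differentiability is assumed. One real coordinate is
    peeled off at a time, so the lemma can be iterated. *)
Lemma differentiable_partial (V : normedModType R) (f : R * V -> R)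
    (D1 : R * V -> R) (p : R * V) :
  (\forall q \near p, is_derive q ((1, 0) : R * V) f (D1 q)) ->
  {for p, continuous D1} ->
  differentiable (fun v : V => f (p.1 : R, v)) (p.2 : V) ->
  differentiable f p.
Proof.
move=> dD1 cD1 df2; pose f2 := fun v : V => f (p.1 : R, v).
pose L (h : R * V) : R := D1 p * h.1 + 'd f2 (p.2 : V) h.2.
have linL : linear L.
  move=> k x y; rewrite /L/= mulrDr linearD linearZ/= /GRing.scale/=; ring.
have cL : continuous L.
  move=> h; apply: cvgD.
    by apply: cvgM; [exact: cvg_cst|exact: cvg_fst].
  apply: (cvg_comp _ _ cvg_snd); exact: (diff_continuous df2).
pose Ll := GRing.isLinear.Build _ _ _ _ _ linL.
pose LL : {linear (R * V)%type -> R} := HB.pack L Ll.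
apply: (@differentiable_littleo _ _ f LL) => // _/posnumP[e].
have e2 : 0 < e%:num / 2 by rewrite divr_gt0.
have nA : \forall h \near (0 : R * V),
    `|f (h.1 + p.1, h.2 + p.2) - f (p.1, h.2 + p.2) - D1 p * h.1| <= e%:num / 2 * `|h|.
  have nq : \forall q \near p, is_derive q ((1, 0) : R * V) f (D1 q) /\
      `|D1 q - D1 p| <= e%:num / 2.
    apply: filterI => //; have /cvgrPdist_le/(_ _ e2) := cD1.
    by apply: filterS => q; rewrite distrC.
  (* Balls of the product norm are products of balls, so the whole horizontal segment at height
     [h.2 + p.2] between the two first coordinates stays where the bound holds. *)
  have /nbhs_ballP[r /= r0 pr] := nq.
  have := nbhsx_ballx (0 : R * V) _ r0; apply: filterS => h [h1 h2].
  have := @mean_value_bound (fun s => f (s, h.2 + p.2)) (fun s => D1 (s, h.2 + p.2))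
    p.1 (h.1 + p.1) (D1 p) (e%:num / 2).
  rewrite addrK => /(_ _)/le_trans; apply.
    move=> x; rewrite ge_min le_max => /andP[xl xu].
    have /pr[dx Dx] : ball p r (x, h.2 + p.2).
      split; rewrite -ball_normE/=; last first.
        by move: h2; rewrite -ball_normE/= sub0r opprD addrCA subrr addr0.
      move: h1; rewrite -ball_normE/= sub0r normrN !ltr_norml => /andP[? ?].
      by apply/andP; split; case/orP: xl => ?; case/orP: xu => ?; lra.
    by split=> //; exact: is_derive_first.
  by rewrite ler_wpM2l ?(ltW e2)// /Num.norm/= le_max lexx.
have nB : \forall h \near (0 : R * V),
    `|f (p.1, h.2 + p.2) - f p - 'd f2 (p.2 : V) h.2| <= e%:num / 2 * `|h|.
  have n2 : \forall h \near (0 : R * V), `|f2 (h.2 + p.2) - f2 p.2 - 'd f2 (p.2 : V) h.2| <= e%:num / 2 * `|h.2|.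
    exact: (@cvg_snd _ _ (nbhs (0 : R)) (nbhs (0 : V)) _ _ (littleo_differentiable df2 e2)).
  apply: filterS n2 => h; rewrite /f2 -surjective_pairing => /le_trans; apply.
  by rewrite ler_wpM2l ?(ltW e2)// /Num.norm/= le_max lexx orbT.
near=> h.
have hA : `|f (h.1 + p.1, h.2 + p.2) - f (p.1, h.2 + p.2) - D1 p * h.1| <= e%:num / 2 * `|h|.
  by near: h.
have hB : `|f (p.1, h.2 + p.2) - f p - 'd f2 (p.2 : V) h.2| <= e%:num / 2 * `|h|.
  by near: h.
rewrite (splitr e%:num) mulrDl; apply: le_trans (lerD hA hB).
apply: le_trans (ler_normD _ _); rewrite le_eqVlt; apply/orP; left; apply/eqP.
congr (`| _ |).
rewrite -[LL h]/(D1 p * h.1 + 'd f2 (p.2 : V) h.2).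
rewrite -[h + p]/(h.1 + p.1, h.2 + p.2); ring.
Unshelve. all: end_near. Qed.

(** Bridge from the directional derivatives of [Ck_on] to the differentials that the chain rule
    uses: time and the first space coordinate are peeled off in turn. *)
Lemma C1_differentiable (U : set (R * (R * R))) (f : R * (R * R) -> R)
    (D : R * (R * R) -> R * (R * R) -> R) :
  open U -> (forall v p, U p -> is_derive p v f (D v p)) ->
  (forall v p, U p -> {for p, continuous (D v)}) ->
  forall p, U p -> differentiable f p.
Proof.
move=> oU dU cU p Up.
have nU : \forall q \near p, U q by apply: open_nbhs_nbhs.
have c1 : {for (p.2 : R * R), continuous (fun v : R * R => (p.1, v) : R * (R * R))}.
  exact: (cvg_pair (cvg_cst _) cvg_id).
apply: (differentiable_partial (D1 := D ((1, 0) : R * (R * R)))).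
- by apply: filterS nU => q; exact: dU.
- exact: cU.
have nU2 : \forall v \near (p.2 : R * R), U (p.1, v).
  by apply: c1; rewrite -surjective_pairing.
apply: (differentiable_partial (f := fun v : R * R => f (p.1, v))
  (D1 := fun v : R * R => D ((0, (1, 0)) : R * (R * R)) (p.1, v))).
- by apply: filterS nU2 => v Uv; apply: is_derive_second; exact: dU.
- apply: (@continuous_comp _ _ _ _ (D (0, (1, 0))) _ c1).
  by rewrite -surjective_pairing; exact: cU.
(* The remaining slice depends on one real variable, where derivability is differentiability. *)
apply/derivable1_diffP.
have := dU ((0, (0, 1)) : R * (R * R)) p Up.
rewrite {1}[p]surjective_pairing => /is_derive_second.
rewrite {1}[p.2]surjective_pairing => /is_derive_second [+ _].
by [].
Qed.

End ContinuouslyDifferentiable.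

Section LinearDifferentials.
Context {R : realType}.

Lemma is_diff_linear (V W : normedModType R) (f : V -> W) (x : V) :
  linear f -> continuous f -> is_diff x f f.
Proof.
move=> lf cf; pose fl := GRing.isLinear.Build _ _ _ _ _ lf.
pose ff : {linear V -> W} := HB.pack f fl.
split; first exact: (@linear_differentiable _ _ _ ff).
exact: (@diff_lin _ _ _ ff).
Qed.

Lemma is_diffE (V W : normedModType R) (f df : V -> W) (x : V) :
  is_diff x f df -> forall v, 'd f x v = df v.
Proof. by case=> _ ->. Qed.

Lemma is_diff_fst (V W : normedModType R) (x : V * W) :
  is_diff x (fst : V * W -> V) (fst : V * W -> V).
Proof. by apply: is_diff_linear => // y; exact: cvg_fst. Qed.

Lemma is_diff_snd (V W : normedModType R) (x : V * W) :
  is_diff x (snd : V * W -> W) (snd : V * W -> W).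
Proof. by apply: is_diff_linear => // y; exact: cvg_snd. Qed.

Lemma is_diff_mul (V : normedModType R) (f g df dg : V -> R) x :
  is_diff x f df -> is_diff x g dg ->
  is_diff x (fun y => f y * g y) (fun v => f x * dg v + g x * df v).
Proof. by move=> hf hg; exact: (is_diffM hf hg). Qed.

Lemma is_diff_add (V : normedModType R) (f g df dg : V -> R) x :
  is_diff x f df -> is_diff x g dg ->
  is_diff x (fun y => f y + g y) (fun v => df v + dg v).
Proof. by move=> hf hg; exact: (is_diffD hf hg). Qed.

Lemma is_diff_const (V : normedModType R) (c : R) (x : V) :
  is_diff x (fun=> c) (fun=> 0).
Proof. exact: (is_diff_cst c x). Qed.

Lemma is_diff_ext (V W : normedModType R) (f g df dg : V -> W) x :
  is_diff x f df -> (forall y, f y = g y) -> (forall v, df v = dg v) -> is_diff x g dg.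
Proof. by move=> h fg dfg; rewrite -(funext fg) -(funext dfg). Qed.

End LinearDifferentials.

(** * The pulled-back coefficients and their differentials *)

Section Avec.
Context {R : realType}.
Variables (Q : set (R * R)) (b : R -> R * R -> R * R).
Hypotheses (open_Q : open Q)
  (smooth_b : smooth_on ([set: R] `*` Q) (fun x : R * (R * R) => b x.1 x.2)).
Local Notation C := (R * R)%type.
Local Notation Z := (varsigma @^-1` Q).
Implicit Types (t : R) (w xi : C) (p q : R * C).

Lemma is_diff_varsigma w : is_diff w (@varsigma R)
  (fun v => (2 * (w.1 * v.1 - w.2 * v.2), 2 * (w.1 * v.2 + w.2 * v.1))).
Proof.
have d1 := is_diff_fst w; have d2 := is_diff_snd w.
have e1 := is_diff_add (is_diff_mul d1 d1) (is_diff_mul (is_diff_const (-1) w) (is_diff_mul d2 d2)).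
have e2 := is_diff_mul (is_diff_const 2 w) (is_diff_mul d1 d2).
apply: (is_diff_ext (is_diff_pair e1 e2)) => [y|v]; rewrite /varsigma; congr (_, _); ring.
Qed.

Lemma vartheta_dot0 t w xi : vartheta b t w xi = dot0 (avec b t w) xi.
Proof.
rewrite /avec /vartheta /form_eval /dot0 !(is_diffE (is_diff_varsigma w))/=; ring.
Qed.

Definition avec1 p : R := (avec b p.1 p.2).1.
Definition avec2 p : R := (avec b p.1 p.2).2.

Definition bcomp1 p : R := (b p.1 p.2).1.
Definition bcomp2 p : R := (b p.1 p.2).2.
Definition sq p : R * C := (p.1, varsigma p.2).

Lemma avec1E p : avec1 p = bcomp1 (sq p) * (2 * p.2.1) + bcomp2 (sq p) * (2 * p.2.2).
Proof.
rewrite /avec1 /avec /vartheta /form_eval /dot0 !(is_diffE (is_diff_varsigma _))/=.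
rewrite /bcomp1 /bcomp2/=; ring.
Qed.

Lemma avec2E p : avec2 p = bcomp1 (sq p) * (- 2 * p.2.2) + bcomp2 (sq p) * (2 * p.2.1).
Proof.
rewrite /avec2 /avec /vartheta /form_eval /dot0 !(is_diffE (is_diff_varsigma _))/=.
rewrite /bcomp1 /bcomp2/=; ring.
Qed.

Lemma open_RQ : open ([set: R] `*` Q).
Proof.
rewrite openE => p [_ Qp]; exists ([set: R], Q) => //=.
by split; [exact: filterT|apply: open_nbhs_nbhs].
Qed.

Lemma bcomp_diff : exists D1 D2 : R * C -> R * C -> R,
  forall p, Q p.2 ->
  [/\ is_diff p bcomp1 (D1^~ p), is_diff p bcomp2 (D2^~ p),
      forall v, {for p, continuous (D1 v)} & forall v, {for p, continuous (D2 v)}].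
Proof.
pose f p := b p.1 p.2; have [cf df] := smooth_b 1.
have dv v p : ([set: R] `*` Q) p -> is_derive p v f ('D_v f p).
  by move=> Up; apply: derivableP; exact: (df v).1.
have cv v p : ([set: R] `*` Q) p -> {for p, continuous (fun x => 'D_v f x)}.
  by move=> Up; have [_ [+ _]] := df v; exact.
have d1 v p : ([set: R] `*` Q) p -> is_derive p v bcomp1 ('D_v f p).1.
  by move=> Up; apply: (is_derive_fst (f := f)); exact: dv.
have d2 v p : ([set: R] `*` Q) p -> is_derive p v bcomp2 ('D_v f p).2.
  by move=> Up; apply: (is_derive_snd (f := f)); exact: dv.
have c1 v p : ([set: R] `*` Q) p -> {for p, continuous (fun x => ('D_v f x).1)}.
  by move=> Up; apply: (cvg_comp _ _ (cv v _ Up)); exact: cvg_fst.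
have c2 v p : ([set: R] `*` Q) p -> {for p, continuous (fun x => ('D_v f x).2)}.
  by move=> Up; apply: (cvg_comp _ _ (cv v _ Up)); exact: cvg_snd.
exists (fun v p => ('D_v f p).1), (fun v p => ('D_v f p).2) => p Qp.
have Up : ([set: R] `*` Q) p by [].
split=> [||v|v]; [|idtac|exact: c1|exact: c2].
- have D := C1_differentiable open_RQ d1 c1 Up.
  split => //; apply/funext => v; rewrite -deriveE//; exact: (@derive_val _ _ _ _ _ _ _ (d1 v p Up)).
- have D := C1_differentiable open_RQ d2 c2 Up.
  split => //; apply/funext => v; rewrite -deriveE//; exact: (@derive_val _ _ _ _ _ _ _ (d2 v p Up)).
Qed.

Definition dir_t : R * C := (1, (0, 0)).
Definition dir_x : R * C := (0, (1, 0)).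
Definition dir_y : R * C := (0, (0, 1)).

(** Continuity of a differential in its base point is available only for a fixed direction, whereas
    the chain rule produces directions that move with the point. Expanding in the basis separates
    the two. *)
Lemma is_diff_basis (f : R * C -> R) (df : R * C -> R) p : is_diff p f df ->
  forall v, df v = v.1 * df dir_t + v.2.1 * df dir_x + v.2.2 * df dir_y.
Proof.
move=> h v; rewrite -!(is_diffE h) -![_ * 'd f p _]linearZ -!linearD; congr ('d f p _).
rewrite /dir_t /dir_x /dir_y [RHS](_ : _ = (v.1 * 1 + v.2.1 * 0 + v.2.2 * 0,
  (v.1 * 0 + v.2.1 * 1 + v.2.2 * 0, v.1 * 0 + v.2.1 * 0 + v.2.2 * 1)))//.
by rewrite !mulr0 !mulr1 !addr0 !add0r -!surjective_pairing.
Qed.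

Lemma is_diff_sq p : is_diff p sq (fun v => (v.1,
  (2 * (p.2.1 * v.2.1 - p.2.2 * v.2.2), 2 * (p.2.1 * v.2.2 + p.2.2 * v.2.1)))).
Proof.
exact: (is_diff_pair (is_diff_fst p) (is_diff_comp (is_diff_snd p) (is_diff_varsigma p.2))).
Qed.

Lemma is_diff_continuous (V W : normedModType R) (f df : V -> W) (x : V) :
  is_diff x f df -> {for x, continuous f}.
Proof. by case=> h _; exact: differentiable_continuous. Qed.

(** This is the interface to the rest: later sections take [A1] and [A2] as variables and see the
    1-form through them, without returning to the iterated derivatives of [b]. *)
Lemma avec_diff : exists A1 A2 : R * C -> R * C -> R,
  forall p, Z p.2 ->
  [/\ is_diff p avec1 (A1^~ p), is_diff p avec2 (A2^~ p),
      forall v, {for p, continuous (A1 v)} & forall v, {for p, continuous (A2 v)}].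
Proof.
have [D1 [D2 D]] := bcomp_diff.
(* Chain rule through [sq], expanded in the basis so that continuity in [p] follows from that of
   three partial derivatives. *)
pose Ds (D : R * C -> R * C -> R) (v p : R * C) := v.1 * D dir_t (sq p) +
  2 * (p.2.1 * v.2.1 - p.2.2 * v.2.2) * D dir_x (sq p) +
  2 * (p.2.1 * v.2.2 + p.2.2 * v.2.1) * D dir_y (sq p).
have x1 p := is_diff_comp (is_diff_snd p) (is_diff_fst p.2).
have x2 p := is_diff_comp (is_diff_snd p) (is_diff_snd p.2).
have cs p : {for p, continuous sq} := is_diff_continuous (is_diff_sq p).
have c1 p : {for p, continuous (fun q : R * C => q.2.1)} := is_diff_continuous (x1 p).
have c2 p : {for p, continuous (fun q : R * C => q.2.2)} := is_diff_continuous (x2 p).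
have B1 p : Z p.2 -> is_diff p (bcomp1 \o sq) ((Ds D1)^~ p).
  move=> Zp; have [d1 _ _ _] := D (sq p) Zp.
  apply: (is_diff_ext (is_diff_comp (is_diff_sq p) d1)) => // v /=.
  by rewrite (is_diff_basis d1).
have B2 p : Z p.2 -> is_diff p (bcomp2 \o sq) ((Ds D2)^~ p).
  move=> Zp; have [_ d1 _ _] := D (sq p) Zp.
  apply: (is_diff_ext (is_diff_comp (is_diff_sq p) d1)) => // v /=.
  by rewrite (is_diff_basis d1).
have cDs (E : R * C -> R * C -> R) p : (forall v, {for sq p, continuous (E v)}) ->
    forall v, {for p, continuous (Ds E v)}.
  move=> cE v; have cEv u : {for p, continuous (fun q => E u (sq q))}.
    exact: (@continuous_comp _ _ _ sq (E u) p (cs p) (cE u)).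
  apply: cvgD; [apply: cvgD|]; apply: cvgM; try exact: cEv.
  - exact: cvg_cst.
  - apply: cvgM; first exact: cvg_cst.
    by apply: cvgB; apply: cvgM; try exact: cvg_cst; [exact: c1|exact: c2].
  - apply: cvgM; first exact: cvg_cst.
    by apply: cvgD; apply: cvgM; try exact: cvg_cst; [exact: c1|exact: c2].
pose y1 p := is_diff_mul (is_diff_const 2 p) (x1 p).
pose y2 p := is_diff_mul (is_diff_const 2 p) (x2 p).
pose y3 p := is_diff_mul (is_diff_const (- 2) p) (x2 p).
exists (fun v p => bcomp1 (sq p) * (2 * v.2.1) + (2 * p.2.1) * Ds D1 v p +
   (bcomp2 (sq p) * (2 * v.2.2) + (2 * p.2.2) * Ds D2 v p)).
exists (fun v p => bcomp1 (sq p) * (- 2 * v.2.2) + (- 2 * p.2.2) * Ds D1 v p +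
   (bcomp2 (sq p) * (2 * v.2.1) + (2 * p.2.1) * Ds D2 v p)).
move=> p Zp; have [_ _ cD1 cD2] := D (sq p) Zp.
have cb1 : {for p, continuous (bcomp1 \o sq)} := is_diff_continuous (B1 p Zp).
have cb2 : {for p, continuous (bcomp2 \o sq)} := is_diff_continuous (B2 p Zp).
split=> [||v|v].
- apply: (is_diff_ext (is_diff_add (is_diff_mul (B1 p Zp) (y1 p)) (is_diff_mul (B2 p Zp) (y2 p)))).
    by move=> q; rewrite avec1E.
  by move=> v /=; rewrite !mulr0 !addr0.
- apply: (is_diff_ext (is_diff_add (is_diff_mul (B1 p Zp) (y3 p)) (is_diff_mul (B2 p Zp) (y1 p)))).
    by move=> q; rewrite avec2E.
  by move=> v /=; rewrite !mulr0 !addr0.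
- apply: cvgD; apply: cvgD; apply: cvgM; try exact: cvg_cst; try exact: cDs;
    try exact: cb1; try exact: cb2; apply: cvgM; try exact: cvg_cst; [exact: c1|exact: c2].
- apply: cvgD; apply: cvgD; apply: cvgM; try exact: cvg_cst; try exact: cDs;
    try exact: cb1; try exact: cb2; apply: cvgM; try exact: cvg_cst; [exact: c2|exact: c1].
Qed.

End Avec.

(** * Derivatives of integrals depending on a parameter *)

Section DerivativeUnderInt.
Context {R : realType}.
Local Notation mu := (@lebesgue_measure R).

(** The hypotheses are local near each point (0,t). Compactness of [0,1] yields one neighbourhood of
    the parameter 0 valid for all times, on which dominated differentiation applies. *)
Lemma is_derive_Int (F G : R -> R -> R) :
  (forall t : R, \forall p \near ((0, t) : R * R),
     is_derive (p.1 : R) 1 (F^~ (p.2 : R)) (G p.1 p.2) /\ {for (p.2 : R), continuous (F p.1)}) ->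
  (forall t : R, {for ((0, t) : R * R), continuous (fun p : R * R => G p.1 p.2)}) ->
  is_derive (0 : R) 1 (fun e => Int 0 1 (F e)) (Int 0 1 (G 0)).
Proof.
move=> dF cG.
have cG0 : continuous (G 0).
  move=> t; have c1 : {for t, continuous (fun s : R => (0, s) : R * R)}.
    exact: (cvg_pair (cvg_cst _) cvg_id).
  exact: (@continuous_comp _ _ _ (fun s : R => (0, s) : R * R) (fun p => G p.1 p.2) t c1 (cG t)).
(* The bound [1 + |G 0 t|] serves as the integrable majorant of the derivative; it is independent of
   [e] and continuous in [t]. *)
pose P (e t : R) := [/\ is_derive e 1 (F^~ t) (G e t), {for t, continuous (F e)} &
  `|G e t| <= 1 + `|G 0 t|].
have /compact_near_coveringP/(_ _ (nbhs (0 : R)) P _) := @segment_compact R 0 1.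
have nP (t : R) : `[0, 1]%classic t ->
    \forall t' \near t & e \near (0 : R), P e t'.
  move=> _.
  have nQ : \forall p \near ((0, t) : R * R), P p.1 p.2.
    have nG : \forall p \near ((0, t) : R * R), `|G p.1 p.2| <= 1 + `|G 0 p.2|.
      (* [G p.1 p.2] and [G 0 p.2] are both within 1/2 of [G 0 t], hence within 1 of each other. *)
      have half : (0 : R) < 2^-1 by rewrite invr_gt0.
      have /cvgrPdist_lt/(_ _ half) n1 := cG t.
      have n2 : \forall p \near ((0, t) : R * R), `|G 0 t - G 0 p.2| < 2^-1.
        have /cvgrPdist_lt/(_ _ half) n2 := cG0 t.
        exact: (@cvg_snd _ _ (nbhs (0 : R)) (nbhs t) _ _ n2).
      apply: filterS2 n1 n2 => p /= n1 n2.
      have -> : G p.1 p.2 = (G 0 t - G 0 p.2) - (G 0 t - G p.1 p.2) + G 0 p.2 by ring.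
      apply: (le_trans (ler_normD _ _)); rewrite lerD2r.
      apply: (le_trans (ler_normB _ _)); lra.
    by apply: filterS2 (dF t) nG => p [].
  case: nQ => -[A B] /= [nA nB] AB; exists (B, A) => //= -[s e] [/= Bs Ae].
  exact: (AB (e, s)).
move=> /(_ nP) /nbhs_ballP[d /= d0 dP].
have Ia : `]- d, d[%classic (0 : R) by rewrite /= in_itv/= oppr_lt0 d0.
have PI (e : R) : `]- d, d[%classic e -> forall t, `[0, 1]%classic t -> P e t.
  by rewrite /= in_itv/= => ed t t01; apply: dP => //; rewrite -ball_normE/= sub0r normrN ltr_norml.
have intF (e : R) : `]- d, d[%classic e -> mu.-integrable `[0, 1] (EFin \o F e).
  move=> Ie; apply: continuous_compact_integrable; first exact: segment_compact.
  apply: continuous_in_subspaceT => t; rewrite inE => t01.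
  by have [] := PI _ Ie _ t01.
have derF (e t : R) : `]- d, d[%classic e -> `[0, 1]%classic t -> derivable (F^~ t) e 1.
  by move=> Ie t01; have [[]] := PI _ Ie _ t01.
have d1E (e t : R) : `]- d, d[%classic e -> `[0, 1]%classic t -> partial1of2 F e t = G e t.
  move=> Ie t01; rewrite partial1of2E; have [h _ _] := PI _ Ie _ t01.
  exact: (@derive_val _ _ _ _ _ _ _ h).
have cB : continuous (fun t => 1 + `|G 0 t|).
  by move=> t; apply: cvgD; [exact: cvg_cst|apply: cvg_norm; exact: cG0].
have B0 t : 0 <= 1 + `|G 0 t| by rewrite addr_ge0.
have ub (e t : R) : `]- d, d[%classic e -> `[0, 1]%classic t ->
    `|partial1of2 F e t| <= 1 + `|G 0 t|.
  by move=> Ie t01; rewrite d1E//; have [] := PI _ Ie _ t01.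
have iB := continuous_integrable 0 1 cB.
have mD : measurable (`[0%R, 1%R]%classic : set R) by [].
apply: DeriveDef.
  exact: (@derivable_under_integral _ _ _ mu F _ mD _ _ _ Ia intF derF _ B0 iB ub).
rewrite -derive1E (@differentiation_under_integral _ _ _ mu F _ mD _ _ _ Ia intF derF _ B0 iB ub).
apply: eq_Rintegral => t; rewrite inE => t01; exact: d1E.
Qed.

Lemma is_derive_chain (V W : normedModType R) (f df : V -> W) (g : R -> V) (e : R) dg :
  is_diff (g e) f df -> is_derive e 1 g dg -> is_derive e 1 (fun x => f (g x)) (df dg).
Proof.
move=> [f_diff f_val] [g_der <-].
have g_diff : differentiable g e by apply/derivable1_diffP.
have h_diff := differentiable_comp g_diff f_diff.
apply: (@DeriveDef _ _ _ _ _ (f \o g)).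
  by apply: diff_derivable.
rewrite deriveE// (diff_comp g_diff f_diff) /= -f_val; congr ('d f _ _).
by rewrite deriveE.
Qed.

End DerivativeUnderInt.

(** * Families continuously differentiable in the perturbation parameter *)

Section Regular.
Context {R : realType}.
Implicit Types (f g : R * R -> R) (p : R * R).

(* [f (e, t)] is continuously differentiable in [e], jointly in [t], for [e]
   near 0; [f'] is the derivative. *)
Definition regular f f' : Prop := forall t : R, \forall p \near ((0, t) : R * R),
  [/\ is_derive (p.1 : R) 1 (fun e => f (e, p.2)) (f' p),
      {for p, continuous f} & {for p, continuous f'}].

Lemma regularD f g f' g' : regular f f' -> regular g g' ->
  regular (fun p => f p + g p) (fun p => f' p + g' p).
Proof.
move=> hf hg t; apply: filterS2 (hf t) (hg t) => p [d1 c1 c1'] [d2 c2 c2'].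
by split; [exact: is_deriveD|apply: cvgD|apply: cvgD].
Qed.

Lemma regularM f g f' g' : regular f f' -> regular g g' ->
  regular (fun p => f p * g p) (fun p => f p * g' p + g p * f' p).
Proof.
move=> hf hg t; apply: filterS2 (hf t) (hg t) => -[e u] [d1 c1 c1'] [d2 c2 c2'].
split; [exact: (is_deriveM d1 d2)|exact: cvgM|].
by apply: cvgD; apply: cvgM.
Qed.

Lemma regular_snd (h : R -> R) : continuous h ->
  regular (fun p => h p.2) (fun=> 0).
Proof.
move=> ch t; apply: (@nearW _ (nbhs ((0, t) : R * R))) => p; split.
  exact: (is_derive_cst (h p.2) (p.1 : R) 1).
  exact: (@continuous_comp _ _ _ snd h p cvg_snd (ch p.2)).
exact: cvg_cst.
Qed.

(** Derivability is asked only near 0, with a view to the inverse of [normf], which is controlled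
    only where [normf] does not vanish. *)
Lemma regular_fst (h h' : R -> R) :
  (\forall e \near (0 : R), is_derive (e : R) 1 h (h' e) /\ {for (e : R), continuous h'}) ->
  regular (fun p => h p.1) (fun p => h' p.1).
Proof.
move=> dh t; have : \forall p \near ((0, t) : R * R),
    is_derive (p.1 : R) 1 h (h' p.1) /\ {for (p.1 : R), continuous h'}.
  exact: (@cvg_fst _ _ (nbhs (0 : R)) (nbhs t) _ _ dh).
apply: filterS => p [d1 c1]; split=> //; last first.
  exact: (@continuous_comp _ _ _ fst h' p cvg_fst c1).
apply: (@continuous_comp _ _ _ fst h p cvg_fst).
by apply/differentiable_continuous/derivable1_diffP; case: d1.
Qed.

Lemma regular_shift (h h' : R -> R) : (forall t : R, is_derive t 1 h (h' t)) ->
  continuous h' -> regular (fun p => h (p.2 + p.1)) (fun p => h' (p.2 + p.1)).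
Proof.
move=> dh ch' t; apply: (@nearW _ (nbhs ((0, t) : R * R))) => p.
have ca : {for p, continuous (fun p : R * R => p.2 + p.1)} by apply: cvgD; [exact: cvg_snd|exact: cvg_fst].
have ch : continuous h.
  by move=> x; apply/differentiable_continuous/derivable1_diffP; case: (dh x).
split.
- apply: (is_derive_eq (@is_derive1_comp _ h (fun e => p.2 + e) p.1 _ 1 (dh _) _)).
    apply: (is_derive_eq (is_deriveD (is_derive_cst p.2 (p.1 : R) 1) (is_derive_id (p.1 : R) 1))).
    by rewrite add0r.
  by rewrite mulr1.
- exact: (@continuous_comp _ _ _ _ h p ca (ch _)).
- exact: (@continuous_comp _ _ _ _ h' p ca (ch' _)).
Qed.

Lemma regular_Int f f' : regular f f' ->
  is_derive (0 : R) 1 (fun e => Int 0 1 (fun t => f (e, t)))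
    (Int 0 1 (fun t => f' (0, t))).
Proof.
move=> rf; apply: (@is_derive_Int _ (fun e t => f (e, t)) (fun e t => f' (e, t))) => t.
  apply: filterS (rf t) => -[e u] [d c _]; split=> //=.
  have c1 : {for u, continuous (fun v : R => (e, v) : R * R)}.
    exact: (cvg_pair (cvg_cst _) cvg_id).
  exact: (@continuous_comp _ _ _ _ f u c1 c).
have [_ _ c] := nbhs_singleton (rf t).
rewrite (_ : (fun p => _) = f')//; by apply/funext => -[].
Qed.

End Regular.

Section RegularAvec.
Context {R : realType}.
Local Notation C := (R * R)%type.
Variables (Q : set C) (b : R -> C -> C).
Hypothesis open_Q : open Q.
Local Notation Z := (varsigma @^-1` Q).
Variables A1 A2 : R * C -> R * C -> R.
Hypothesis hA : forall p : R * C, Z p.2 ->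
  [/\ is_diff p (avec1 b) (A1^~ p), is_diff p (avec2 b) (A2^~ p),
      forall v, {for p, continuous (A1 v)} & forall v, {for p, continuous (A2 v)}].

Lemma varsigma_continuous : continuous (@varsigma R).
Proof. by move=> w; exact: is_diff_continuous (is_diff_varsigma w). Qed.

Lemma open_Z : open Z.
Proof. by apply: open_comp => // w _; exact: varsigma_continuous. Qed.

Lemma regular_comp (F : R * C -> R) (DF : R * C -> R * C -> R)
    (T X Y T' X' Y' : R * R -> R) :
  (forall p : R * C, Z p.2 -> is_diff p F (DF^~ p) /\ forall v, {for p, continuous (DF v)}) ->
  regular T T' -> regular X X' -> regular Y Y' -> (forall t, Z (X (0, t), Y (0, t))) ->
  let P p : R * C := (T p, (X p, Y p)) in
  regular (fun p => F (P p))
    (fun p => T' p * DF dir_t (P p) + X' p * DF dir_x (P p) + Y' p * DF dir_y (P p)).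
Proof.
move=> hF rT rX rY Z0 P t.
have [_ cX0 _] := nbhs_singleton (rX t); have [_ cY0 _] := nbhs_singleton (rY t).
have cXY : {for (0, t), continuous (fun p => (X p, Y p) : C)} by exact: (cvg_pair cX0 cY0).
(* Only the unperturbed point is known to lie in [Z]; openness keeps nearby points there. This is
   why [regular] is a condition near each (0,t). *)
have nZ : \forall p \near ((0, t) : R * R), Z (X p, Y p).
  by apply: cXY; apply: open_nbhs_nbhs; split; [exact: open_Z|exact: Z0].
apply: filterS2 (filterI (rT t) nZ) (filterI (rX t) (rY t)).
move=> -[e u] [[dT cT cT'] Zp] [[dX cX cX'] [dY cY cY']].
have cP : {for (e, u), continuous P} by exact: (cvg_pair cT (cvg_pair cX cY)).
have [dF cDF] := hF (P (e, u)) Zp.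
have cD v : {for (e, u), continuous (fun p => DF v (P p))}.
  exact: (@continuous_comp _ _ _ P (DF v) _ cP (cDF v)).
split.
- have dP := is_derive_pair dT (is_derive_pair dX dY).
  apply: (is_derive_eq (is_derive_chain dF dP)).
  by rewrite (is_diff_basis dF).
- exact: (@continuous_comp _ _ _ P F _ cP (is_diff_continuous dF)).
- apply: cvgD; last by apply: cvgM; [exact: cY'|exact: cD].
  by apply: cvgD; apply: cvgM; [exact: cT'|exact: cD|exact: cX'|exact: cD].
Qed.

(** Common source of both variations of [Theta]: [T] is the time, [(X, Y)] the point and [(V, W)]
    the vector, each moving with the parameter. It is applied to the time shift and to the
    perturbation of a loop. *)
Lemma regular_avec (T X Y V W T' X' Y' V' W' : R * R -> R) :
  regular T T' -> regular X X' -> regular Y Y' -> regular V V' -> regular W W' ->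
  (forall t, Z (X (0, t), Y (0, t))) ->
  let P p : R * C := (T p, (X p, Y p)) in
  is_derive (0 : R) 1
    (fun e => Int 0 1 (fun t =>
       dot0 (avec b (T (e, t)) (X (e, t), Y (e, t))) (V (e, t), W (e, t))))
    (Int 0 1 (fun t => let p := (0, t) in
       avec1 b (P p) * V' p + V p * (T' p * A1 dir_t (P p) + X' p * A1 dir_x (P p) + Y' p * A1 dir_y (P p))
     + (avec2 b (P p) * W' p + W p * (T' p * A2 dir_t (P p) + X' p * A2 dir_x (P p) + Y' p * A2 dir_y (P p))))).
Proof.
move=> rT rX rY rV rW Z0 P.
have r1 := regular_comp (F := avec1 b) (DF := A1) (fun p Zp => let: And4 h1 _ h3 _ := hA Zp in conj h1 h3) rT rX rY Z0.
have r2 := regular_comp (F := avec2 b) (DF := A2) (fun p Zp => let: And4 _ h2 _ h4 := hA Zp in conj h2 h4) rT rX rY Z0.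
exact: (regular_Int (regularD (regularM r1 rV) (regularM r2 rW))).
Qed.

Lemma adotE t w : Z w -> adot b t w = (A1 dir_t (t, w), A2 dir_t (t, w)).
Proof.
move=> Zw; have [d1 d2 _ _] := hA (p := (t, w)) Zw; apply: derive1_val.
have dp : is_derive t 1 (fun s : R => (s, w) : R * C) dir_t.
  exact: (is_derive_pair (is_derive_id t 1) (is_derive_cst w t 1)).
have := is_derive_pair (is_derive_chain d1 dp) (is_derive_chain d2 dp).
rewrite (_ : (fun x => (avec1 b (x, w), avec2 b (x, w))) = (fun s => avec b s w))//.
Qed.

Lemma rot_aE t w : Z w -> rot_a b t w = A2 dir_x (t, w) - A1 dir_y (t, w).
Proof.
move=> Zw; have [d1 d2 _ _] := hA (p := (t, w)) Zw.
have dp : is_diff w (fun v : C => (t, v) : R * C) (fun v => (0, v)).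
  exact: (is_diff_pair (is_diff_cst t w) (is_diff_linear w (f := id) _ (fun _ => cvg_id))).
have h1 := is_diff_comp dp d1; have h2 := is_diff_comp dp d2.
rewrite /rot_a; congr (_ - _).
  rewrite deriveE; last by case: h2.
  by rewrite (is_diffE h2).
rewrite deriveE; last by case: h1.
by rewrite (is_diffE h1).
Qed.

Lemma dot_varthetaE t w xi : Z w -> dot_vartheta b t w xi = dot0 (adot b t w) xi.
Proof.
move=> Zw; have [d1 d2 _ _] := hA (p := (t, w)) Zw; apply: derive1_val.
have dp : is_derive t 1 (fun s : R => (s, w) : R * C) dir_t.
  exact: (is_derive_pair (is_derive_id t 1) (is_derive_cst w t 1)).
have := is_deriveD (is_deriveMc xi.1 (is_derive_chain d1 dp)) (is_deriveMc xi.2 (is_derive_chain d2 dp)).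
rewrite adotE// /dot0/= [A1 _ _ * _]mulrC [A2 _ _ * _]mulrC.
suff -> : (fun s => vartheta b s w xi) =
  (fun y => xi.1 * avec1 b (y, w)) + (fun y => xi.2 * avec2 b (y, w)) by [].
by apply/funext => s; rewrite vartheta_dot0 /dot0 mulrC [_ * xi.2]mulrC.
Qed.

End RegularAvec.

(** * Loops and the time reparametrization *)

Section LoopFacts.
Context {R : realType}.
Local Notation C := (R * R)%type.
Implicit Types (z xi zeta eta : R -> R * R) (s : bool) (A B : set (R * R)).

Lemma loops_is_derive s A z : loops s A z ->
  forall t : R, is_derive t 1 z (derive1 z t).
Proof. by case=> dz _ _ t; apply: is_derive_derive1; exact: (dz 0%N). Qed.

Lemma loops_continuous s A z : loops s A z -> continuous z.
Proof.
by case=> dz _ _ t; apply/differentiable_continuous/derivable1_diffP; exact: (dz 0%N).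
Qed.

Lemma loops_setT s A z : loops s A z -> loops s setT z.
Proof. by case. Qed.

Lemma is_derive_translate (W : normedModType R) (f : R -> W) (t a : R) d :
  is_derive (t + a) 1 f d -> is_derive t 1 (fun u => f (u + a)) d.
Proof.
move=> /cvg_is_derive fd; apply: is_derive_cvg; move: fd.
by under eq_fun do rewrite addrA.
Qed.

Lemma loops_derive1 s A z : loops s A z -> loops s setT (derive1 z).
Proof.
move=> lz; have [dz _ pz] := lz; split; [move=> n t|by []|move=> t].
  by rewrite -derive1nSn; exact: dz.
have d1 := is_derive_translate (loops_is_derive lz (t + 1)).
rewrite -(derive1_val d1); apply: derive1_val.
rewrite (_ : (fun u => z (u + 1)) = ((-1) ^+ s *: z)); last exact/funext.
exact: is_deriveZ (loops_is_derive lz t).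
Qed.

Lemma derive1nB (f g : R -> C) n : (forall n t, derivable (derive1n n f) t 1) ->
  (forall n t, derivable (derive1n n g) t 1) -> forall k : R,
  derive1n n (fun t => f t + k *: g t) = fun t => derive1n n f t + k *: derive1n n g t.
Proof.
elim: n f g => [//|n ih] f g df dg k; rewrite derive1nSn.
rewrite [derive1 _](_ : _ = fun t => derive1 f t + k *: derive1 g t).
  rewrite ih; [by rewrite !derive1nSn| |] => m t; rewrite -derive1nSn.
    exact: df.
  exact: dg.
apply/funext => t; apply: derive1_val; apply: is_deriveD.
  exact/is_derive_derive1/(df 0%N).
exact: is_deriveZ (is_derive_derive1 (dg 0%N t)).
Qed.

Lemma loops_addZ s A B z xi (k : R) : loops s A z -> loops s B xi ->
  loops s setT (fun t => z t + k *: xi t).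
Proof.
move=> [dz _ pz] [dx _ px]; split; [move=> n t|by []|move=> t].
  rewrite (derive1nB _ dz dx); apply: (derivableD (dz n t)).
  exact: derivableZ (dx n t).
by rewrite pz px scalerDr !scalerA mulrC.
Qed.

Lemma derive1_addZ s A B z xi (k t : R) : loops s A z -> loops s B xi ->
  derive1 (fun t => z t + k *: xi t) t = derive1 z t + k *: derive1 xi t.
Proof.
move=> lz lx; apply: derive1_val; apply: is_deriveD; first exact: loops_is_derive lz t.
exact: is_deriveZ (loops_is_derive lx t).
Qed.

Lemma loops0 s : loops s setT (0 : R -> C).
Proof.
apply: (smooth_pair_loops (f := cst 0) (g := cst 0)) => [k|k|t|t]; rewrite ?mulr0//.
  exact: derivable_upto_cst.
exact: derivable_upto_cst.
Qed.

Lemma scaleN_loops s z : loops s setT z -> forall k : R, loops s setT (fun t => k *: z t).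
Proof.
move=> lz k; have := loops_addZ k (loops0 s) lz.
by rewrite (_ : (fun t => _) = fun t => k *: z t)//; apply/funext => t; rewrite add0r.
Qed.

(** Two different parities would give z = -z. As a result the tangent space of a nonzero loop is a
    single space [loops s setT]. *)
Lemma loops_parity s s' A B z : loops s A z -> loops s' B z -> z <> 0 -> s = s'.
Proof.
move=> [_ _ p1] [_ _ p2] z0; apply: contrapT => ss'; apply: z0; apply/funext => t.
have e : z t = - z t.
  move: (p1 t); rewrite p2; case: s s' ss' {p1 p2} => -[]//= _;
    rewrite ?expr1 ?expr0 ?scaleN1r ?scale1r// => {1}->.
move: e => /eqP; rewrite -addr_eq0 -mulr2n -scaler_nat scaler_eq0 pnatr_eq0/=.
by move=> /eqP.
Qed.

Lemma tangentE s A z : loops s A z -> z <> 0 -> tangent z = loops s setT.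
Proof.
move=> lz z0; apply/seteqP; split=> xi.
  by case=> s' l' lx; rewrite (loops_parity lz l' z0).
by move=> lx; exists s => //; exact: loops_setT lz.
Qed.

Lemma dot0_ge0 (v : C) : 0 <= dot0 v v.
Proof. by rewrite /dot0 -!expr2 addr_ge0 ?sqr_ge0. Qed.

Lemma dot0_eq0 (v : C) : dot0 v v = 0 -> v = 0.
Proof.
rewrite /dot0 -!expr2 => /eqP; rewrite paddr_eq0 ?sqr_ge0// !sqrf_eq0.
by case: v => x y /= /andP[/eqP -> /eqP ->].
Qed.

Lemma enorm_sq (v : C) : enorm v ^+ 2 = dot0 v v.
Proof. by rewrite sqr_sqrtr// dot0_ge0. Qed.

Lemma inner_ge0 z : 0 <= inner z z.
Proof. by apply: Rintegral_ge0 => t _; exact: dot0_ge0. Qed.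

Lemma norm2_sq z : norm2 z ^+ 2 = inner z z.
Proof. by rewrite sqr_sqrtr// inner_ge0. Qed.

Lemma norm2_4 z : norm2 z ^+ 4 = inner z z ^+ 2.
Proof. by rewrite -norm2_sq -exprM. Qed.

Lemma dot0_continuous z xi : continuous z -> continuous xi ->
  continuous (fun t : R => dot0 (z t) (xi t)).
Proof.
move=> cz cx t; apply: cvgD; apply: cvgM;
  [exact: (fst_comp_continuous cz)|exact: (fst_comp_continuous cx)
  |exact: (snd_comp_continuous cz)|exact: (snd_comp_continuous cx)].
Qed.

Lemma innerC z xi : inner z xi = inner xi z.
Proof. by apply: eq_Int => t _; rewrite /dot0 mulrC [(z t).2 * _]mulrC. Qed.

Lemma innerDr z xi zeta : continuous z -> continuous xi -> continuous zeta ->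
  inner z (fun t => xi t + zeta t) = inner z xi + inner z zeta.
Proof.
move=> cz cx cy; rewrite /inner -IntD; try exact: dot0_continuous.
by apply: eq_Int => t _; rewrite /dot0/=; ring.
Qed.

Lemma innerZr z xi (k : R) : continuous z -> continuous xi ->
  inner z (fun t => k *: xi t) = k * inner z xi.
Proof.
move=> cz cx; rewrite /inner -IntZ; last exact: dot0_continuous.
by apply: eq_Int => t _; rewrite /dot0/= /GRing.scale/=; ring.
Qed.

Lemma scale_continuous (k : R) z : continuous z -> continuous (fun t => k *: z t).
Proof. by move=> cz t; apply: cvgZr; exact: cz. Qed.

Lemma add_continuous_fun z xi : continuous z -> continuous xi ->
  continuous (fun t => z t + xi t).
Proof. by move=> cz cx t; apply: cvgD; [exact: cz|exact: cx]. Qed.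

Lemma innerDl z xi zeta : continuous z -> continuous xi -> continuous zeta ->
  inner (fun t => xi t + zeta t) z = inner xi z + inner zeta z.
Proof. by move=> ? ? ?; rewrite innerC innerDr// !(innerC z). Qed.

Lemma innerZl z xi (k : R) : continuous z -> continuous xi ->
  inner (fun t => k *: xi t) z = k * inner xi z.
Proof. by move=> ? ?; rewrite innerC innerZr// (innerC z). Qed.

Lemma inner0r z : inner z 0 = 0.
Proof.
rewrite /inner -[RHS](Int0 0 1); apply: eq_Int => t _.
by rewrite /dot0/= !mulr0 addr0.
Qed.

Lemma inner0l z : inner 0 z = 0.
Proof. by rewrite innerC inner0r. Qed.

Lemma inner_perturb z xi (e : R) : continuous z -> continuous xi ->
  inner (fun t => z t + e *: xi t) (fun t => z t + e *: xi t) =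
  inner z z + 2 * e * inner z xi + e ^+ 2 * inner xi xi.
Proof.
move=> cz cx; have cex := scale_continuous (k := e) cx.
rewrite innerDr//; last exact: add_continuous_fun.
rewrite !innerDl// !(innerZr, innerZl)// (innerC xi z); ring.
Qed.

Lemma periodic_eq0 s (h : R -> C) : (forall t, h (t + 1) = (-1) ^+ s *: h t) ->
  (forall t, 0 <= t < 1 -> h t = 0) -> h = 0.
Proof.
move=> ph h0; have sgn (v : C) : ((-1) ^+ s *: v = 0) -> v = 0.
  by move=> /eqP; rewrite scaler_eq0 signr_eq0 => /eqP.
have up (n : nat) t : 0 <= t < 1 -> h (t + n%:R) = 0.
  move=> t01; elim: n => [|n ih]; first by rewrite addr0 h0.
  by rewrite -[n.+1]addn1 natrD addrA ph ih scaler0.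
have down (n : nat) t : 0 <= t < 1 -> h (t - n%:R) = 0.
  move=> t01; elim: n => [|n ih]; first by rewrite subr0 h0.
  by apply: sgn; rewrite -ph -[n.+1]addn1 natrD opprD addrA subrK.
apply/funext => t; pose m := Num.floor t.
have tm : 0 <= t - m%:~R < 1.
  have := floor_le t; have := floorD1_gt t; rewrite intrD -/m => h1 h2.
  by apply/andP; split; lra.
rewrite -[t](subrK m%:~R); case: m tm => n tm; first exact: up.
by rewrite NegzE mulrNz; rewrite NegzE mulrNz in tm; exact: down.
Qed.

Lemma continuous_eq0 (h : R -> C) : continuous h ->
  (forall t, 0 < t < 1 -> h t = 0) -> forall t, 0 <= t < 1 -> h t = 0.
Proof.
move=> ch h0 t /andP[]; rewrite le_eqVlt => /predU1P[<-|t0] t1; last first.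
  by apply: h0; rewrite t0.
(* The sequence starts at 1/2, so that every term lies strictly inside ]0,1[, where [h] is known to
   vanish. *)
have c0 : ((n.+2%:R)^-1 : R) @[n --> \oo] --> 0.
  by have := @cvg_harmonic R; rewrite -cvg_shiftS.
have ch0 := cvg_comp _ _ c0 (ch 0).
apply/esym; apply: (cvg_unique _ _ ch0) => //.
rewrite (_ : (h \o _) = cst 0); first exact: cvg_cst.
by apply/funext => n; rewrite /= h0// invr_gt0 ltr0n/= invf_lt1 ?ltr0n// ltr1n.
Qed.

Lemma loops_inner_gt0 s A z : loops s A z -> z <> 0 -> 0 < inner z z.
Proof.
move=> lz z0; have cz := loops_continuous lz; rewrite lt_neqAle inner_ge0 andbT eq_sym.
apply/negP => /eqP iz; apply: z0; have [_ _ pz] := lz.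
have cd : continuous (fun t => dot0 (z t) (z t)) by exact: dot0_continuous.
have zi t : 0 < t < 1 -> z t = 0.
  by move=> t01; apply: dot0_eq0; apply: (Int_ge0_eq0 cd _ ler01 iz) => // x; exact: dot0_ge0.
by apply: (periodic_eq0 pz); exact: continuous_eq0.
Qed.

(** The squared length of the difference has integral 0 and so vanishes inside; the point 0 follows
    by continuity. The half-open period is enough to determine a loop. *)
Lemma continuous_eqL2 z xi : continuous z -> continuous xi -> eqL2 z xi ->
  forall t, 0 <= t < 1 -> z t = xi t.
Proof.
move=> cz cx zx t t01; apply/eqP; rewrite -subr_eq0; apply/eqP.
have ch : continuous (fun t => z t - xi t).
  by move=> u; apply: cvgB; [exact: cz|exact: cx].
apply: (continuous_eq0 ch) t01 => u u01; apply: dot0_eq0.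
pose h t := z t - xi t; have cd : continuous (fun t => dot0 (h t) (h t)) by exact: dot0_continuous.
apply: (Int_ge0_eq0 cd _ ler01 _ u01) => [x|]; first exact: dot0_ge0.
rewrite -[RHS](Int0 0 1) /Int /Rintegral; congr fine.
apply: ae_eq_integral => //.
- by apply/measurable_EFinP; apply: measurable_funTS; exact: continuous_measurable_fun.
- apply: ae_imply zx => x e /=; rewrite /h => x01; rewrite e// subrr /dot0/= mulr0 addr0//.
Qed.

End LoopFacts.

Section ContinuousFunctions.
Context {R : realType} {T : topologicalType}.
Implicit Types f g : T -> R.

Lemma contD f g : continuous f -> continuous g -> continuous (fun t => f t + g t).
Proof. by move=> cf cg t; apply: cvgD; [exact: cf|exact: cg]. Qed.

Lemma contB f g : continuous f -> continuous g -> continuous (fun t => f t - g t).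
Proof. by move=> cf cg t; apply: cvgB; [exact: cf|exact: cg]. Qed.

Lemma contM f g : continuous f -> continuous g -> continuous (fun t => f t * g t).
Proof. by move=> cf cg t; apply: cvgM; [exact: cf|exact: cg]. Qed.

Lemma contN f : continuous f -> continuous (fun t => - f t).
Proof. by move=> cf t; apply: cvgN; exact: cf. Qed.

Lemma cont_cst (c : R) : continuous (fun _ : T => c).
Proof. exact: cst_continuous. Qed.

End ContinuousFunctions.

(** Structural descent through an integrand. The leaves are closed by continuity hypotheses, which
    is why such facts are placed in the context beforehand. *)
Ltac solve_cont := lazymatch goal with
  | |- forall x, continuous_at x (fun _ => ?c) => exact: cont_cst
  | |- forall x, continuous_at x (fun t => (@?f t - @?g t)%R) =>
      refine (@contB _ _ f g _ _); solve_cont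
  | |- forall x, continuous_at x (fun t => (@?f t + @?g t)%R) =>
      refine (@contD _ _ f g _ _); solve_cont
  | |- forall x, continuous_at x (fun t => (- @?f t)%R) =>
      refine (@contN _ _ f _); solve_cont
  | |- forall x, continuous_at x (fun t => (@?f t * @?g t)%R) =>
      refine (@contM _ _ f g _ _); solve_cont
  | |- forall x, continuous_at x (fun t => dot0 (@?f t) (@?g t)) =>
      refine (@dot0_continuous _ f g _ _); solve_cont
  | |- forall x, continuous_at x (fun t => fst (@?f t)) =>
      refine (@fst_comp_continuous _ _ f _); solve_cont
  | |- forall x, continuous_at x (fun t => snd (@?f t)) =>
      refine (@snd_comp_continuous _ _ f _); solve_cont
  | |- forall x, continuous_at x (fun t => prim ?f t) =>
      refine (@prim_continuous _ f _); solve_cont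
  | |- forall x, continuous_at x (prim ?f) =>
      refine (@prim_continuous _ f _); solve_cont
  | |- forall x, continuous_at x (fun t => ?h t) =>
      first [match goal with H : forall x, continuous_at x h |- _ => exact H end | assumption]
  | |- _ => assumption
  end.

Section IntLinear.
Context {R : realType}.
Implicit Types f g h u : R -> R.

Lemma Int_lin3 (a c : R) f g h (k l m : R) : continuous f -> continuous g -> continuous h ->
  Int a c (fun t => k * f t + l * g t + m * h t) =
  k * Int a c f + l * Int a c g + m * Int a c h.
Proof.
by move=> cf cg ch; rewrite IntD; [rewrite IntD; [rewrite !IntZ|..]|..] => //; solve_cont.
Qed.

Lemma Int_lin2 (a c : R) f g (k l : R) : continuous f -> continuous g ->
  Int a c (fun t => k * f t + l * g t) = k * Int a c f + l * Int a c g.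
Proof. by move=> cf cg; rewrite IntD; [rewrite !IntZ|..] => //; solve_cont. Qed.

End IntLinear.

(** * The magnetic form on loop space *)

Section LoopMagnetic.
Context {R : realType}.
Local Notation C := (R * R)%type.
Implicit Types (z xi zeta eta : R -> R * R).

Section Definitions.
Variable b : R -> C -> C.

Definition sqn z (t : R) : R := dot0 (z t) (z t).

(* [tq] and [dtq] extend [tz] and [dtz] smoothly to negative times. *)
Definition tq z (t : R) : R := (inner z z)^-1 * prim (sqn z) t.

Definition dtq z xi (t : R) : R :=
  2 / inner z z * prim (fun s => dot0 (z s) (xi s)) t -
  2 * inner z xi / inner z z ^+ 2 * prim (sqn z) t.

Definition adq z (t : R) : C := adot b (tq z t) (z t).
Definition roq z (t : R) : R := rot_a b (tq z t) (z t).

(** Continuous representative of the Lorentz force. The first two terms are the local part of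
    -dTheta(eta, .). The multiples of [z] represent the part that contains [dtz z zeta]: the
    integral of [g] over [t,1] from the partial integral of <z, zeta>, the constant from the
    variation of the normalization of [tz]. *)
Definition lorentz_expr z eta (t : R) : C :=
  let g s := dot0 (adq z s) (eta s) in
  - roq z t *: imul (eta t) - dtq z eta t *: adq z t
  + (2 / inner z z * (prim g 1 - prim g t)) *: z t
  - (2 / inner z z ^+ 2 * Int 0 1 (fun s => prim (sqn z) s * g s)) *: z t.

End Definitions.

Lemma sqn_continuous z : continuous z -> continuous (sqn z).
Proof. by move=> cz; exact: dot0_continuous. Qed.

Lemma tzE z t : 0 <= t -> tz z t = tq z t.
Proof.
move=> t0; rewrite /tz /tq norm2_sq prim_ge0//; congr (_ * _).
by apply: eq_Int => u _; rewrite enorm_sq.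
Qed.

Lemma dtzE z xi t : 0 <= t -> dtz z xi t = dtq z xi t.
Proof.
move=> t0; rewrite /dtz /dtq norm2_sq norm2_4 !prim_ge0//; congr (_ - _ * _).
by apply: eq_Int => u _; rewrite enorm_sq.
Qed.

Lemma tq_continuous z : continuous z -> continuous (tq z).
Proof. by move=> cz; have := sqn_continuous cz => cq; rewrite /tq; solve_cont. Qed.

Lemma dtq_continuous z xi : continuous z -> continuous xi -> continuous (dtq z xi).
Proof. by move=> cz cx; have := sqn_continuous cz => cq; rewrite /dtq; solve_cont. Qed.

Lemma is_derive_tq z (t : R) : continuous z ->
  is_derive t 1 (tq z) ((inner z z)^-1 * sqn z t).
Proof.
by move=> cz; apply: is_deriveMc; apply: is_derive_prim; exact: sqn_continuous.
Qed.

Lemma tq0 z : tq z 0 = 0.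
Proof. by rewrite /tq prim0 mulr0. Qed.

Lemma tq1 z : 0 < inner z z -> tq z 1 = 1.
Proof. by move=> N0; rewrite /tq prim_ge0// mulVf// gt_eqF. Qed.

Variables (Q : set C) (b : R -> C -> C).
Hypothesis open_Q : open Q.
Hypothesis periodic_b : forall t w, Q w -> b (t + 1) w = b t w.
Local Notation Z := (varsigma @^-1` Q).
Variables A1 A2 : R * C -> R * C -> R.
Hypothesis hA : forall p : R * C, Z p.2 ->
  [/\ is_diff p (avec1 b) (A1^~ p), is_diff p (avec2 b) (A2^~ p),
      forall v, {for p, continuous (A1 v)} & forall v, {for p, continuous (A2 v)}].

Variable z : R -> C.
Hypotheses (cz : continuous z) (Zz : forall t, Z (z t)).

Let P (t : R) : R * C := (tq z t, z t).
Local Notation N := (inner z z).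

Lemma cP : continuous P.
Proof. by apply: pair_continuous => //; exact: tq_continuous. Qed.

Lemma A1_continuous v : continuous (fun t : R => A1 v (P t)).
Proof.
move=> t; have [_ _ h _] := hA (p := P t) (Zz t).
exact: (@continuous_comp _ _ _ P (A1 v) t (@cP t) (h v)).
Qed.

Lemma A2_continuous v : continuous (fun t : R => A2 v (P t)).
Proof.
move=> t; have [_ _ _ h] := hA (p := P t) (Zz t).
exact: (@continuous_comp _ _ _ P (A2 v) t (@cP t) (h v)).
Qed.

Lemma avec1_continuous : continuous (fun t : R => avec1 b (P t)).
Proof.
move=> t; have [h _ _ _] := hA (p := P t) (Zz t).
exact: (@continuous_comp _ _ _ P (avec1 b) t (@cP t) (is_diff_continuous h)).
Qed.

Lemma avec2_continuous : continuous (fun t : R => avec2 b (P t)).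
Proof.
move=> t; have [_ h _ _] := hA (p := P t) (Zz t).
exact: (@continuous_comp _ _ _ P (avec2 b) t (@cP t) (is_diff_continuous h)).
Qed.

Lemma adqE t : adq b z t = (A1 dir_t (P t), A2 dir_t (P t)).
Proof. exact: (adotE hA _ (Zz t)). Qed.

Lemma roqE t : roq b z t = A2 dir_x (P t) - A1 dir_y (P t).
Proof. exact: (rot_aE hA _ (Zz t)). Qed.

Lemma adq_continuous : continuous (adq b z).
Proof.
rewrite (_ : adq b z = fun t => (A1 dir_t (P t), A2 dir_t (P t))); last exact/funext/adqE.
by apply: pair_continuous; [exact: A1_continuous|exact: A2_continuous].
Qed.

Lemma roq_continuous : continuous (roq b z).
Proof.
rewrite (_ : roq b z = fun t => A2 dir_x (P t) - A1 dir_y (P t)); last exact/funext/roqE.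
by apply: contB; [exact: A2_continuous|exact: A1_continuous].
Qed.

Lemma dThetaE xi zeta : dTheta b z xi zeta = Int 0 1 (fun t =>
  roq b z t * ((xi t).1 * (zeta t).2 - (xi t).2 * (zeta t).1)
  + dtq z xi t * dot0 (adq b z t) (zeta t) - dtq z zeta t * dot0 (adq b z t) (xi t)).
Proof.
apply: eq_Int => t /andP[t0 _].
by rewrite /dvartheta !(dot_varthetaE hA _ _ (Zz t)) !(tzE _ t0) !(dtzE _ _ t0).
Qed.

Lemma dThetaC xi zeta : continuous xi -> continuous zeta ->
  dTheta b z xi zeta = - dTheta b z zeta xi.
Proof.
move=> cx cy; have ca := adq_continuous; have cr := roq_continuous.
have cdx := dtq_continuous cz cx; have cdy := dtq_continuous cz cy.
rewrite !dThetaE -mulN1r -IntZ; last by solve_cont.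
by apply: eq_Int => t _; ring.
Qed.

Lemma dThetaZl xi zeta (k : R) : continuous xi -> continuous zeta ->
  dTheta b z (fun t => k *: xi t) zeta = k * dTheta b z xi zeta.
Proof.
move=> cx cy; have ca := adq_continuous; have cr := roq_continuous.
have cdx := dtq_continuous cz cx; have cdy := dtq_continuous cz cy.
rewrite !dThetaE -IntZ; last by solve_cont.
have dk t : 0 <= t -> dtq z (fun t => k *: xi t) t = k * dtq z xi t.
  move=> t0; rewrite /dtq innerZr// !prim_ge0//.
  rewrite (_ : Int 0 t (fun s => dot0 (z s) (k *: xi s)) = k * Int 0 t (fun s => dot0 (z s) (xi s))).
    ring.
  rewrite -IntZ; last by solve_cont.
  by apply: eq_Int => u _; rewrite /dot0/= /GRing.scale/=; ring.
apply: eq_Int => t /andP[t0 _]; rewrite dk// /dot0/= /GRing.scale/=; ring.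
Qed.

Lemma lorentz_exprE xi zeta : continuous xi -> continuous zeta ->
  inner (lorentz_expr b z xi) zeta = - dTheta b z xi zeta.
Proof.
move=> cx cy; have ca := adq_continuous; have cr := roq_continuous.
have cdx := dtq_continuous cz cx; have cq := sqn_continuous cz.
pose g s := dot0 (adq b z s) (xi s); have cg : continuous g by rewrite /g; solve_cont.
pose h s := dot0 (z s) (zeta s); have ch : continuous h by rewrite /h; solve_cont.
pose K := Int 0 1 (fun s => prim (sqn z) s * g s).
pose w s := roq b z s * ((xi s).1 * (zeta s).2 - (xi s).2 * (zeta s).1)
  + dtq z xi s * dot0 (adq b z s) (zeta s).
have cw : continuous w by rewrite /w; solve_cont.
(* The exchange of integrations, done by parts between two primitives: it frees [zeta] from the
   inner integral, so that it appears only through a pointwise product. *)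
have bp : Int 0 1 (fun s => prim h s * g s) =
    inner z zeta * prim g 1 - Int 0 1 (fun s => h s * prim g s).
  rewrite (Int_by_parts ch cg (fun x => is_derive_prim x ch) (fun x => is_derive_prim x cg)).
  by rewrite prim0 mul0r subr0 (prim_ge0 h ler01).
have cz1 : continuous (fun s => prim h s * g s) by solve_cont.
have cz2 : continuous (fun s => h s * prim g s) by solve_cont.
have cz3 : continuous (fun s => prim (sqn z) s * g s) by solve_cont.
have e1 := Int_lin3 0 1 1 (- (2 / N)) (2 * inner z zeta / N ^+ 2) cw cz1 cz3.
have e2 := Int_lin3 0 1 (- 1) (2 / N * prim g 1 - 2 / N ^+ 2 * K) (- (2 / N)) cw ch cz2.
have -> : dTheta b z xi zeta =
    Int 0 1 (fun t => 1 * w t + - (2 / N) * (prim h t * g t) + 2 * inner z zeta / N ^+ 2 * (prim (sqn z) t * g t)).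
  by rewrite dThetaE; apply: eq_Int => t _; rewrite /w /dtq -/h -/(g t); ring.
have -> : inner (lorentz_expr b z xi) zeta = Int 0 1 (fun t => - 1 * w t
    + (2 / N * prim g 1 - 2 / N ^+ 2 * K) * h t + - (2 / N) * (h t * prim g t)).
  apply: eq_Int => t _; rewrite /lorentz_expr -/g -/K /w /h /dot0/= /GRing.scale/=; ring.
rewrite e1 e2 bp -/K -[Int 0 1 h]/(inner z zeta); ring.
Qed.

Variable s : bool.
Hypotheses (lz : loops s Z z) (z0 : z <> 0).

Lemma sqn_periodic t : sqn z (t + 1) = sqn z t.
Proof.
have [_ _ pz] := lz; rewrite /sqn pz; case: s; rewrite ?expr1 ?expr0 ?scale1r//.
by rewrite scaleN1r /dot0/= !mulrNN.
Qed.

Lemma avecD1 t w : Z w -> avec b (t + 1) w = avec b t w.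
Proof. by move=> Zw; rewrite /avec /vartheta /form_eval periodic_b. Qed.

(** [varsigma] is even and its differential is odd in the base point, so the pulled-back
    coefficients are odd. *)
Lemma avec_sign t w : avec b t ((-1) ^+ s *: w) = (-1) ^+ s *: avec b t w.
Proof.
case: s; rewrite ?expr1 ?expr0 ?scale1r// !scaleN1r.
have avE w' : avec b t w' = (avec1 b (t, w'), avec2 b (t, w')) by exact: surjective_pairing.
rewrite !avE.
rewrite !avec1E !avec2E /bcomp1 /bcomp2 /sq /varsigma/= !sqrrN !mulrNN.
by apply/eqP; rewrite xpair_eqE; apply/andP; split; apply/eqP => /=; ring.
Qed.

Let dz (t : R) := loops_is_derive lz t.
Let cdz : continuous (derive1 z).
Proof. exact: loops_continuous (loops_derive1 lz). Qed.
Let N0 : 0 < N.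
Proof. exact: loops_inner_gt0 lz z0. Qed.

(* The derivative of [fun t => dot0 (avec b (tq z t) (z t)) (xi t)]. *)
Definition total_derivative xi t : R :=
  avec1 b (P t) * (derive1 xi t).1 + (xi t).1 * (N^-1 * sqn z t * A1 dir_t (P t)
    + (derive1 z t).1 * A1 dir_x (P t) + (derive1 z t).2 * A1 dir_y (P t)) +
  (avec2 b (P t) * (derive1 xi t).2 + (xi t).2 * (N^-1 * sqn z t * A2 dir_t (P t)
    + (derive1 z t).1 * A2 dir_x (P t) + (derive1 z t).2 * A2 dir_y (P t))).

Lemma total_derivative_continuous xi : loops s setT xi ->
  continuous (total_derivative xi).
Proof.
move=> lx; have cx := loops_continuous lx; have cdx := loops_continuous (loops_derive1 lx).
have := (avec1_continuous, avec2_continuous) => -[ca1 ca2].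
have c10 := @A1_continuous dir_t; have c11 := @A1_continuous dir_x; have c12 := @A1_continuous dir_y.
have c20 := @A2_continuous dir_t; have c21 := @A2_continuous dir_x; have c22 := @A2_continuous dir_y.
have cq := sqn_continuous cz; rewrite /total_derivative; solve_cont.
Qed.

(** Over a period [tq] runs from 0 to 1, where the coefficients agree by periodicity in time, while
    [avec] and [xi] pick up the same sign. So the boundary values cancel. *)
Lemma Int_total_derivative xi : loops s setT xi -> Int 0 1 (total_derivative xi) = 0.
Proof.
move=> lx; pose h t := avec1 b (P t) * (xi t).1 + avec2 b (P t) * (xi t).2.
have dh (t : R) : is_derive t 1 h (total_derivative xi t).
  have [h1 h2 _ _] := hA (p := P t) (Zz t).
  have dP : is_derive t 1 P (N^-1 * sqn z t, derive1 z t).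
    by apply: is_derive_pair (dz t); exact: is_derive_tq.
  have dx := loops_is_derive lx t.
  have d1 := is_deriveM (is_derive_chain h1 dP) (is_derive_fst dx).
  have d2 := is_deriveM (is_derive_chain h2 dP) (is_derive_snd dx).
  apply: (is_derive_eq (is_deriveD d1 d2)).
  by rewrite (is_diff_basis h1) (is_diff_basis h2).
rewrite (Int_FTC (total_derivative_continuous lx) ler01 dh).
suff : h (0 + 1) = h 0 by rewrite add0r => ->; rewrite subrr.
have [_ _ pz] := lz; have [_ _ px] := lx.
rewrite /h -[avec1 b _]/(avec b (tq z (0 + 1)) (z (0 + 1))).1
  -[avec2 b (P (0 + 1))]/(avec b (tq z (0 + 1)) (z (0 + 1))).2.
rewrite px pz {1 2}add0r tq1// -[X in avec b X]add0r avecD1; last by rewrite -pz.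
rewrite avec_sign /avec1 /avec2 /P/= tq0.
by case: s; rewrite ?expr1 ?expr0 ?scale1r// !scaleN1r !mulrNN.
Qed.

(** The integral over [x, x+1] of a periodic function has zero derivative in x. *)
Lemma Int_sqn_shift r : Int 0 1 (fun t => sqn z (t + r)) = N.
Proof.
have cq := sqn_continuous cz.
pose F x := prim (sqn z) (x + 1) - prim (sqn z) x.
have dF (x : R) : is_derive x 1 F 0.
  apply: (is_derive_eq (is_deriveB (is_derive_translate (is_derive_prim (x + 1) cq)) (is_derive_prim x cq))).
  by rewrite sqn_periodic subrr.
have dp (x : R) : is_derive x 1 (fun t => prim (sqn z) (t + r)) (sqn z (x + r)).
  by apply: is_derive_translate; exact: is_derive_prim.
have cqr : continuous (fun t => sqn z (t + r)).
  move=> t; apply: (@continuous_comp _ _ _ (fun t => t + r) (sqn z) t _ (cq (t + r))).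
  by apply: cvgD; [exact: cvg_id|exact: cvg_cst].
rewrite (Int_FTC cqr ler01 dp) add0r (addrC 1).
rewrite -[LHS]/(F r) (is_derive_eq0_cst r 0 dF) /F add0r -Int_prim//.
Qed.

(** The reparametrization restarts at 0 after a shift, so times become t_z(t+r) - t_z(r). The
    subtracted term is the origin of the boundary contribution in the Lie derivative. *)
Lemma tz_shift r t : 0 <= t ->
  tz (time_shift r z) t = N^-1 * (prim (sqn z) (t + r) - prim (sqn z) r).
Proof.
move=> t0; have cq := sqn_continuous cz.
have dp (x : R) : is_derive x 1 (fun t => prim (sqn z) (t + r)) (sqn z (x + r)).
  by apply: is_derive_translate; exact: is_derive_prim.
have cqr : continuous (fun t => sqn z (t + r)).
  move=> u; apply: (@continuous_comp _ _ _ (fun t => t + r) (sqn z) u _ (cq (u + r))).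
  by apply: cvgD; [exact: cvg_id|exact: cvg_cst].
have e : inner (time_shift r z) (time_shift r z) = N by exact: Int_sqn_shift.
rewrite /tz norm2_sq e; congr (_ * _).
rewrite -[X in _ - prim _ X](add0r r) -(Int_FTC cqr t0 dp).
by apply: eq_Int => u _; rewrite enorm_sq.
Qed.

Lemma prim_dot0_derive1 t :
  prim (fun u => dot0 (z u) (derive1 z u)) t = (sqn z t - sqn z 0) / 2.
Proof.
have cd := dot0_continuous cz cdz.
pose F x := prim (fun u => dot0 (z u) (derive1 z u)) x + - 2^-1 * sqn z x.
have dF (x : R) : is_derive x 1 F 0.
  have d1 := is_derive_fst (dz x); have d2 := is_derive_snd (dz x).
  apply: (is_derive_eq (is_deriveD (is_derive_prim x cd)
    (is_deriveMc (- 2^-1) (is_deriveD (is_deriveM d1 d1) (is_deriveM d2 d2))))).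
  by rewrite /dot0 /GRing.scale/=; field.
have := is_derive_eq0_cst t 0 dF; rewrite /F prim0 add0r => /eqP.
by rewrite -subr_eq0 => /eqP e; apply/eqP; rewrite -subr_eq0 -[X in _ == X]e; apply/eqP; field.
Qed.

Lemma inner_derive1 : inner z (derive1 z) = 0.
Proof.
rewrite /inner -prim_ge0// prim_dot0_derive1 -[X in sqn z X](add0r 1) sqn_periodic.
by rewrite subrr mul0r.
Qed.

Lemma dtq_derive1 t : dtq z (derive1 z) t = (sqn z t - sqn z 0) / N.
Proof.
rewrite /dtq inner_derive1 prim_dot0_derive1 mulr0 !mul0r subr0.
by have NN : N != 0 by [rewrite gt_eqF]; field.
Qed.

(** Moving the point, the vector and the time t_z(t+r) together is differentiation along the loop,
    which integrates to 0. What survives is the effect of -t_z(r), whose derivative at 0 is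
    [- sqn z 0 / N]. *)
Lemma Lie_nu_ThetaE xi : loops s setT xi ->
  Lie_nu_Theta b z xi = - (sqn z 0 / N) * inner (adq b z) xi.
Proof.
move=> lx; apply: derive1_val.
have cx := loops_continuous lx; have cdx := loops_continuous (loops_derive1 lx).
have dx := loops_is_derive lx; have cq := sqn_continuous cz.
have dq (t : R) := is_derive_prim t cq.
have r1 := regular_shift dq cq.
have r2 : regular (fun p : R * R => prim (sqn z) p.1) (fun p => sqn z p.1).
  by apply: regular_fst; apply: (@nearW _ (nbhs (0 : R))) => e; split; [exact: dq|exact: cq].
have rc (c : R) : regular (fun p : R * R => c) (fun=> 0).
  exact: (regular_snd (@cst_continuous R R c)).
have rT := regularM (rc N^-1) (regularD r1 (regularM (rc (- 1)) r2)).
have rX := regular_shift (fun t => is_derive_fst (dz t)) (fst_comp_continuous cdz).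
have rY := regular_shift (fun t => is_derive_snd (dz t)) (snd_comp_continuous cdz).
have rV := regular_shift (fun t => is_derive_fst (dx t)) (fst_comp_continuous cdx).
have rW := regular_shift (fun t => is_derive_snd (dx t)) (snd_comp_continuous cdx).
have Z1 t : Z ((z (t + 0)).1, (z (t + 0)).2) by rewrite -surjective_pairing.
have := regular_avec open_Q hA rT rX rY rV rW Z1 => /= D.
rewrite (_ : (fun r => _) = (fun e => Int 0 1 (fun t => dot0
   (avec b (N^-1 * (prim (sqn z) (t + e) + - 1 * prim (sqn z) e))
      ((z (t + e)).1, (z (t + e)).2)) ((xi (t + e)).1, (xi (t + e)).2)))); last first.
  apply/funext => r; apply: eq_Int => t /andP[t0 _].
  by rewrite vartheta_dot0 (tz_shift r t0) -!surjective_pairing mulN1r.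
apply: (is_derive_eq D).
have cI : continuous (fun t => dot0 (adq b z t) (xi t)).
  exact: (dot0_continuous adq_continuous cx).
have ct := total_derivative_continuous lx.
have := Int_lin2 0 1 1 (- (sqn z 0 / N)) ct cI.
rewrite (Int_total_derivative lx) mulr0 add0r => <-.
apply: eq_Int => t _; rewrite !addr0 prim0 !mulr0 !addr0 -!surjective_pairing.
rewrite -[N^-1 * prim _ t]/(tq z t) -/(P t) /total_derivative adqE /dot0/=.
move: (avec1 b (P t)) (avec2 b (P t)) (A1 dir_t (P t)) (A1 dir_x (P t))
  (A1 dir_y (P t)) (A2 dir_t (P t)) (A2 dir_x (P t)) (A2 dir_y (P t)).
move: (sqn z t) (sqn z 0) (xi t) (derive1 xi t) (derive1 z t) N^-1.
by move=> *; ring.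
Qed.

(** * First variation of the magnetic potential along the loop *)

Section Variation.
Variable xi : R -> C.
Hypothesis lx : loops s setT xi.

Let cx : continuous xi.
Proof. exact: loops_continuous lx. Qed.

Definition normf (e : R) : R := N + e * (2 * inner z xi) + e * e * inner xi xi.

Lemma normfE e : inner (z + e *: xi) (z + e *: xi) = normf e.
Proof. by rewrite /normf [LHS](inner_perturb e cz cx); ring. Qed.

Lemma is_derive_normf (e : R) :
  is_derive e 1 normf (2 * inner z xi + 2 * e * inner xi xi).
Proof.
have d1 := is_deriveD (is_derive_cst N e 1) (is_deriveM (is_derive_id e 1) (is_derive_cst (2 * inner z xi) e 1)).
have d2 := is_deriveM (is_deriveM (is_derive_id e 1) (is_derive_id e 1)) (is_derive_cst (inner xi xi) e 1).
apply: (is_derive_eq (is_deriveD d1 d2)).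
by rewrite /GRing.scale/= /cst/=; ring.
Qed.

Lemma normf_continuous : continuous normf.
Proof.
by move=> e; apply/differentiable_continuous/derivable1_diffP; case: (is_derive_normf e).
Qed.

Lemma normf_near : \forall e \near (0 : R), normf e != 0.
Proof.
have n0 : normf 0 = N by rewrite /normf !mul0r !addr0.
have : \forall e \near (0 : R), 0 < normf e.
  have := @normf_continuous 0; rewrite /continuous_at n0 => /(cvgr_gt _); exact.
by apply: filterS => e; rewrite lt0r => /andP[].
Qed.

Lemma tq_perturb e t : 0 <= t -> tz (z + e *: xi) t =
  (normf e)^-1 * (prim (sqn z) t + (2 * e) * prim (fun s => dot0 (z s) (xi s)) t
    + (e * e) * prim (sqn xi) t).
Proof.
move=> t0; rewrite /tz norm2_sq normfE !prim_ge0//; congr (_ * _).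
have cq := sqn_continuous cz; have cqx := sqn_continuous cx.
have cd := dot0_continuous cz cx.
have := Int_lin3 0 t 1 (2 * e) (e * e) cq cd cqx; rewrite mul1r => <-.
apply: eq_Int => u _; rewrite enorm_sq /sqn /dot0/= /GRing.scale/=; ring.
Qed.

(** The value is L_nu Theta - dTheta(z', .) at [xi], that is, Cartan's formula for d(i_nu Theta). *)
Lemma is_derive_calM : is_derive (0 : R) 1 (fun e : R => calM b (z + e *: xi))
  (- dTheta b z (derive1 z) xi - sqn z 0 / N * inner (adq b z) xi).
Proof.
have cdx := loops_continuous (loops_derive1 lx).
have dx := loops_is_derive lx; have cq := sqn_continuous cz.
have cqx := sqn_continuous cx; have cd := dot0_continuous cz cx.
have ca := adq_continuous; have cr := roq_continuous.
have rc (c : R) : regular (fun p : R * R => c) (fun=> 0).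
  exact: (regular_snd (@cst_continuous R R c)).
have re : regular (fun p : R * R => p.1) (fun=> 1).
  apply: (regular_fst (h := id) (h' := fun=> 1)); apply: (@nearW _ (nbhs (0 : R))) => e.
  by split; [exact: is_derive_id|exact: cst_continuous].
have rs (h : R -> R) : continuous h -> regular (fun p => h p.2) (fun=> 0).
  by move=> ch; exact: regular_snd.
have rN : regular (fun p : R * R => (normf p.1)^-1)
    (fun p => - (normf p.1 ^- 2) * (2 * inner z xi + 2 * p.1 * inner xi xi)).
  apply: (regular_fst (h := fun e => (normf e)^-1)
    (h' := fun e => - (normf e ^- 2) * (2 * inner z xi + 2 * e * inner xi xi))).
  apply: filterS normf_near => e e0; have [d1 d2] := is_derive_normf e; split.
    split; first exact: derivableV.
    by rewrite deriveV// d2.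
  apply: cvgM.
    apply: cvgN; apply: cvgV; first by rewrite expf_neq0.
    by apply: cvgM; exact: normf_continuous.
  apply: cvgD; first exact: cvg_cst.
  apply: cvgM; last exact: cvg_cst.
  by apply: cvgM; [exact: cvg_cst|exact: cvg_id].
have rT := regularM rN (regularD (regularD (rs _ (prim_continuous cq))
  (regularM (regularM (rc 2) re) (rs _ (prim_continuous cd))))
  (regularM (regularM re re) (rs _ (prim_continuous cqx)))).
have lin (f g : R -> R) : continuous f -> continuous g ->
    regular (fun p => f p.2 + p.1 * g p.2) (fun p => 0 + (p.1 * 0 + g p.2 * 1)).
  by move=> cf cg; apply: regularD; [exact: rs|apply: regularM => //; exact: rs].
have rX := lin _ _ (fst_comp_continuous cz) (fst_comp_continuous cx).
have rY := lin _ _ (snd_comp_continuous cz) (snd_comp_continuous cx).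
have rV := lin _ _ (fst_comp_continuous cdz) (fst_comp_continuous cdx).
have rW := lin _ _ (snd_comp_continuous cdz) (snd_comp_continuous cdx).
have Z1 t : Z ((z t).1 + 0 * (xi t).1, (z t).2 + 0 * (xi t).2).
  by rewrite !mul0r !addr0 -surjective_pairing.
have := regular_avec open_Q hA rT rX rY rV rW Z1 => /= D.
have eqf : (fun e : R => calM b (z + e *: xi)) = (fun e => Int 0 1 (fun t => dot0
   (avec b ((normf e)^-1 * (prim (sqn z) t + 2 * e * prim (fun t => dot0 (z t) (xi t)) t
      + e * e * prim (sqn xi) t))
      ((z t).1 + e * (xi t).1, (z t).2 + e * (xi t).2))
   ((derive1 z t).1 + e * (derive1 xi t).1, (derive1 z t).2 + e * (derive1 xi t).2))).
  apply/funext => e; apply: eq_Int => t /andP[t0 _].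
  by rewrite vartheta_dot0 tq_perturb// (derive1_addZ e t lz lx).
rewrite eqf; apply: (is_derive_eq D).
have n0 : normf 0 = N by rewrite /normf !mul0r !addr0.
have cdxi := dtq_continuous cz cx; have cdz' := dtq_continuous cz cdz.
(* The integrand is the total derivative plus [w] minus [v]. The space derivatives antisymmetrize
   into the rotation in [w]; [v] removes the time part of the total derivative, because the
   perturbation moves the time by [dtq z xi] and not along the loop. *)
pose w t := roq b z t * ((xi t).1 * (derive1 z t).2 - (xi t).2 * (derive1 z t).1)
  + dtq z xi t * dot0 (adq b z t) (derive1 z t).
have cw : continuous w by rewrite /w; solve_cont.
pose v t := sqn z t / N * dot0 (adq b z t) (xi t).
have cv : continuous v by rewrite /v; solve_cont.
have ct := total_derivative_continuous lx.
have e1 := Int_lin3 0 1 1 1 (- 1) ct cw cv.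
rewrite (Int_total_derivative lx) mulr0 add0r !mul1r in e1.
rewrite [LHS](_ : _ = Int 0 1 w + - 1 * Int 0 1 v); last first.
  rewrite -e1; apply: eq_Int => t _.
  rewrite !(mulr0, mul0r, addr0, add0r, mulr1, mul1r) n0 -!surjective_pairing.
  rewrite -[N^-1 * prim _ t]/(tq z t) -/(P t) /total_derivative /w /v /dtq.
  rewrite adqE roqE /dot0/=.
  have NN : N != 0 by rewrite gt_eqF.
  move: NN; move: (avec1 b (P t)) (avec2 b (P t)) (A1 dir_t (P t)) (A1 dir_x (P t))
    (A1 dir_y (P t)) (A2 dir_t (P t)) (A2 dir_x (P t)) (A2 dir_y (P t)).
  move: (prim (fun u => (z u).1 * (xi u).1 + (z u).2 * (xi u).2) t)
    (prim (sqn z) t) (sqn z t).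
  move: (xi t) (derive1 xi t) (derive1 z t) (inner z xi) (inner z z).
  by move=> *; field.
pose u t := roq b z t * ((derive1 z t).1 * (xi t).2 - (derive1 z t).2 * (xi t).1)
  + dtq z (derive1 z) t * dot0 (adq b z t) (xi t) - dtq z xi t * dot0 (adq b z t) (derive1 z t).
have cu : continuous u by rewrite /u; solve_cont.
rewrite dThetaE -/u -mulNr -[- Int 0 1 u]mulN1r -[Int 0 1 w]mul1r.
rewrite -(Int_lin2 0 1 (- 1) (- (sqn z 0 / N)) cu (dot0_continuous ca cx)).
rewrite -(Int_lin2 0 1 1 (- 1) cw cv).
by apply: eq_Int => t _; rewrite /w /v /u dtq_derive1; ring.
Qed.

End Variation.

End LoopMagnetic.

Section L2Congruence.
Context {R : realType}.
Local Notation mu := (@lebesgue_measure R).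
Implicit Types (z xi zeta X u : R -> R * R).

Lemma L2_measurable X : L2 X -> measurable_fun `[0 : R, 1] (fun t => (X t).1) /\
  measurable_fun `[0 : R, 1] (fun t => (X t).2).
Proof. by move=> [[m1 _] [m2 _]]. Qed.

Lemma continuous_measurable_itv (f : R -> R) : continuous f -> measurable_fun `[0 : R, 1] f.
Proof. by move=> cf; apply: measurable_funTS; exact: continuous_measurable_fun. Qed.

Lemma Int_ae (f g : R -> R) t : t <= 1 ->
  measurable_fun `[0 : R, 1] f -> measurable_fun `[0 : R, 1] g ->
  {ae mu, forall x, x \in `[0, 1] -> f x = g x} -> Int 0 t f = Int 0 t g.
Proof.
move=> t1 mf mg fg; rewrite /Int /Rintegral; congr fine.
have s01 : [set` `[0, t]] `<=` `[0 : R, 1] by apply: subset_itvl; rewrite bnd_simp.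
apply: ae_eq_integral => //.
- by apply/measurable_EFinP; exact: (measurable_funS _ s01).
- by apply/measurable_EFinP; exact: (measurable_funS _ s01).
- by apply: ae_imply fg => x e /= /s01 x01; rewrite e.
Qed.

Lemma Int_dot0_ae zeta X u t : t <= 1 -> L2 X -> continuous u -> eqL2 X u ->
  continuous zeta ->
  Int 0 t (fun x => dot0 (zeta x) (X x)) = Int 0 t (fun x => dot0 (zeta x) (u x)).
Proof.
move=> t1 /L2_measurable[m1 m2] cu Xu cy; apply: Int_ae => //.
- apply: measurable_funD; apply: measurable_funM => //; apply: continuous_measurable_itv;
    by solve_cont.
- by apply: continuous_measurable_itv; solve_cont.
- by apply: ae_imply Xu => x e x01; rewrite e.
Qed.

Lemma inner_ae zeta X u : L2 X -> continuous u -> eqL2 X u -> continuous zeta ->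
  inner zeta X = inner zeta u.
Proof. exact: Int_dot0_ae. Qed.

Lemma contZ (f : R -> R) z : continuous f -> continuous z -> continuous (fun t => f t *: z t).
Proof.
move=> cf cz; rewrite (_ : (fun t => _) = fun t => (f t * (z t).1, f t * (z t).2))//.
by apply: pair_continuous; solve_cont.
Qed.

Lemma sub_continuous_fun z xi : continuous z -> continuous xi ->
  continuous (fun t => z t - xi t).
Proof. by move=> cz cx t; apply: cvgB; [exact: cz|exact: cx]. Qed.

Lemma pair_ext (v w : R * R) : v.1 = w.1 -> v.2 = w.2 -> v = w.
Proof. by case: v w => [? ?] [? ?] /= -> ->. Qed.

Lemma dot0Dl (u v w : R * R) : dot0 (u + v) w = dot0 u w + dot0 v w.
Proof. by rewrite /dot0/=; ring. Qed.

Lemma dot0Bl (u v w : R * R) : dot0 (u - v) w = dot0 u w - dot0 v w.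
Proof. by rewrite /dot0/=; ring. Qed.

Lemma dot0Zl (k : R) (v w : R * R) : dot0 (k *: v) w = k * dot0 v w.
Proof. by rewrite /dot0/= /GRing.scale/=; ring. Qed.

Lemma imul_continuous z : continuous z -> continuous (fun t => imul (z t)).
Proof. by move=> cz; apply: pair_continuous; solve_cont. Qed.

End L2Congruence.

Lemma is_derive_quadratic {R : realType} (a c d : R) :
  is_derive (0 : R) 1 (fun e => a + e * c + e * e * d) c.
Proof.
have i1 := is_derive_id (0 : R) 1.
apply: (is_derive_eq (is_deriveD (is_deriveD (is_derive_cst a (0 : R) 1)
  (is_deriveM i1 (is_derive_cst c (0 : R) 1)))
  (is_deriveM (is_deriveM i1 i1) (is_derive_cst d (0 : R) 1)))).
by rewrite /GRing.scale/= /cst/=; ring.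
Qed.

(** * Hamiltonian, Euler and Lorentz terms *)

Section EulerHamilton.
Context {R : realType}.
Local Notation C := (R * R)%type.
Variables (Q : set C) (b : R -> C -> C).
Hypothesis open_Q : open Q.
Hypothesis periodic_b : forall t w, Q w -> b (t + 1) w = b t w.
Local Notation Z := (varsigma @^-1` Q).
Variables A1 A2 : R * C -> R * C -> R.
Hypothesis hA : forall p : R * C, Z p.2 ->
  [/\ is_diff p (avec1 b) (A1^~ p), is_diff p (avec2 b) (A2^~ p),
      forall v, {for p, continuous (A1 v)} & forall v, {for p, continuous (A2 v)}].

(** * The fields and the equation at a fixed lift *)

Section AtPoint.
Variables (s : bool) (z eta : R -> C).
Hypotheses (lz : loops s Z z) (z0 : z <> 0) (le : loops s setT eta).
Local Notation N := (inner z z).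
Implicit Types (xi zeta kappa : R -> C).

Let cz : continuous z. Proof. exact: loops_continuous lz. Qed.
Let ce : continuous eta. Proof. exact: loops_continuous le. Qed.
Let Zz t : Z (z t). Proof. by case: lz. Qed.
Let ldz : loops s setT (derive1 z). Proof. exact: loops_derive1 lz. Qed.
Let lde : loops s setT (derive1 eta). Proof. exact: loops_derive1 le. Qed.
Let cdz : continuous (derive1 z). Proof. exact: loops_continuous ldz. Qed.
Let cde : continuous (derive1 eta). Proof. exact: loops_continuous lde. Qed.
Let N0 : 0 < N. Proof. exact: loops_inner_gt0 lz z0. Qed.
Let NN : N != 0. Proof. by rewrite gt_eqF. Qed.
Let ca : continuous (adq b z). Proof. exact: (adq_continuous hA cz Zz). Qed.
Let cr : continuous (roq b z). Proof. exact: (roq_continuous hA cz Zz). Qed.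

Let tangent_z : tangent z = loops s setT. Proof. exact: tangentE lz z0. Qed.

Lemma lorentz_expr_continuous xi : continuous xi -> continuous (lorentz_expr b z xi).
Proof.
move=> cx; have cd := dtq_continuous cz cx; have ci := imul_continuous cx.
have cg : continuous (fun u => dot0 (adq b z u) (xi u)) by solve_cont.
apply: sub_continuous_fun; last by apply: contZ => //; exact: cont_cst.
apply: add_continuous_fun; last by apply: contZ => //; solve_cont.
by apply: sub_continuous_fun; apply: contZ => //; solve_cont.
Qed.

Lemma lorentz_exprZ xi (k : R) t : continuous xi ->
  lorentz_expr b z (fun u => k *: xi u) t = k *: lorentz_expr b z xi t.
Proof.
move=> cx; have cg : continuous (fun u => dot0 (adq b z u) (xi u)) by solve_cont.
have cd : continuous (fun u => dot0 (z u) (xi u)) by solve_cont.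
have primZ (f : R -> R) u : continuous f -> prim (fun x => k * f x) u = k * prim f u.
  by move=> cf; rewrite /prim !IntZ// mulrBr.
have dk (v : R -> C) : (fun u => dot0 (v u) (k *: xi u)) = (fun u => k * dot0 (v u) (xi u)).
  by apply/funext => u; rewrite /dot0/= /GRing.scale/=; ring.
have cq := sqn_continuous cz.
rewrite /lorentz_expr /dtq !dk !primZ// innerZr//.
rewrite (_ : Int 0 1 (fun u => prim (sqn z) u * dot0 (adq b z u) (k *: xi u)) =
  k * Int 0 1 (fun u => prim (sqn z) u * dot0 (adq b z u) (xi u))); last first.
  rewrite -IntZ; last by solve_cont.
  by apply: eq_Int => u _; rewrite /dot0/= /GRing.scale/=; ring.
move: (prim _ _) (prim _ _) (Int _ _ _) (prim _ _) (prim _ _) (inner z xi) (roq _ _ _) => p1 p2 p3 p4 p5 p6 p7.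
by apply: pair_ext; rewrite /= /GRing.scale/=; field.
Qed.

(** The explicit formula shows that the set under [xget] is inhabited, so the chosen element
    satisfies its specification; density then identifies the two. The other fields follow this
    pattern. *)
Lemma Lorentz_eqL2 xi : continuous xi -> eqL2 (Lorentz b z xi) (lorentz_expr b z xi).
Proof.
move=> cx; have cl := lorentz_expr_continuous cx; rewrite /Lorentz /L2_repr tangent_z.
set S := (X in xget 0 X).
have [] : S (xget 0 S).
  apply: xgetPex; exists (lorentz_expr b z xi); split; first exact: continuous_L2.
  by move=> zeta ly; apply: (lorentz_exprE hA cz Zz cx); exact: loops_continuous ly.
move=> Lw Ew; apply: (@fundamental_lemma _ s) => //; first exact: continuous_L2.
move=> zeta ly; rewrite Ew// (lorentz_exprE hA cz Zz cx)//; exact: loops_continuous ly.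
Qed.

Definition grad_expr t : C :=
  lorentz_expr b z (derive1 z) t - (sqn z 0 / N) *: adq b z t.

Lemma grad_expr_continuous : continuous grad_expr.
Proof.
have c1 := lorentz_expr_continuous cdz.
have c2 : continuous (fun t => (sqn z 0 / N) *: adq b z t) by exact: scale_continuous.
exact: (sub_continuous_fun c1 c2).
Qed.

Lemma inner_grad_expr xi : continuous xi -> inner grad_expr xi =
  - dTheta b z (derive1 z) xi - sqn z 0 / N * inner (adq b z) xi.
Proof.
move=> cx; have cl := lorentz_expr_continuous cdz.
rewrite -(lorentz_exprE hA cz Zz cdz cx) -mulNr -[inner (lorentz_expr _ _ _) _]mul1r.
rewrite -(Int_lin2 0 1 1 (- (sqn z 0 / N)) (dot0_continuous cl cx) (dot0_continuous ca cx)).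
by apply: eq_Int => t _; rewrite /grad_expr dot0Bl dot0Zl mul1r mulNr.
Qed.

Lemma is_derive_calM_grad xi : loops s setT xi ->
  is_derive (0 : R) 1 (fun e : R => calM b (z + e *: xi)) (inner grad_expr xi).
Proof.
move=> lx; rewrite inner_grad_expr; last exact: loops_continuous lx.
exact: (is_derive_calM open_Q periodic_b hA cz Zz lz z0 lx).
Qed.

Lemma gradM_eqL2 : eqL2 (gradM b z) grad_expr.
Proof.
have cg := grad_expr_continuous; rewrite /gradM /L2_repr tangent_z.
have dM xi : loops s setT xi -> dvar (calM b) z xi = inner grad_expr xi.
  by move=> lx; apply: derive1_val; exact: is_derive_calM_grad.
set S := (X in xget 0 X).
have [] : S (xget 0 S).
  apply: xgetPex; exists grad_expr; split; first exact: continuous_L2.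
  by move=> zeta ly; rewrite dM.
move=> Lw Ew; apply: (@fundamental_lemma _ s) => //; first exact: continuous_L2.
by move=> zeta ly; rewrite Ew// dM.
Qed.

(** The Hamiltonian is (|eta|^2 - 8) / (8 N). This is minus its derivative in N, times the factor 2
    from dN = 2 <z, xi>. *)
Definition kepler_coeff : R := (inner eta eta - 8) / (4 * N ^+ 2).

Lemma is_derive_calH xi kappa : loops s setT xi -> loops s setT kappa ->
  is_derive (0 : R) 1 (fun e : R => calH ((z, eta) + e *: (xi, kappa)))
    ((4 * N)^-1 * inner eta kappa - kepler_coeff * inner z xi).
Proof.
move=> lx lk; have cx := loops_continuous lx; have ck := loops_continuous lk.
have n0 : normf z xi 0 = N by rewrite /normf !mul0r !addr0.
have n1 : normf eta kappa 0 = inner eta eta by rewrite /normf !mul0r !addr0.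
have -> : (fun e : R => calH ((z, eta) + e *: (xi, kappa))) =
    (fun e => (8^-1 * normf eta kappa e + - 1) * (normf z xi e)^-1).
  apply/funext => e; rewrite /calH !norm2_sq /=.
  move: (normfE cz lx e) (normfE ce lk e) => -> ->; rewrite invfM.
  by move: (normf _ _ _) (normf _ _ _) => x y; ring.
have [d1 v1] := is_derive_normf z xi 0; have d2 := is_derive_normf eta kappa 0.
have d3 : is_derive (0 : R) 1 (fun e => (normf z xi e)^-1)
    (- (N ^- 2) * (2 * inner z xi)).
  split; first by apply: derivableV; rewrite ?n0.
  by rewrite deriveV ?n0// v1 mulr0 mul0r addr0.
have d4 : is_derive (0 : R) 1 (fun e => 8^-1 * normf eta kappa e + - 1)
    (8^-1 * (2 * inner eta kappa) + 0).
  apply: is_deriveD; apply: is_deriveMc.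
  by apply: (is_derive_eq d2); rewrite mulr0 mul0r addr0.
apply: (is_derive_eq (is_deriveM d4 d3)); rewrite /kepler_coeff /GRing.scale/= n0 n1.
by move: NN; move: (inner z z) (inner eta eta) (inner eta kappa) (inner z xi) => *; field.
Qed.

(** No boundary term: both loops have parity [s], so their pointwise product is 1-periodic. *)
Lemma inner_by_parts xi : loops s setT xi ->
  inner eta (derive1 xi) = - inner (derive1 eta) xi.
Proof.
move=> lx; have cx := loops_continuous lx; have cdx := loops_continuous (loops_derive1 lx).
have cd1 := dot0_continuous ce cdx; have cd2 := dot0_continuous cde cx.
pose h t := dot0 (eta t) (xi t).
have dh (t : R) : is_derive t 1 h (1 * dot0 (eta t) (derive1 xi t) + 1 * dot0 (derive1 eta t) (xi t)).
  have d1 := loops_is_derive le t; have d2 := loops_is_derive lx t.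
  apply: (is_derive_eq (is_deriveD (is_deriveM (is_derive_fst d1) (is_derive_fst d2))
    (is_deriveM (is_derive_snd d1) (is_derive_snd d2)))).
  rewrite /dot0 /GRing.scale/=.
  by move: (eta t) (xi t) (derive1 eta t) (derive1 xi t) => *; ring.
have c12 : continuous (fun t => 1 * dot0 (eta t) (derive1 xi t) + 1 * dot0 (derive1 eta t) (xi t)).
  by solve_cont.
have := Int_FTC c12 ler01 dh; rewrite Int_lin2// !mul1r.
have -> : h 1 = h 0.
  have [_ _ pe] := le; have [_ _ px] := lx.
  rewrite -[X in h X](add0r 1) /h pe px /dot0/=.
  by case: s; rewrite ?expr1 ?expr0 ?scale1r// !scaleN1r /= !mulrNN.
by rewrite subrr => /eqP; rewrite addr_eq0 => /eqP.
Qed.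

Lemma is_derive_action xi kappa : loops s setT xi -> loops s setT kappa ->
  is_derive (0 : R) 1 (fun e : R => action b ((z, eta) + e *: (xi, kappa)))
    (inner (fun t => derive1 z t - (4 * N)^-1 *: eta t) kappa +
     inner (fun t => kepler_coeff *: z t + grad_expr t - derive1 eta t) xi).
Proof.
move=> lx lk; have cx := loops_continuous lx; have ck := loops_continuous lk.
have cdx := loops_continuous (loops_derive1 lx); have cg := grad_expr_continuous.
have d1 : is_derive (0 : R) 1 (fun e : R => inner (eta + e *: kappa) (derive1 (z + e *: xi)))
    (inner kappa (derive1 z) + inner eta (derive1 xi)).
  have -> : (fun e : R => inner (eta + e *: kappa) (derive1 (z + e *: xi))) =
      (fun e => (inner eta (derive1 z) + e * (inner kappa (derive1 z) + inner eta (derive1 xi)))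
        + e * e * inner kappa (derive1 xi)).
    apply/funext => e; have -> : derive1 (z + e *: xi) = (fun t => derive1 z t + e *: derive1 xi t).
      by apply/funext => t; exact: (derive1_addZ e t lz lx).
    have cek := scale_continuous (k := e) ck; have cex := scale_continuous (k := e) cdx.
    rewrite -[eta + e *: kappa]/(fun t => eta t + e *: kappa t).
    have cek' := add_continuous_fun ce cek.
    rewrite (innerDr cek' cdz cex) (innerDl cdz ce cek) (innerDl cex ce cek).
    rewrite (innerZl e cdz ck) (innerZl e cex ck) (innerZr e ce cdx) (innerZr e ck cdx).
    by rewrite mulrDr !mulrA !addrA.
  exact: is_derive_quadratic.
apply: (is_derive_eq (is_deriveB (is_deriveD d1 (is_derive_calM_grad lx)) (is_derive_calH lx lk))).
rewrite (inner_by_parts lx).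
have -> : inner (fun t => derive1 z t - (4 * N)^-1 *: eta t) kappa =
    1 * inner (derive1 z) kappa + - (4 * N)^-1 * inner eta kappa.
  apply: (etrans _ (Int_lin2 0 1 1 (- (4 * N)^-1) (dot0_continuous cdz ck) (dot0_continuous ce ck))).
  by apply: eq_Int => t _; rewrite dot0Bl dot0Zl mul1r mulNr.
have -> : inner (fun t => kepler_coeff *: z t + grad_expr t - derive1 eta t) xi =
    kepler_coeff * inner z xi + 1 * inner grad_expr xi + - 1 * inner (derive1 eta) xi.
  apply: (etrans _ (Int_lin3 0 1 kepler_coeff 1 (- 1) (dot0_continuous cz cx)
    (dot0_continuous cg cx) (dot0_continuous cde cx))).
  by apply: eq_Int => t _; rewrite dot0Bl dot0Dl dot0Zl mul1r mulN1r.
rewrite (innerC kappa).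
have alg (x y w u v k l : R) :
  x + - y + w - (k * u - l * v) = 1 * x + - k * u + (l * v + 1 * w + - 1 * y) by ring.
exact: alg.
Qed.

Definition velocity_expr t : C := (4 * N)^-1 *: eta t.
Definition hamilton_expr t : C :=
  kepler_coeff *: z t + (4 * N)^-1 *: lorentz_expr b z eta t.
Definition euler_expr t : C := - (sqn z 0 / N) *: adq b z t.

Let cvel : continuous velocity_expr. Proof. exact: scale_continuous. Qed.
Let clor : continuous (lorentz_expr b z eta).
Proof. exact: lorentz_expr_continuous. Qed.
Let cham : continuous hamilton_expr.
Proof.
exact: (add_continuous_fun (scale_continuous (k := kepler_coeff) cz) (scale_continuous (k := (4 * N)^-1) clor)).
Qed.
Let ceul : continuous euler_expr. Proof. exact: scale_continuous. Qed.

(** The equation for the second component of [X_Theta] contains [dTheta] of its first component,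
    which is known only almost everywhere. *)
Lemma dTheta_ae zeta X u : L2 X -> continuous u -> eqL2 X u -> continuous zeta ->
  dTheta b z zeta X = dTheta b z zeta u.
Proof.
move=> LX cu Xu cy; have [mX1 mX2] := L2_measurable LX; have cd := dtq_continuous cz cy.
have cdu := dtq_continuous cz cu.
rewrite !(dThetaE hA Zz).
(* The variation of time sees [X] through integrals, so here the equality is pointwise; the
   remaining occurrences of [X] are local. *)
have dE t : 0 <= t <= 1 -> dtq z X t = dtq z u t.
  move=> /andP[t0 t1]; rewrite /dtq (inner_ae LX cu Xu cz) !prim_ge0//.
  by rewrite (Int_dot0_ae t1 LX cu Xu cz).
apply: (@etrans _ _ (Int 0 1 (fun t =>
   roq b z t * ((zeta t).1 * (X t).2 - (zeta t).2 * (X t).1) +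
   dtq z zeta t * dot0 (adq b z t) (X t) - dtq z u t * dot0 (adq b z t) (zeta t)))).
  by apply: eq_Int => t t01; rewrite dE.
have mc (f : R -> R) : continuous f -> measurable_fun `[0 : R, 1] f.
  exact: continuous_measurable_itv.
apply: Int_ae => //; last by apply: ae_imply Xu => t e t01; rewrite e.
  apply: measurable_funB; last by apply: mc; solve_cont.
  apply: measurable_funD; apply: measurable_funM; try by apply: mc; solve_cont.
    by apply: measurable_funB; apply: measurable_funM => //; apply: mc; solve_cont.
  by apply: measurable_funD; apply: measurable_funM => //; apply: mc; solve_cont.
by apply: mc; solve_cont.
Qed.

Lemma dTheta_ae_l zeta X u : L2 X -> continuous u -> eqL2 X u -> continuous zeta ->
  dTheta b z X zeta = dTheta b z u zeta.
Proof.
move=> LX cu Xu cy; have [mX1 mX2] := L2_measurable LX; have cd := dtq_continuous cz cy.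
have cdu := dtq_continuous cz cu.
rewrite !(dThetaE hA Zz).
have dE t : 0 <= t <= 1 -> dtq z X t = dtq z u t.
  move=> /andP[t0 t1]; rewrite /dtq (inner_ae LX cu Xu cz) !prim_ge0//.
  by rewrite (Int_dot0_ae t1 LX cu Xu cz).
apply: (@etrans _ _ (Int 0 1 (fun t =>
   roq b z t * ((X t).1 * (zeta t).2 - (X t).2 * (zeta t).1) +
   dtq z u t * dot0 (adq b z t) (zeta t) - dtq z zeta t * dot0 (adq b z t) (X t)))).
  by apply: eq_Int => t t01; rewrite dE.
have mc (f : R -> R) : continuous f -> measurable_fun `[0 : R, 1] f.
  exact: continuous_measurable_itv.
apply: Int_ae => //; last by apply: ae_imply Xu => t e t01; rewrite e.
  apply: measurable_funB; last first.
    apply: measurable_funM; first by apply: mc; solve_cont.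
    by apply: measurable_funD; apply: measurable_funM => //; apply: mc; solve_cont.
  apply: measurable_funD; last by apply: mc; solve_cont.
  apply: measurable_funM; first by apply: mc; solve_cont.
  by apply: measurable_funB; apply: measurable_funM => //; apply: mc; solve_cont.
by apply: mc; solve_cont.
Qed.

Lemma dTheta0l u : dTheta b z 0 u = 0.
Proof.
rewrite (dThetaE hA Zz) -[RHS](Int0 0 1); apply: eq_Int => t /andP[t0 t1].
have -> : dtq z 0 t = 0.
  rewrite /dtq inner0r prim_ge0// mulr0 !mul0r subr0.
  apply/eqP; rewrite mulf_eq0; apply/orP; right; apply/eqP; rewrite -[RHS](Int0 0 t).
  by apply: eq_Int => x _; rewrite /dot0/= !mulr0 addr0.
by rewrite /dot0/= !(mul0r, mulr0, addr0, subrr).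
Qed.

Lemma dTheta0r u : dTheta b z u 0 = 0.
Proof.
rewrite (dThetaE hA Zz) -[RHS](Int0 0 1); apply: eq_Int => t /andP[t0 t1].
have -> : dtq z 0 t = 0.
  rewrite /dtq inner0r prim_ge0// mulr0 !mul0r subr0.
  apply/eqP; rewrite mulf_eq0; apply/orP; right; apply/eqP; rewrite -[RHS](Int0 0 t).
  by apply: eq_Int => x _; rewrite /dot0/= !mulr0 addr0.
by rewrite /dot0/= !mulr0 subrr !mulr0 !addr0 mulr0 mul0r subr0 addr0.
Qed.

Lemma dTheta_velocity zeta : continuous zeta ->
  dTheta b z zeta velocity_expr = (4 * N)^-1 * inner (lorentz_expr b z eta) zeta.
Proof.
move=> cy; rewrite (dThetaC hA cz Zz cy cvel) (dThetaZl hA cz Zz (4 * N)^-1 ce cy).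
by rewrite (lorentz_exprE hA cz Zz ce cy) mulrN.
Qed.

Lemma inner_hamilton zeta : continuous zeta -> inner hamilton_expr zeta =
  kepler_coeff * inner z zeta + (4 * N)^-1 * inner (lorentz_expr b z eta) zeta.
Proof.
move=> cy.
apply: (etrans _ (Int_lin2 0 1 kepler_coeff (4 * N)^-1 (dot0_continuous cz cy) (dot0_continuous clor cy))).
by apply: eq_Int => t _; rewrite /hamilton_expr dot0Dl !dot0Zl.
Qed.

Lemma tangent2E v : tangent2 (z, eta) v -> loops s setT v.1 /\ loops s setT v.2.
Proof. by case: v => v1 v2; rewrite /tangent2/= tangent_z. Qed.

Lemma dvar_calH xi kappa : loops s setT xi -> loops s setT kappa ->
  dvar calH (z, eta) (xi, kappa) = (4 * N)^-1 * inner eta kappa - kepler_coeff * inner z xi.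
Proof. by move=> lx lk; apply: derive1_val; exact: is_derive_calH. Qed.

(** The system is triangular: tangent vectors [(0, kappa)] do not see the magnetic term and
    determine the first component. After its substitution, [(xi, 0)] determines the second. *)
Lemma X_Theta_eqL2 : eqL2 (X_Theta b (z, eta)).1 velocity_expr /\
  eqL2 (X_Theta b (z, eta)).2 hamilton_expr.
Proof.
rewrite /X_Theta; set S := (X in xget 0 X).
have [] : S (xget 0 S).
  apply: xgetPex; exists (velocity_expr, hamilton_expr).
  split; [exact: continuous_L2|exact: continuous_L2|].
  move=> [xi kappa] /tangent2E[/= lx lk]; rewrite dvar_calH//.
  have cx := loops_continuous lx; have ck := loops_continuous lk.
  rewrite /Omega_Theta /Omega/= dTheta_velocity// inner_hamilton//.
  rewrite (innerZr (4 * N)^-1 ck ce) (innerC kappa) opprD addrA subrK//.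
move: (xget 0 S) => -[X1 X2] /= L1 L2' EX.
have tv xi kappa : loops s setT xi -> loops s setT kappa -> tangent2 (z, eta) (xi, kappa).
  by move=> lx lk; rewrite /tangent2/= tangent_z.
have X1v : eqL2 X1 velocity_expr.
  apply: (@fundamental_lemma _ s) => //; first exact: continuous_L2.
  move=> kappa lk; have ck := loops_continuous lk.
  have := EX _ (tv _ _ (loops0 s) lk); rewrite (dvar_calH (loops0 s) lk).
  rewrite /Omega_Theta /Omega/= dTheta0l !inner0r mulr0 !subr0 addr0 => h.
  by rewrite innerC -h; apply/esym; exact: innerZl.
split=> //; apply: (@fundamental_lemma _ s) => //; first exact: continuous_L2.
move=> xi lx; have cx := loops_continuous lx.
have := EX _ (tv _ _ lx (loops0 s)); rewrite (dvar_calH lx (loops0 s)).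
rewrite /Omega_Theta /Omega/= inner0l (dTheta_ae L1 cvel X1v cx) dTheta_velocity//.
rewrite inner_hamilton// inner0r mulr0 !sub0r => /eqP; rewrite eq_sym addrC subr_eq => /eqP h.
by apply/eqP; rewrite -subr_eq0 opprD addrA; apply/eqP; move: h; lra.
Qed.

(** The Lie derivative is pulled back from the base and ignores [kappa], which forces the first
    component to vanish; the magnetic term then drops out of the second. *)
Lemma Y_Theta_eqL2 : eqL2 (Y_Theta b (z, eta)).1 0 /\
  eqL2 (Y_Theta b (z, eta)).2 euler_expr.
Proof.
rewrite /Y_Theta; set S := (X in xget 0 X).
have Lie xi : loops s setT xi -> Lie_nu_Theta b z xi = inner euler_expr xi.
  move=> lx; rewrite (Lie_nu_ThetaE open_Q periodic_b hA cz Zz lz z0 lx).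
  by rewrite (innerZl _ (loops_continuous lx) ca).
have L20 : L2 (0 : R -> C) by apply: continuous_L2; exact: cst_continuous.
have [] : S (xget 0 S).
  apply: xgetPex; exists (0, euler_expr); split => //; first exact: continuous_L2.
  move=> [xi kappa] /tangent2E[/= lx lk]; rewrite Lie//.
  by rewrite /Omega_Theta /Omega/= inner0r subr0 dTheta0l addr0.
move: (xget 0 S) => -[Y1 Y2] /= L1 L2' EY.
have tv xi kappa : loops s setT xi -> loops s setT kappa -> tangent2 (z, eta) (xi, kappa).
  by move=> lx lk; rewrite /tangent2/= tangent_z.
have c0 : continuous (0 : R -> C) by exact: cst_continuous.
have Y1v : eqL2 Y1 0.
  apply: (@fundamental_lemma _ s) => // kappa lk.
  have := EY _ (tv _ _ (loops0 s) lk); rewrite (Lie _ (loops0 s)).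
  rewrite /Omega_Theta /Omega/= dTheta0r !inner0r addr0 sub0r => /eqP.
  by rewrite oppr_eq0 inner0l innerC => /eqP.
split=> //; apply: (@fundamental_lemma _ s) => //; first exact: continuous_L2.
move=> xi lx; have cx := loops_continuous lx.
have := EY _ (tv _ _ lx (loops0 s)); rewrite (Lie _ lx) => <-.
rewrite /Omega_Theta /Omega/= inner0l subr0 (dTheta_ae_l L1 c0 Y1v cx) dTheta0l addr0//.
Qed.

Definition force_fun t : C := (4 * norm2 z ^+ 2)^-1 *:
  (Lorentz b z eta t - (4 * enorm (z 0) ^+ 2) *: adot b (tz z t) (z t)).
Definition kepler_fun t : C := ((norm2 eta ^+ 2 - 8) / (4 * norm2 z ^+ 4)) *: z t.

Definition force_expr t : C :=
  (4 * N)^-1 *: (lorentz_expr b z eta t - (4 * sqn z 0) *: adq b z t).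

Let force_scalar : (4 * N)^-1 * (4 * sqn z 0) = sqn z 0 / N.
Proof. by move: NN; move: (inner z z) (sqn z 0) => n q n0; field. Qed.

Lemma force_eqL2 : eqL2 force_fun force_expr.
Proof.
apply: ae_imply (Lorentz_eqL2 ce) => t e t01; rewrite /force_fun /force_expr.
have t0 : 0 <= t by move: t01; rewrite in_itv/= => /andP[].
by rewrite norm2_sq enorm_sq (e t01) (tzE _ t0).
Qed.

Lemma kepler_funE : kepler_fun = (fun t => kepler_coeff *: z t).
Proof. by apply/funext => t; rewrite /kepler_fun norm2_sq norm2_4. Qed.

Lemma rhs1_eqL2 : eqL2 (X_Theta b (z, eta) + Y_Theta b (z, eta)).1 velocity_expr.
Proof.
have [X1 _] := X_Theta_eqL2; have [Y1 _] := Y_Theta_eqL2.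
by have := eqL2D X1 Y1; rewrite addr0.
Qed.

Lemma rhs2_eqL2 :
  eqL2 (X_Theta b (z, eta) + Y_Theta b (z, eta)).2 (kepler_fun + force_fun).
Proof.
have [_ X2] := X_Theta_eqL2; have [_ Y2] := Y_Theta_eqL2.
apply: (eqL2_trans (eqL2D X2 Y2)).
apply: (eqL2_trans _ (eqL2D (eqL2_refl kepler_fun) (eqL2_sym force_eqL2))).
apply: aeW => t _; rewrite kepler_funE -[LHS]/(hamilton_expr t + euler_expr t).
rewrite -[RHS]/(kepler_coeff *: z t + force_expr t) /hamilton_expr -addrA; congr (_ + _).
have alg (k l m : R) (u v : C) : k * l = m -> k *: u + (- m) *: v = k *: (u - l *: v).
  by move=> <-; rewrite scalerBr scalerA scaleNr.
exact: alg force_scalar.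
Qed.

(** [lorentz_expr] is linear in its momentum, so the factor 4 N of [eta] cancels the prefactor. *)
Lemma force_grad t : eta = (fun t => (4 * N) *: derive1 z t) ->
  force_expr t = grad_expr t.
Proof.
move=> etaE; rewrite /force_expr /grad_expr.
have -> : lorentz_expr b z eta t = (4 * N) *: lorentz_expr b z (derive1 z) t.
  by rewrite etaE; exact: (lorentz_exprZ (4 * N) t cdz).
have N4 : 4 * N != 0 by rewrite mulf_neq0// pnatr_eq0.
by rewrite scalerBr !scalerA (mulVf N4) scale1r force_scalar.
Qed.

(** The pointwise form in which the variational and the vector field sides meet. It has the gradient
    in place of the [xget]-chosen force. *)
Definition hamilton_eqs : Prop := derive1 z = velocity_expr /\
  forall t, 0 <= t < 1 -> derive1 eta t = kepler_coeff *: z t + grad_expr t.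

Lemma velocity_eta : derive1 z = velocity_expr <-> eta = (fun t => (4 * N) *: derive1 z t).
Proof.
have N4 : 4 * N != 0 by rewrite mulf_neq0// pnatr_eq0.
split=> [->|e]; apply/funext => t; rewrite /velocity_expr.
  by rewrite scalerA mulfV// scale1r.
by rewrite [in RHS]e scalerA mulVf// scale1r.
Qed.

Lemma velocity_loops : loops s setT velocity_expr.
Proof. exact: scaleN_loops le (4 * N)^-1. Qed.

Lemma loops_eq (u v : R -> C) : loops s setT u -> loops s setT v ->
  (forall t, 0 <= t < 1 -> u t = v t) -> u = v.
Proof.
move=> [_ _ pu] [_ _ pv] uv; apply/funext => t; apply/eqP; rewrite -subr_eq0; apply/eqP.
have h0 : (fun t => u t - v t) = 0.
  apply: (@periodic_eq0 _ s) => [x|x x01]; first by rewrite pu pv scalerBr.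
  by rewrite uv// subrr.
exact: (congr1 (fun f => f t) h0).
Qed.

Lemma velocity_eqL2P : eqL2 (derive1 z) velocity_expr <-> derive1 z = velocity_expr.
Proof.
split=> [e|->]; last exact: eqL2_refl.
exact: (loops_eq ldz velocity_loops (continuous_eqL2 cdz cvel e)).
Qed.

Lemma eqL2_pointwise (u v : R -> C) : (forall t, 0 <= t < 1 -> u t = v t) -> eqL2 u v.
Proof.
move=> uv; apply: ae_imply (@ae_neq R 1) => t t1; rewrite in_itv/= => /andP[t0 tl1].
by apply: uv; rewrite t0 lt_neqAle t1.
Qed.

(** The two second equations have different right-hand sides in general; they are identified only
    after the first equation has fixed [eta] as 4 N z'. *)
Lemma hamilton_eqsP : derive1 z = velocity_expr /\
  eqL2 (derive1 eta) (kepler_fun + force_fun) <-> hamilton_eqs.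
Proof.
have cg := grad_expr_continuous.
have ckg : continuous (fun t => kepler_coeff *: z t + grad_expr t).
  exact: (add_continuous_fun (scale_continuous (k := kepler_coeff) cz) cg).
have key : derive1 z = velocity_expr ->
    eqL2 (kepler_fun + force_fun) (fun t => kepler_coeff *: z t + grad_expr t).
  move=> /velocity_eta etaE.
  apply: (eqL2_trans (eqL2D (eqL2_refl kepler_fun) force_eqL2)).
  by apply: aeW => t _; rewrite kepler_funE -(force_grad t etaE).
split=> -[vz h]; (split; first exact: vz).
  exact: (continuous_eqL2 cde ckg (eqL2_trans h (key vz))).
exact: (eqL2_trans (eqL2_pointwise h) (eqL2_sym (key vz))).
Qed.

Definition euler_hamilton_at : Prop :=
  eqL2 (derive1 z) (X_Theta b (z, eta) + Y_Theta b (z, eta)).1 /\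
  eqL2 (derive1 eta) (X_Theta b (z, eta) + Y_Theta b (z, eta)).2.

Lemma euler_hamilton_atP : euler_hamilton_at <->
  derive1 z = velocity_expr /\ eqL2 (derive1 eta) (kepler_fun + force_fun).
Proof.
split=> -[h1 h2]; split.
- by apply/velocity_eqL2P; exact: eqL2_trans h1 rhs1_eqL2.
- exact: eqL2_trans h2 rhs2_eqL2.
- by rewrite h1; exact: eqL2_sym rhs1_eqL2.
- exact: eqL2_trans h2 (eqL2_sym rhs2_eqL2).
Qed.

Definition critical_at : Prop := forall v, tangent2 (z, eta) v ->
  is_derive (0 : R) 1 (fun e : R => action b ((z, eta) + e *: v)) 0.

Lemma critical_atP : critical_at <-> hamilton_eqs.
Proof.
have cg := grad_expr_continuous.
have ckg : continuous (fun t => kepler_coeff *: z t + grad_expr t).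
  exact: (add_continuous_fun (scale_continuous (k := kepler_coeff) cz) cg).
pose u1 t := derive1 z t - (4 * N)^-1 *: eta t.
pose u2 t := kepler_coeff *: z t + grad_expr t - derive1 eta t.
have cu1 : continuous u1 := sub_continuous_fun cdz cvel.
have cu2 : continuous u2 := sub_continuous_fun ckg cde.
have c0 : continuous (0 : R -> C) by exact: cst_continuous.
have L20 := continuous_L2 c0.
have tv xi kappa : loops s setT xi -> loops s setT kappa -> tangent2 (z, eta) (xi, kappa).
  by move=> lx lk; rewrite /tangent2/= tangent_z.
split=> [crit|[vz ve] [xi kappa] /tangent2E[/= lx lk]].
  have D xi kappa (lx : loops s setT xi) (lk : loops s setT kappa) :
      inner u1 kappa + inner u2 xi = 0.
    have [_ d1] := is_derive_action lx lk; have [_ d2] := crit _ (tv _ _ lx lk).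
    by rewrite -d2 -d1.
  have u10 : eqL2 u1 0.
    apply: (fundamental_lemma (continuous_L2 cu1) L20 (s := s)) => kappa lk.
    by have := D _ _ (loops0 s) lk; rewrite inner0r addr0 inner0l.
  have u20 : eqL2 u2 0.
    apply: (fundamental_lemma (continuous_L2 cu2) L20 (s := s)) => xi lx.
    by have := D _ _ lx (loops0 s); rewrite inner0r add0r inner0l.
  have v1 := continuous_eqL2 cu1 c0 u10; have v2 := continuous_eqL2 cu2 c0 u20.
  split; first apply: (loops_eq ldz velocity_loops) => t t01.
    by apply/eqP; rewrite -subr_eq0; apply/eqP; exact: v1.
  by move=> t t01; apply/esym/eqP; rewrite -subr_eq0; apply/eqP; exact: v2.
apply: (is_derive_eq (is_derive_action lx lk)).
have -> : inner (fun t => derive1 z t - (4 * N)^-1 *: eta t) kappa = 0.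
  rewrite -[RHS](Int0 0 1); apply: eq_Int => t _.
  by rewrite vz /velocity_expr subrr /dot0/= !mul0r addr0.
rewrite add0r; transitivity (inner 0 xi); last exact: inner0l.
(* The second equation gives [u2 = 0] on [0,1[ only, so [u2] is replaced by 0 in the L^2 sense. *)
rewrite ![inner _ xi]innerC; apply: (inner_ae (continuous_L2 cu2) c0) (loops_continuous lx).
by apply: eqL2_pointwise => t t01; rewrite /u2 ve// subrr.
Qed.

End AtPoint.
End EulerHamilton.

(** * The gradient written out *)

Section ExplicitForm.
Context {R : realType}.
Local Notation C := (R * R)%type.
Variables (Q : set C) (b : R -> C -> C) (s : bool) (z : R -> C).
Local Notation Z := (varsigma @^-1` Q).
Hypotheses (lz : loops s Z z) (z0 : z <> 0).
Hypothesis ca : continuous (adq b z).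

(** The time variation along z' is (|z_t|^2 - |z_0|^2) / N. Its |z_0|^2 cancels against the Euler
    term, which is why the explicit equation retains only |z_t|^2 in front of the time derivative of
    the coefficients. *)
Lemma grad_exprE t : 0 <= t < 1 -> grad_expr b z t =
  - (2 / norm2 z ^+ 4 *
      Int 0 1 (fun u => Int 0 u (fun sigma => enorm (z sigma) ^+ 2) *
                        dot0 (adot b (tz z u) (z u)) (derive1 z u))) *: z t
  + (2 / norm2 z ^+ 2 *
      Int t 1 (fun sigma => dot0 (adot b (tz z sigma) (z sigma)) (derive1 z sigma))) *: z t
  - (enorm (z t) ^+ 2 / norm2 z ^+ 2) *: adot b (tz z t) (z t)
  - rot_a b (tz z t) (z t) *: imul (derive1 z t).
Proof.
move=> /andP[t0 t1]; have cz := loops_continuous lz.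
have cdz := loops_continuous (loops_derive1 lz).
have cg : continuous (fun u => dot0 (adq b z u) (derive1 z u)) by solve_cont.
rewrite norm2_sq norm2_4 enorm_sq (tzE _ t0) -[adot b (tq z t) _]/(adq b z t).
rewrite -[rot_a b (tq z t) _]/(roq b z t).
have -> : Int 0 1 (fun u => Int 0 u (fun sigma => enorm (z sigma) ^+ 2) *
      dot0 (adot b (tz z u) (z u)) (derive1 z u)) =
    Int 0 1 (fun u => prim (sqn z) u * dot0 (adq b z u) (derive1 z u)).
  apply: eq_Int => u /andP[u0 _]; rewrite (tzE _ u0) (prim_ge0 _ u0); congr (_ * _).
  by apply: eq_Int => x _; rewrite enorm_sq.
have -> : Int t 1 (fun sigma => dot0 (adot b (tz z sigma) (z sigma)) (derive1 z sigma)) =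
    prim (fun u => dot0 (adq b z u) (derive1 z u)) 1 -
    prim (fun u => dot0 (adq b z u) (derive1 z u)) t.
  rewrite -(Int_prim cg (ltW t1)); apply: eq_Int => u /andP[tu _].
  by rewrite (tzE _ (le_trans t0 tu)).
rewrite /grad_expr /lorentz_expr (dtq_derive1 cz lz z0) -/(sqn z t).
have NN : inner z z != 0 by rewrite gt_eqF// (loops_inner_gt0 lz z0).
have alg (x y q q0 r p k n : R) (u v w : C) : n != 0 ->
    - r *: w - ((q - q0) / n) *: v + (2 / n * p) *: u - (2 / n ^+ 2 * k) *: u - (q0 / n) *: v =
    - (2 / n ^+ 2 * k) *: u + (2 / n * p) *: u - (q / n) *: v - r *: w.
  move=> n0; apply: pair_ext; rewrite /= /GRing.scale/=; field; exact: n0.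
exact: (alg 0 0).
Qed.

End ExplicitForm.

(** * The sign involution *)

Section SignInvariance.
Context {R : realType}.
Local Notation C := (R * R)%type.
Variable b : R -> C -> C.
Implicit Types (z eta : R -> C).

Lemma loopsN s z : loops s setT z -> loops s setT (- z).
Proof.
move=> lz; have := scaleN_loops lz (- 1); rewrite (_ : (fun t => _) = - z)//.
by apply/funext => t; rewrite scaleN1r.
Qed.

Lemma derive1_loopsN s z : loops s setT z -> derive1 (- z) = - derive1 z.
Proof.
move=> lz; apply/funext => t; apply: derive1_val.
exact: is_deriveN (loops_is_derive lz t).
Qed.

Lemma dot0NN (v w : C) : dot0 (- v) (- w) = dot0 v w.
Proof. by rewrite /dot0/= !mulrNN. Qed.

Lemma innerNN z eta : inner (- z) (- eta) = inner z eta.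
Proof. by apply: eq_Int => t _; rewrite -[RHS]dot0NN. Qed.

Lemma norm2N z : norm2 (- z) = norm2 z.
Proof. by rewrite /norm2 innerNN. Qed.

Lemma tzN z t : tz (- z) t = tz z t.
Proof.
rewrite /tz norm2N; congr (_ * _); apply: eq_Int => u _.
by rewrite !enorm_sq -[RHS]dot0NN.
Qed.

Lemma avecN t (w : C) : avec b t (- w) = - avec b t w.
Proof. by have := avec_sign b true t w; rewrite expr1 !scaleN1r. Qed.

Lemma actionN s z eta : loops s setT z -> loops s setT eta ->
  action b (- z, - eta) = action b (z, eta).
Proof.
move=> lz le; rewrite /action/= (derive1_loopsN lz) innerNN; congr (_ + _ - _).
  apply: eq_Int => t _; rewrite !vartheta_dot0 tzN -[RHS]dot0NN -avecN//.
by rewrite /calH/= !norm2N.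
Qed.

Lemma phase_classP (p q : (R -> C) * (R -> C)) :
  phase_class p = phase_class q <-> p = q \/ p = - q.
Proof.
split=> [/eqP|pq].
  by rewrite eqmodE => /orP[/eqP ->|/eqP ->]; [left|right].
apply/eqP; rewrite eqmodE /sign_equiv/= /sign_rel.
by case: pq => ->; rewrite eqxx ?orbT.
Qed.

Lemma phase_reprK (q : @phaseQ R) : phase_class (phase_repr q) = q.
Proof. exact: reprK. Qed.

(** [phase_repr] may return either sign, and may switch along a curve of classes. Invariance of the
    action under the sign makes the choice harmless. *)
Lemma actionQE s z eta : loops s setT z -> loops s setT eta ->
  actionQ b (phase_class (z, eta)) = action b (z, eta).
Proof.
move=> lz le; rewrite /actionQ.
have /phase_classP[->//|->] := phase_reprK (phase_class (z, eta)).
exact: actionN lz le.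
Qed.

End SignInvariance.

Theorem theorem5p13 (R : realType) (Q : set (R * R))
    (b : R -> R * R -> R * R)
    (open_Q : open Q) (Q0 : Q 0)
    (smooth_b : smooth_on ([set: R] `*` Q) (fun x : R * (R * R) => b x.1 x.2))
    (periodic_b : forall t w, Q w -> b (t + 1) w = b t w) :
  let Z : set (R * R) := varsigma @^-1` Q in
  let velocity (z eta : R -> R * R) : R -> R * R :=
    fun tau => (4 * norm2 z ^+ 2)^-1 *: eta tau in
  let kepler (z eta : R -> R * R) : R -> R * R :=
    fun tau => ((norm2 eta ^+ 2 - 8) / (4 * norm2 z ^+ 4)) *: z tau in
  let force (z eta : R -> R * R) : R -> R * R :=
    fun tau => (4 * norm2 z ^+ 2)^-1 *:
      (Lorentz b z eta tau
       - (4 * enorm (z 0) ^+ 2) *: adot b (tz z tau) (z tau)) in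
  [/\
    [set q | cotangent Z q /\ critical b q] =
    [set q | cotangent Z q /\ Euler_Hamilton b q],
    forall z eta, cotangent_cover Z (z, eta) ->
      [/\ eqL2 (X_Theta b (z, eta) + Y_Theta b (z, eta)).1 (velocity z eta),
          eqL2 (X_Theta b (z, eta) + Y_Theta b (z, eta)).2
               (kepler z eta + force z eta)
        & Euler_Hamilton b (phase_class (z, eta)) <->
          derive1 z = velocity z eta /\ eqL2 (derive1 eta) (kepler z eta + force z eta)],
    forall z eta, cotangent_cover Z (z, eta) ->
      eta = (fun tau => (4 * norm2 z ^+ 2) *: derive1 z tau) ->
      eqL2 (force z eta) (gradM b z)
  & forall z eta, cotangent_cover Z (z, eta) ->
      Euler_Hamilton b (phase_class (z, eta)) <->
      derive1 z = velocity z eta /\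
      forall tau : R, 0 <= tau < 1 ->
        derive1 eta tau =
          kepler z eta tau
          - (2 / norm2 z ^+ 4 *
             Int 0 1 (fun s => Int 0 s (fun sigma => enorm (z sigma) ^+ 2) *
                               dot0 (adot b (tz z s) (z s)) (derive1 z s)))
              *: z tau
          + (2 / norm2 z ^+ 2 *
             Int tau 1 (fun sigma =>
               dot0 (adot b (tz z sigma) (z sigma)) (derive1 z sigma))) *: z tau
          - (enorm (z tau) ^+ 2 / norm2 z ^+ 2)
              *: adot b (tz z tau) (z tau)
          - rot_a b (tz z tau) (z tau) *: imul (derive1 z tau)].
Proof.
move=> Z velocity kepler force.
have [A1 [A2 hA]] := avec_diff open_Q smooth_b.
have nz (z : R -> R * R) : ~ (z = 0) -> z <> 0 by [].
(* [Z] is symmetric because [varsigma] is even. *)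
have coverN p : cotangent_cover Z p -> cotangent_cover Z (- p).
  case: p => z eta [s [[/= lz /nz z0] le]]; exists s => /=.
  split; last exact: loopsN le.
  split; last by move=> /= /(congr1 -%R); rewrite opprK oppr0.
  have [lz1 _ lz3] := loopsN (loops_setT lz); split=> // t.
  have [_ Zz _] := lz; have := Zz t.
  by rewrite /Z /= /varsigma -[(- z) t]/(- z t)/= !sqrrN !mulrNN.
have velE z eta : velocity z eta = velocity_expr z eta.
  by apply/funext => t; rewrite /velocity norm2_sq.
have lift p q : cotangent_cover Z q -> phase_class p = phase_class q -> cotangent_cover Z p.
  by move=> cq /phase_classP[->|->] //; exact: coverN.
(* Along tangent directions the perturbed pair keeps its parity, so the action on the quotient
   agrees with the one on the lift for every [e], as functions. *)
have crit_action z eta (cp : cotangent_cover Z (z, eta)) : critical_at b z eta <->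
    forall v, tangent2 (z, eta) v -> is_derive (0 : R) 1
      (fun e : R => actionQ b (phase_class ((z, eta) + e *: v))) 0.
  case: cp => s [[/= lz /nz z0] le].
  split=> h [xi kappa] tv; have := h _ tv; (have -> : (fun e : R => action b ((z, eta) + e *: (xi, kappa))) =
    (fun e => actionQ b (phase_class ((z, eta) + e *: (xi, kappa)))); last by []).
    apply/funext => e; have [lx lk] := tangent2E lz z0 tv.
    by rewrite (actionQE b (loops_addZ e lz lx) (loops_addZ e le lk)).
  apply/funext => e; have [lx lk] := tangent2E lz z0 tv.
  by rewrite (actionQE b (loops_addZ e lz lx) (loops_addZ e le lk)).
have at_equiv z eta (cp : cotangent_cover Z (z, eta)) :
    critical_at b z eta <-> euler_hamilton_at b z eta.
  case: cp => s [[/= lz /nz z0] le].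
  have h1 := critical_atP open_Q periodic_b hA lz z0 le.
  have h2 := hamilton_eqsP hA lz z0 le.
  have h3 := euler_hamilton_atP open_Q periodic_b hA lz z0 le.
  by rewrite h1 -h2 h3.
have critN z eta (cp : cotangent_cover Z (z, eta)) :
    critical_at b z eta -> critical_at b (- z) (- eta).
  case: cp => s [[/= lz /nz z0] le] h [xi kappa] [/= tx tk].
  have zN0 : - z <> 0 by move=> /(congr1 -%R); rewrite opprK oppr0.
  have lzN := loopsN (loops_setT lz).
  rewrite (tangentE lzN zN0) in tx tk.
  have lx := loopsN tx; have lk := loopsN tk.
  (* The curve through the opposite lift is the negative of the curve through [(z, eta)] with
     opposite velocity. *)
  have tv : tangent2 (z, eta) (- xi, - kappa).
    by rewrite /tangent2/= (tangentE lz z0).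
  rewrite (_ : (fun e : R => action b ((- z, - eta) + e *: (xi, kappa))) =
    (fun e => action b ((z, eta) + e *: (- xi, - kappa)))); first exact: h.
  apply/funext => e.
  have oppE (x y : R -> R * R) : - x + e *: y = - (x + e *: - y).
    by rewrite scalerN opprB addrC.
  have -> : (- z, - eta) + e *: (xi, kappa) = (- (z + e *: - xi), - (eta + e *: - kappa)).
    by rewrite -!oppE.
  exact: (actionN b (loops_addZ e lz lx) (loops_addZ e le lk)).
(* [Euler_Hamilton] asks for the equation at both lifts, where the fields come from separate [xget]
   choices. Transfer from one lift to the other goes through criticality, which is visibly invariant
   under the sign. *)
have EHP z eta (cp : cotangent_cover Z (z, eta)) :
    Euler_Hamilton b (phase_class (z, eta)) <-> euler_hamilton_at b z eta.
  split=> [h|h p pc]; first exact: (h (z, eta) erefl).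
  have /phase_classP[->//|->] := pc.
  apply/at_equiv; first exact: coverN cp.
  by apply: critN => //; apply/at_equiv.
split.
- apply/seteqP; split=> q [cq h]; split=> //.
    move=> [z eta] pc; have [q0 cq0 qE] := cq.
    have cp : cotangent_cover Z (z, eta) by apply: lift cq0 _; rewrite pc.
    apply/(at_equiv _ _ cp)/(crit_action _ _ cp) => v tv; exact: h.
  move=> [z eta] v pc tv; have [q0 cq0 qE] := cq.
  have cp : cotangent_cover Z (z, eta) by apply: lift cq0 _; rewrite pc.
  suff : critical_at b z eta by move=> /(crit_action _ _ cp); exact.
  by apply/(at_equiv _ _ cp)/(EHP _ _ cp); rewrite pc.
- move=> z eta cp; have [s [[/= lz /nz z0] le]] := cp; rewrite velE; split.
  + exact: (rhs1_eqL2 open_Q periodic_b hA lz z0 le).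
  + exact: (rhs2_eqL2 open_Q periodic_b hA lz z0 le).
  + by rewrite (EHP _ _ cp); exact: (euler_hamilton_atP open_Q periodic_b hA lz z0 le).
- move=> z eta cp etaE; have [s [[/= lz /nz z0] le]] := cp.
  apply: (eqL2_trans (force_eqL2 hA lz z0 le)).
  apply: (eqL2_trans _ (eqL2_sym (gradM_eqL2 open_Q periodic_b hA lz z0))).
  apply: aeW => t _; apply: (force_grad hA lz z0).
  by rewrite etaE; apply/funext => u; rewrite norm2_sq.
- move=> z eta cp; have [s [[/= lz /nz z0] le]] := cp; rewrite (EHP _ _ cp).
  rewrite (euler_hamilton_atP open_Q periodic_b hA lz z0 le).
  rewrite (hamilton_eqsP hA lz z0 le) velE.
  have cz := loops_continuous lz; have Zz t : Z (z t) by case: lz.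
  have ca := adq_continuous hA cz Zz.
  (* Uses the gradient formula in z' itself, so the last part follows from [hamilton_eqs] with the
     momentum confined to the Kepler term. *)
  have gE t : 0 <= t < 1 -> kepler_coeff z eta *: z t + grad_expr b z t =
      kepler z eta t
      - (2 / norm2 z ^+ 4 *
         Int 0 1 (fun s => Int 0 s (fun sigma => enorm (z sigma) ^+ 2) *
                           dot0 (adot b (tz z s) (z s)) (derive1 z s))) *: z t
      + (2 / norm2 z ^+ 2 *
         Int t 1 (fun sigma =>
           dot0 (adot b (tz z sigma) (z sigma)) (derive1 z sigma))) *: z t
      - (enorm (z t) ^+ 2 / norm2 z ^+ 2) *: adot b (tz z t) (z t)
      - rot_a b (tz z t) (z t) *: imul (derive1 z t).
    move=> t01; rewrite (grad_exprE lz z0 ca t01) scaleNr !addrA.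
    by rewrite -[kepler z eta t]/(kepler_fun z eta t) kepler_funE.
  split=> -[vz h]; split; try exact: vz; move=> t t01.
    by rewrite -(gE _ t01); exact: h.
  by rewrite (gE _ t01); exact: h.
Qed.
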